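(* Let $D\subset\mathbb{C}^d$ be a domain, let $\varphi$ be a positive real analytic function on $D$, let $d_0\ge1$ be an integer, and let $$\Omega=\{(\xi,z)\in\mathbb{C}^{d_0}\times D:\ \|\xi\|^2<\varphi(z)\}.$$ Let $g^D$ and $g^\Omega$ be the Kähler metrics on $D$ and $\Omega$ with Kähler forms $-\frac{\sqrt{-1}}{2}\partial\bar\partial\log\varphi$ and $-\frac{\sqrt{-1}}{2}\partial\bar\partial\log(\varphi(z)-\|\xi\|^2)$ respectively. Suppose that $\Omega$ is a simply connected circular domain with center zero and that $-\log\varphi$ is the diastatic function of $g^D$ centered at the origin. Let $n\ge1$ be an integer. If $(D,g^D)$ admits a Kähler immersion into $(\mathbb{C}^n,g_0)$ or $(\mathbb{C}^\infty,g_0)$, and $(D,g^D)$ is not relative to $(\mathbb{C}^n,g_0)$, then $(\Omega,g^\Omega)$ is not relative to $(\mathbb{C}^n,g_0)$.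
   Context: Standing assumption: $-\frac{\sqrt{-1}}{2}\partial\bar\partial\log\varphi$ and $-\frac{\sqrt{-1}}{2}\partial\bar\partial\log(\varphi-\|\xi\|^2)$ are positive definite, so that $g^D,g^\Omega$ are (real analytic) Kähler metrics. Circular with center zero: the domain contains $0$ and is invariant under $x\mapsto e^{\sqrt{-1}\theta}x$ for all $\theta\in\mathbb{R}$. Diastatic function (Calabi): if $\psi$ is a real analytic local Kähler potential ($\omega=\frac{\sqrt{-1}}{2}\partial\bar\partial\psi$) with polarization $\psi(z,w)$ (holomorphic, $\psi(z,\bar z)=\psi(z)$), the diastatic function centered at $p$ is $z\mapsto\psi(z,\bar z)+\psi(p,\bar p)-\psi(z,\bar p)-\psi(p,\bar z)$; it is a Kähler potential independent of the choice of $\psi$. $g_0$ is the flat metric on $\mathbb{C}^n$ ($n\le\infty$, with $\mathbb{C}^\infty=\ell^2(\mathbb{C})$), with Kähler form $\frac{\sqrt{-1}}{2}\partial\bar\partial\sum_j|z_j|^2$. A Kähler immersion is a holomorphic immersion which is isometric (pulls back the target Kähler form to the source Kähler form). Two Kähler manifolds are relatives if they have a common Kähler submanifold of positive dimension with their induced metrics, i.e. there are a complex manifold $S$ of positive dimension and holomorphic immersions of $S$ into both inducing the same Kähler metric on $S$. *)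

(* Defs.v *)
From HB Require Import structures.
From mathcomp Require Import all_boot all_order all_algebra.
From mathcomp Require Import complex ring lra.
From mathcomp Require Import all_classical all_reals all_analysis.

Set Implicit Arguments.
Unset Strict Implicit.
Unset Printing Implicit Defensive.

Import Order.TTheory GRing.Theory Num.Theory.
Import numFieldNormedType.Exports.
Import ComplexField.Normc.

Local Open Scope classical_set_scope.
Local Open Scope ring_scope.
Local Open Scope complex_scope.

(* C is a normed module over itself; this also gives 'rV[R[i]]_m its topology *)
HB.instance Definition _ (R : rcfType) := NormedModule.copy R[i] R[i]^o.

Section l2.
Variable R : realType.
Local Notation C := R[i].

Definition sqsummable : {pred nat -> C} :=
  [pred a : nat -> C | `[< cvgn (series (fun j => normc (a j) ^+ 2)) >]].

Lemma sqsummableP (a : nat -> C) :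
  reflect (cvgn (series (fun j => normc (a j) ^+ 2))) (a \in sqsummable).
Proof. by rewrite inE; exact: asboolP. Qed.

Lemma normc_ge0 (a : C) : 0 <= normc a.
Proof. by case: a => x y; rewrite /= sqrtr_ge0. Qed.

(* the termwise estimate behind closure under addition and the triangle
   inequality *)
Lemma normc_sqD (a b : C) (s t : R) : 0 < s -> 0 < t ->
  normc (a + b) ^+ 2 <=
    (s + t) / s * normc a ^+ 2 + (s + t) / t * normc b ^+ 2.
Proof.
move=> s0 t0; apply: (@le_trans _ _ ((normc a + normc b) ^+ 2)).
  by rewrite lerXn2r ?nnegrE ?addr_ge0 ?normc_ge0// le_normcD.
set u := normc a; set v := normc b; rewrite -subr_ge0.
rewrite (_ : _ - _ = (s * t)^-1 * (t * u - s * v) ^+ 2); last first.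
  by field; rewrite !gt_eqF.
by rewrite mulr_ge0 ?sqr_ge0// invr_ge0 mulr_ge0 ?ltW.
Qed.

Lemma sqsummable_cvgD (a b : nat -> C) (s t : R) :
  a \in sqsummable -> b \in sqsummable ->
  cvgn (series (fun j => s * normc (a j) ^+ 2 + t * normc (b j) ^+ 2)).
Proof.
move=> /sqsummableP ca /sqsummableP cb.
exact: (is_cvg_seriesD (is_cvg_seriesZ (k:=s) ca) (is_cvg_seriesZ (k:=t) cb)).
Qed.

Lemma sqsummableD (a b : nat -> C) :
  a \in sqsummable -> b \in sqsummable -> a + b \in sqsummable.
Proof.
move=> sa sb; apply/sqsummableP.
apply: (series_le_cvg _ _ _ (@sqsummable_cvgD a b 2 2 sa sb)) => j.
- exact: sqr_ge0.
- by rewrite addr_ge0// mulr_ge0// sqr_ge0.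
- have := @normc_sqD (a j) (b j) 1 1 ltr01 ltr01.
  by rewrite divr1.
Qed.

Lemma sqsummableZ (k : R[i]) (a : nat -> C) :
  a \in sqsummable -> k *: a \in sqsummable.
Proof.
move=> /sqsummableP ca; apply/sqsummableP.
rewrite (_ : (fun _ => _) = (normc k ^+ 2) *: (fun j => normc (a j) ^+ 2)).
  exact: is_cvg_seriesZ.
by apply/funext => j; rewrite [LHS](_ : _ = normc (k * a j) ^+ 2)// normcM exprMn.
Qed.

Fact sqsummable_submod : submod_closed sqsummable.
Proof.
split=> [|k a b sa sb]; last by apply: sqsummableD => //; exact: sqsummableZ.
apply/sqsummableP; rewrite (_ : series _ = cst 0); first exact: is_cvg_cst.
apply/funext => n; rewrite /series /= big1// => j _; rewrite /normc /=.
by rewrite expr0n /= addr0 sqrtr0 expr0n.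
Qed.

HB.instance Definition _ :=
  GRing.isSubmodClosed.Build _ _ sqsummable sqsummable_submod.

Record l2 := L2 { l2val :> nat -> C; l2P : l2val \in sqsummable }.

HB.instance Definition _ := [isSub for l2val].
HB.instance Definition _ := [Choice of l2 by <:].
HB.instance Definition _ := [SubChoice_isSubLmodule of l2 by <:].

Definition l2sq (a : l2) : R := limn (series (fun j => normc (a j) ^+ 2)).

Definition l2norm (a : l2) : R[i] := (Num.sqrt (l2sq a))%:C.

Lemma l2_cvg (a : l2) : cvgn (series (fun j => normc (a j) ^+ 2)).
Proof. exact/sqsummableP/l2P. Qed.

Lemma l2sq_ge (a : l2) j : normc (a j) ^+ 2 <= l2sq a.
Proof.
apply: (@le_trans _ _ (series (fun j => normc (a j) ^+ 2) j.+1)).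
  rewrite /series /= big_nat_recr//= lerDr.
  by apply: sumr_ge0 => i _; exact: sqr_ge0.
apply: nondecreasing_cvgn_le; last exact: l2_cvg.
by apply: nondecreasing_series => i _ _; exact: sqr_ge0.
Qed.

Lemma l2sq_ge0 (a : l2) : 0 <= l2sq a.
Proof. exact: le_trans (sqr_ge0 _) (l2sq_ge a 0). Qed.

Lemma l2sq_eq0 (a : l2) : l2sq a = 0 -> a = 0.
Proof.
move=> a0; apply/val_inj/funext => j /=; apply: eq0_normc.
have := l2sq_ge a j; rewrite a0 => h; apply/eqP; rewrite -sqrf_eq0.
by rewrite eq_le h sqr_ge0.
Qed.

Lemma l2norm_eq0 (a : l2) : l2norm a = 0 -> a = 0.
Proof.
move=> /(congr1 (@complex.Re R)) /= /eqP; rewrite sqrtr_eq0 => a0.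
by apply: l2sq_eq0; apply/eqP; rewrite eq_le a0 l2sq_ge0.
Qed.

Lemma l2normZ (k : R[i]) (a : l2) : l2norm (k *: a) = `|k| * l2norm a.
Proof.
rewrite /l2norm.
have -> : l2sq (k *: a) = normc k ^+ 2 * l2sq a.
  rewrite /l2sq -[RHS](lim_seriesZ (normc k ^+ 2) (@l2_cvg a)).
  congr (limn (series _)); apply/funext => j.
  by rewrite [LHS](_ : _ = normc (k * a j) ^+ 2)// normcM exprMn.
by rewrite sqrtrM ?sqr_ge0// sqrtr_sqr ger0_norm ?normc_ge0// rmorphM.
Qed.

Lemma l2normD (a b : l2) : l2norm (a + b) <= l2norm a + l2norm b.
Proof.
rewrite /l2norm -rmorphD lecR.
have [a0|a0] := eqVneq (l2sq a) 0.
  by rewrite (l2sq_eq0 a0) add0r lerDr sqrtr_ge0.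
have [b0|b0] := eqVneq (l2sq b) 0.
  by rewrite (l2sq_eq0 b0) addr0 lerDl sqrtr_ge0.
set s := Num.sqrt (l2sq a); set t := Num.sqrt (l2sq b).
have s0 : 0 < s by rewrite sqrtr_gt0 lt_neqAle eq_sym a0 l2sq_ge0.
have t0 : 0 < t by rewrite sqrtr_gt0 lt_neqAle eq_sym b0 l2sq_ge0.
rewrite -(ler_pXn2r (ltn0Sn 1)) ?nnegrE ?addr_ge0 ?sqrtr_ge0//.
rewrite sqr_sqrtr ?l2sq_ge0//.
pose p := (s + t) / s; pose q := (s + t) / t.
have -> : (s + t) ^+ 2 = p * l2sq a + q * l2sq b.
  rewrite -(sqr_sqrtr (l2sq_ge0 a)) -(sqr_sqrtr (l2sq_ge0 b)) -/s -/t /p /q.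
  by field; rewrite !gt_eqF.
pose f := fun j => p * normc (a j) ^+ 2 + q * normc (b j) ^+ 2.
have cf : cvgn (series f) by exact: sqsummable_cvgD (l2P a) (l2P b).
have -> : p * l2sq a + q * l2sq b = limn (series f).
  rewrite -[p * _](lim_seriesZ p (@l2_cvg a)).
  rewrite -[q * _](lim_seriesZ q (@l2_cvg b)).
  have pa := is_cvg_seriesZ (k:=p) (@l2_cvg a).
  have qb := is_cvg_seriesZ (k:=q) (@l2_cvg b).
  exact/esym/(lim_seriesD pa qb).
apply: (lim_series_le (@l2_cvg (a + b)) cf) => j.
exact: normc_sqD.
Qed.

HB.instance Definition _ :=
  Lmodule_isNormed.Build R[i] l2 l2normD l2normZ l2norm_eq0.

End l2.

Section forms.
Variables (R : realType) (V : normedModType R[i]).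

Definition dirderiv (f : V -> R[i]) (v x : V) : R[i] :=
  derive1 (fun t : R => complex.Re (f (x + t%:C *: v))) 0 +i*
  derive1 (fun t : R => complex.Im (f (x + t%:C *: v))) 0.

(* Wirtinger derivatives in the direction of v: on C^m, they are d/dz_a and
   d/dzbar_a when v is the a-th basis vector. *)
Definition dz (f : V -> R[i]) (v x : V) : R[i] :=
  (dirderiv f v x - 'i * dirderiv f ('i *: v) x) / 2.

Definition dzbar (f : V -> R[i]) (v x : V) : R[i] :=
  (dirderiv f v x + 'i * dirderiv f ('i *: v) x) / 2.

(* kahler_form psi x u v is the value at x of the form (i/2) ddbar psi on the
   tangent vectors u, v; on C^m,
     ddbar psi = \sum_(a, b) d^2 psi / dz_a dzbar_b  dz_a /\ dzbar_b. *)
Definition kahler_form (psi : V -> R) (x u v : V) : R[i] :=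
  let psiC := fun y => (psi y)%:C in
  'i / 2 * (dz (dzbar psiC v) u x - dz (dzbar psiC u) v x).

(* u |-> omega (u, i u) is the quadratic form of the metric of the
   (1,1)-form omega. *)
Definition positive_form (U : set V) (omega : V -> V -> V -> R[i]) :=
  forall x u, U x -> u != 0 -> 0 < omega x u ('i *: u).

End forms.

Definition holomorphic_on (R : realType) (V W : normedModType R[i])
  (U : set V) (f : V -> W) := forall x, U x -> differentiable f x.

Section complex_space.
Variables (R : realType) (m : nat).
Local Notation Cm := 'rV[R[i]]_m.

Definition is_domain (U : set Cm) := [/\ open U, connected U & U !=set0].

Definition circular (U : set Cm) := U 0 /\
  forall (theta : R) x, U x -> U ((cos theta +i* sin theta) *: x).

Definition simply_connected (U : set Cm) :=
  (forall x y, U x -> U y -> exists c : R -> Cm,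
    [/\ {within `[0, 1], continuous c}, c @` `[0, 1] `<=` U,
        c 0 = x & c 1 = y]) /\
  (forall c : R -> Cm, {within `[0, 1], continuous c} ->
    c @` `[0, 1] `<=` U -> c 0 = c 1 ->
    exists H : R * R -> Cm,
      [/\ {within `[0, 1] `*` `[0, 1], continuous H},
          H @` (`[0, 1] `*` `[0, 1]) `<=` U,
          {in `[0, 1], forall t, H (0, t) = c t},
          {in `[0, 1], forall t, H (1, t) = c 0} &
          {in `[0, 1], forall s, H (s, 0) = c 0 /\ H (s, 1) = c 0}]).

(* C^m is identified with R^(2m), the coordinates being indexed by 'I_m * bool:
   (j, false) stands for Re z_j and (j, true) for Im z_j. *)
Definition real_coord (h : Cm) (i : 'I_m * bool) : R :=
  if i.2 then complex.Im (h 0 i.1) else complex.Re (h 0 i.1).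

Definition real_monomial (a : 'I_m * bool -> nat) (h : Cm) : R :=
  \prod_i real_coord h i ^+ a i.

(* The sum over the multi-indices with all components < N; convergence of a
   multiple power series is expressed with these sums, as N -> oo. *)
Definition box_sum (F : ('I_m * bool -> nat) -> R) (N : nat) : R :=
  \sum_(a : {ffun 'I_m * bool -> 'I_N}) F (fun i => a i : nat).

Definition real_analytic_on (U : set Cm) (f : Cm -> R) :=
  forall p, U p -> exists c : ('I_m * bool -> nat) -> R,
    \forall h \near (0 : Cm),
      cvgn (box_sum (fun a => `|c a * real_monomial a h|)) /\
      box_sum (fun a => c a * real_monomial a h) @ \oo --> f (p + h).

Definition sqnorm (z : Cm) : R := \sum_j normc (z 0 j) ^+ 2.

Definition polarization (W : set Cm) (psi : Cm -> R)
    (Psi : Cm * Cm -> R[i]) :=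
  holomorphic_on [set zw | W zw.1 /\ W (map_mx conjc zw.2)] Psi /\
  forall z, W z -> Psi (z, map_mx conjc z) = (psi z)%:C.

(* As the diastatic function is only defined near its center p, this is a
   condition on the germ of delta at p. The choice of the local potential psi is
   immaterial. *)
Definition is_diastasis (U : set Cm) (omega : Cm -> Cm -> Cm -> R[i]) (p : Cm)
    (delta : Cm -> R) :=
  exists (W : set Cm) (psi : Cm -> R) (Psi : Cm * Cm -> R[i]),
    [/\ open_nbhs p W /\ W `<=` U,
        real_analytic_on W psi,
        forall x u v, W x -> kahler_form psi x u v = omega x u v,
        polarization W psi Psi &
        forall z, W z -> (delta z)%:C =
          Psi (z, map_mx conjc z) + Psi (p, map_mx conjc p)
          - Psi (z, map_mx conjc p) - Psi (p, map_mx conjc z)].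

Definition kahler_immersion (V : normedModType R[i]) (U : set Cm)
    (omega : Cm -> Cm -> Cm -> R[i]) (omegaV : V -> V -> V -> R[i])
    (f : Cm -> V) :=
  [/\ holomorphic_on U f,
      forall x, U x -> injective ('d f x) &
      forall x u v, U x -> omegaV (f x) ('d f x u) ('d f x v) = omega x u v].

End complex_space.

Definition flat_form (R : realType) (n : nat) := kahler_form (@sqnorm R n).

Definition flat_form_l2 (R : realType) := kahler_form (@l2sq R).

Arguments flat_form R n : clear implicits.
Arguments flat_form_l2 R : clear implicits.

(* cm_inv i is the inverse of the i-th chart; only its values on cm_img i, the
   image of that chart, matter. *)
Record complex_manifold (R : realType) (k : nat) := ComplexManifold {
  cm_point :> topologicalType;
  cm_index : Type;
  cm_dom : cm_index -> set cm_point;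
  cm_chart : cm_index -> cm_point -> 'rV[R[i]]_k;
  cm_inv : cm_index -> 'rV[R[i]]_k -> cm_point;
  cm_img := fun i => cm_chart i @` cm_dom i;
  cm_nonempty : [set: cm_point] !=set0;
  cm_hausdorff : hausdorff_space cm_point;
  cm_countable : @second_countable cm_point;
  cm_cover : forall s, exists i, cm_dom i s;
  cm_dom_open : forall i, open (cm_dom i);
  cm_img_open : forall i, open (cm_img i);
  cm_chartK : forall i s, cm_dom i s -> cm_inv i (cm_chart i s) = s;
  cm_chart_continuous : forall i s, cm_dom i s -> {for s, continuous (cm_chart i)};
  cm_inv_continuous : forall i x, cm_img i x -> {for x, continuous (cm_inv i)};
  cm_transition : forall i j,
    holomorphic_on (cm_chart i @` (cm_dom i `&` cm_dom j))
                   (cm_chart j \o cm_inv i)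
}.

Section relatives.
Variable R : realType.

Definition holomorphic_immersion (k m : nat) (S : complex_manifold R k)
    (f : S -> 'rV[R[i]]_m) :=
  forall i : cm_index S,
    holomorphic_on (cm_img i) (f \o cm_inv i) /\
    forall x, cm_img i x -> injective ('d (f \o cm_inv i) x).

(* f^* omega is read in the i-th chart of S *)
Definition pullback (k m : nat) (S : complex_manifold R k)
    (omega : 'rV[R[i]]_m -> 'rV[R[i]]_m -> 'rV[R[i]]_m -> R[i])
    (f : S -> 'rV[R[i]]_m) (i : cm_index S) (x u v : 'rV[R[i]]_k) : R[i] :=
  omega (f (cm_inv i x)) ('d (f \o cm_inv i) x u) ('d (f \o cm_inv i) x v).

Definition relatives (m1 m2 : nat)
    (U1 : set 'rV[R[i]]_m1)
    (omega1 : 'rV[R[i]]_m1 -> 'rV[R[i]]_m1 -> 'rV[R[i]]_m1 -> R[i])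
    (U2 : set 'rV[R[i]]_m2)
    (omega2 : 'rV[R[i]]_m2 -> 'rV[R[i]]_m2 -> 'rV[R[i]]_m2 -> R[i]) :=
  exists (k : nat) (S : complex_manifold R k)
    (f1 : S -> 'rV[R[i]]_m1) (f2 : S -> 'rV[R[i]]_m2),
    [/\ (0 < k)%N,
        (forall s, U1 (f1 s)) /\ (forall s, U2 (f2 s)),
        holomorphic_immersion f1, holomorphic_immersion f2 &
        forall (i : cm_index S) x u v, cm_img i x ->
          pullback omega1 f1 i x u v = pullback omega2 f2 i x u v].

End relatives.

Section hartogs.
Variables (R : realType) (d0 d : nat).
Variables (D : set 'rV[R[i]]_d) (phi : 'rV[R[i]]_d -> R).

(* a point (xi, z) of C^d0 x C^d is the row vector row_mx xi z *)
Definition hartogs : set 'rV[R[i]]_(d0 + d) :=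
  [set x | D (rsubmx x) /\ sqnorm (lsubmx x) < phi (rsubmx x)].

Definition base_form := kahler_form (fun z => - ln (phi z)).

Definition hartogs_form : 'rV[R[i]]_(d0 + d) -> _ :=
  kahler_form (fun x => - ln (phi (rsubmx x) - sqnorm (lsubmx x))).

End hartogs.

Arguments hartogs {R} d0 {d} D phi.
Arguments base_form {R d} phi.
Arguments hartogs_form {R} d0 {d} phi.

(* Main.v *)
Require Import Defs.
From HB Require Import structures.
From mathcomp Require Import all_boot all_order all_algebra.
From mathcomp Require Import complex ring lra zify.
From mathcomp Require Import separable cyclic cyclotomic.
From mathcomp Require Import all_classical all_reals all_analysis.

Set Implicit Arguments.
Unset Strict Implicit.
Unset Printing Implicit Defensive.

Import Order.TTheory GRing.Theory Num.Theory.
Import numFieldNormedType.Exports.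
Import ComplexField.Normc.

Local Open Scope classical_set_scope.
Local Open Scope ring_scope.
Local Open Scope complex_scope.

(* Suppose that [S] is a common Kaehler submanifold of [Omega] and [C^n], and
   restrict the two immersions to a complex line of a chart of [S]: this gives
   holomorphic curves [(xi, z)] in [Omega] and [F] in [C^n].  If [xi] vanishes
   identically, then [D] itself is relative to [C^n].  Otherwise let [xi] be
   nonzero at the base point, and let [f] be the immersion of [D] into [C^n]
   or [l^2].  The equalities of Kaehler forms say that
     [- ln (phi z - |xi|^2) - |F|^2]  and  [u = - ln (phi z) - |f z|^2]
   are harmonic in the parameter [t] of the line.  With [u = c + q + conj q],
   [q] holomorphic, the function
     [X = |xi|^2 / phi z = e^c |xi e^q|^2 e^(|f z|^2)]
   therefore satisfies
     [- ln (1 - X) + |f z|^2 = |F|^2 + harmonic].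
   The coefficients of [t^k conj(t)^l], with [k, l > 0], of the right-hand side
   form a matrix of rank at most [n], while those of the left-hand side form a
   sum of positive semidefinite matrices, among which, by expanding the
   logarithm and the exponential, the Gram matrices of [(xi_i e^q)^a f_j^b]
   for all [a > 0], [b >= 0].  A nonzero vector [p], supported on the degrees
   [1, ..., n + 1], whose pairing with the Taylor coefficients of every [F_i]
   vanishes, annihilates all these functions.  But, as the immersion of [S] does
   not degenerate at the base point, linear combinations of them vanish there
   to exactly any prescribed order: this contradicts [p <> 0].

   All the analysis is carried out on finite Taylor expansions ("jets") in [t]
   and [conj t]. *)

(** The definitions give little regularity: holomorphic means complex differentiable, and a Kaehler
    form is an iterated directional derivative. Along a line, the equality of the forms says only
    that, at each parameter, the coefficient of [t * t^J] in a second-order expansion vanishes.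
    Higher coefficients need a regularity theorem: a continuous function whose five-point Laplacian
    is [o(r^2)] at every point is a uniform limit of harmonic polynomials, hence has harmonic Taylor
    polynomials of every order.

    Jets of order [N = 2 n + 3] suffice, since [p] pairs total degrees up to [2 n + 2] only. As [X]
    need not vanish at the base point, every power of [X] contributes to each coefficient of
    [- ln (1 - X)]; the logarithm is expanded at the value [x] of [X], and the negative binomial
    series recovers the positive series in [X].

    Prescribed orders of vanishing are reached in two ways. The immersion [f] is translated to
    vanish at the base point. If [z] moves there, some [f_j] has a simple zero, and [xi_i e^q f_j^t]
    vanishes to order [t]. Otherwise [q] is stationary and some [xi_i] moves, and the [t]-th power
    of [xi_i e^q] minus its value is used. *)

Local Notation "z ^J" := (conjc z) (at level 2, format "z ^J").

(** * Moduli, conjugation, real and imaginary parts *)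

Section normc_theory.
Variable R : realType.
Local Notation C := R[i].
Implicit Types (x y z : C) (r : R).

Lemma normcX z n : normc (z ^+ n) = normc z ^+ n.
Proof. by elim: n => [|n IH]; rewrite ?expr0 ?normc1// !exprS normcM IH. Qed.

Lemma normc_real r : normc r%:C = `|r|.
Proof. by rewrite /= expr0n /= addr0 sqrtr_sqr. Qed.

Lemma normc_conj z : normc z^J = normc z.
Proof. by case: z => a b /=; rewrite sqrrN. Qed.

Lemma normcB z y : normc (z - y) = normc (y - z).
Proof. by rewrite -opprB normcN. Qed.

Lemma normc_gt0 z : (0 < normc z) = (z != 0).
Proof.
rewrite lt_neqAle normc_ge0 andbT eq_sym; congr negb.
by apply/eqP/eqP => [/eq0_normc|->]//; rewrite normc0.
Qed.

Lemma normc_Re z : `|complex.Re z| <= normc z.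
Proof. 
case: z => a b /=; rewrite -sqrtr_sqr ler_sqrt ?lerDl ?sqr_ge0//.
by rewrite addr_ge0 ?sqr_ge0.
Qed.

Lemma normc_Im z : `|complex.Im z| <= normc z.
Proof. 
case: z => a b /=; rewrite -sqrtr_sqr ler_sqrt ?lerDr ?sqr_ge0//.
by rewrite addr_ge0 ?sqr_ge0.
Qed.

Lemma normc_le z : normc z <= `|complex.Re z| + `|complex.Im z|.
Proof.
rewrite {1}(complexE z); apply: le_trans (le_normcD _ _) _.
by rewrite normcM !normc_real /= expr0n expr1n /= add0r sqrtr1 mul1r.
Qed.

Lemma normc_sqE z : (normc z ^+ 2)%:C = z * z^J.
Proof.
case: z => a b /=; rewrite sqr_sqrtr ?addr_ge0 ?sqr_ge0//.
by apply/eqP; rewrite eq_complex /=; apply/andP; split; apply/eqP; ring.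
Qed.

Lemma normc_sq z : normc z ^+ 2 = complex.Re z ^+ 2 + complex.Im z ^+ 2.
Proof. by case: z => a b /=; rewrite sqr_sqrtr// addr_ge0 ?sqr_ge0. Qed.

Lemma normc_sum (I : Type) (s : seq I) (P : pred I) (F : I -> C) :
  normc (\sum_(i <- s | P i) F i) <= \sum_(i <- s | P i) normc (F i).
Proof.
elim/big_rec2: _ => [|i y1 y2 _ h]; first by rewrite normc0.
by apply: le_trans (le_normcD _ _) _; rewrite lerD2l.
Qed.

Lemma ler_normcD3 x y z : normc (x - z) <= normc (x - y) + normc (y - z).
Proof. by apply: le_trans (le_normcD _ _); rewrite addrA subrK. Qed.

Lemma normc_i : normc ('i%C : C) = 1.
Proof. by rewrite /= expr0n expr1n /= add0r sqrtr1. Qed.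

Lemma ReD x y : complex.Re (x + y) = complex.Re x + complex.Re y.
Proof. by case: x; case: y. Qed.
Lemma ImD x y : complex.Im (x + y) = complex.Im x + complex.Im y.
Proof. by case: x; case: y. Qed.
Lemma ReN x : complex.Re (- x) = - complex.Re x. Proof. by case: x. Qed.
Lemma ImN x : complex.Im (- x) = - complex.Im x. Proof. by case: x. Qed.
Lemma ReMr r x : complex.Re (r%:C * x) = r * complex.Re x.
Proof. by case: x => a b /=; rewrite mul0r subr0. Qed.
Lemma ImMr r x : complex.Im (r%:C * x) = r * complex.Im x.
Proof. by case: x => a b /=; rewrite mul0r addr0. Qed.

Lemma complex_ext x y : complex.Re x = complex.Re y ->
  complex.Im x = complex.Im y -> x = y.
Proof. by case: x; case: y => ? ? ? ? /= -> ->. Qed.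

Lemma real_complexX r n : (r ^+ n)%:C = r%:C ^+ n :> C.
Proof. exact: rmorphXn. Qed.

Lemma real_complexM r s : (r * s)%:C = r%:C * s%:C :> C.
Proof. exact: rmorphM. Qed.

Lemma real_complexD r s : (r + s)%:C = r%:C + s%:C :> C.
Proof. exact: rmorphD. Qed.

Lemma real_complex_sum (I : Type) (s : seq I) (P : pred I) (F : I -> R) :
  (\sum_(i <- s | P i) F i)%:C = \sum_(i <- s | P i) (F i)%:C :> C.
Proof. exact: rmorph_sum. Qed.

Lemma conjcM x y : (x * y)^J = x^J * y^J. Proof. exact: rmorphM. Qed.
Lemma conjcD x y : (x + y)^J = x^J + y^J. Proof. exact: rmorphD. Qed.
Lemma conjcB x y : (x - y)^J = x^J - y^J. Proof. exact: rmorphB. Qed.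
Lemma conjcX x n : (x ^+ n)^J = x^J ^+ n. Proof. exact: rmorphXn. Qed.
Lemma conjc_sum (I : Type) (s : seq I) (P : pred I) (F : I -> C) :
  (\sum_(i <- s | P i) F i)^J = \sum_(i <- s | P i) (F i)^J.
Proof. exact: rmorph_sum. Qed.

End normc_theory.

(** * Goursat's theorem *)

Section bisection.
Variable R : realType.

Lemma half_pow_small (w e : R) : 0 <= w -> 0 < e -> exists n, w / 2 ^+ n < e.
Proof.
move=> w0 e0; exists (Num.bound (w / e)).
rewrite ltr_pdivrMr ?exprn_gt0// mulrC -ltr_pdivrMr//.
apply: lt_trans (archi_boundP _) _; first by rewrite divr_ge0// ltW.
by rewrite -natrX ltr_nat ltn_expl.
Qed.

Lemma nested_intervals (u w : nat -> R) :
  (forall n, 0 <= w n) ->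
  (forall n, u n <= u n.+1 /\ u n.+1 + w n.+1 <= u n + w n) ->
  exists x, forall n, u n <= x <= u n + w n.
Proof.
move=> w0 uS.
have mono k n : u n <= u (n + k)%N /\ u (n + k)%N + w (n + k)%N <= u n + w n.
  elim: k => [|k [IH1 IH2]]; first by rewrite addn0.
  by have [? ?] := uS (n + k)%N; rewrite addnS; split; apply: le_trans; eauto.
have cross n m : u n <= u m + w m.
  have [nm|/ltnW mn] := leqP n m.
    have [h _] := mono (m - n)%N n; rewrite subnKC// in h.
    by apply: le_trans h _; rewrite lerDl.
  have [_ h] := mono (n - m)%N m; rewrite subnKC// in h.
  by apply: le_trans h; rewrite lerDl.
exists (sup (range u)) => n; apply/andP; split.
  apply: ub_le_sup; last by exists n.
  by exists (u 0 + w 0) => _ [k _ <-].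
by apply: ge_sup; [exists (u 0); exists 0|move=> _ [k _ <-]].
Qed.

(** If [P] failed, it would fail on one of the four quarters, and so on for a nested sequence of
    rectangles shrinking to a point, where the local hypothesis contradicts the failure. A rectangle
    is given by its lower left corner and its two sides. The lemma serves both Goursat's estimate
    and the compactness of the disc. *)
Lemma bisection (P : R -> R -> R -> R -> Prop) (a b w h : R) :
  0 <= w -> 0 <= h ->
  (forall a b w h, 0 <= w -> 0 <= h ->
     P a b (w / 2) (h / 2) -> P (a + w / 2) b (w / 2) (h / 2) ->
     P a (b + h / 2) (w / 2) (h / 2) ->
     P (a + w / 2) (b + h / 2) (w / 2) (h / 2) -> P a b w h) ->
  (forall x y, a <= x <= a + w -> b <= y <= b + h ->
     exists2 d, 0 < d & forall a' b' w' h', 0 <= w' < d -> 0 <= h' < d ->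
       a' <= x <= a' + w' -> b' <= y <= b' + h' ->
       a <= a' -> a' + w' <= a + w -> b <= b' -> b' + h' <= b + h ->
       P a' b' w' h') ->
  P a b w h.
Proof.
move=> w0 h0 Psplit Ploc; apply: contrapT => nP.
pose W n := w / 2 ^+ n; pose H n := h / 2 ^+ n.
have W0 n : 0 <= W n by rewrite divr_ge0// exprn_ge0.
have H0 n : 0 <= H n by rewrite divr_ge0// exprn_ge0.
have WS n : W n.+1 = W n / 2 by rewrite /W exprSr invfM mulrA.
have HS n : H n.+1 = H n / 2 by rewrite /H exprSr invfM mulrA.
pose Q n (p : R * R) := ~ P p.1 p.2 (W n) (H n).
(* The premise [Q n p] is kept under the existential, so that the choice is a total function of [p],
   as the recursion defining [u] requires. *)
have step n p : exists p' : R * R, Q n p -> [/\ Q n.+1 p',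
    p.1 <= p'.1 /\ p'.1 + W n.+1 <= p.1 + W n
    & p.2 <= p'.2 /\ p'.2 + H n.+1 <= p.2 + H n].
  apply: contrapT => nex; have Wn := W0 n; have Hn := H0 n.
  have Qp : Q n p by apply: contrapT => nQ; apply: nex; exists p.
  apply: (Qp); apply: Psplit => //; apply: contrapT => nP'; apply: nex.
  - exists p => _; rewrite /Q WS HS; split=> //; split; lra.
  - exists (p.1 + W n / 2, p.2) => _; rewrite /Q WS HS /=; split=> //; split; lra.
  - exists (p.1, p.2 + H n / 2) => _; rewrite /Q WS HS /=; split=> //; split; lra.
  - exists (p.1 + W n / 2, p.2 + H n / 2) => _; rewrite /Q WS HS /=; split=> //; split; lra.
pose u := fix u n := if n is n'.+1 then sval (cid (step n' (u n'))) else (a, b).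
have uQ n : Q n (u n).
  elim: n => [|n IH]; first by rewrite /Q /W /H expr0 !divr1.
  by rewrite /=; case: cid => p' /= /(_ IH) [].
have uS n : (u n).1 <= (u n.+1).1 /\ (u n.+1).1 + W n.+1 <= (u n).1 + W n.
  by rewrite /=; case: cid => p' /= /(_ (uQ n)) [].
have vS n : (u n).2 <= (u n.+1).2 /\ (u n.+1).2 + H n.+1 <= (u n).2 + H n.
  by rewrite /=; case: cid => p' /= /(_ (uQ n)) [].
have [x xP] := nested_intervals W0 uS.
have [y yP] := nested_intervals H0 vS.
have hu n : a <= (u n).1 /\ (u n).1 + W n <= a + w.
  elim: n => [|n [IH1 IH2]]; first by rewrite /W expr0 divr1.
  by have [? ?] := uS n; split; [apply: le_trans IH1 _|apply: le_trans IH2].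
have hv n : b <= (u n).2 /\ (u n).2 + H n <= b + h.
  elim: n => [|n [IH1 IH2]]; first by rewrite /H expr0 divr1.
  by have [? ?] := vS n; split; [apply: le_trans IH1 _|apply: le_trans IH2].
have [d d0 dP] : exists2 d, 0 < d & forall a' b' w' h', 0 <= w' < d -> 0 <= h' < d ->
       a' <= x <= a' + w' -> b' <= y <= b' + h' ->
       a <= a' -> a' + w' <= a + w -> b <= b' -> b' + h' <= b + h ->
       P a' b' w' h'.
  apply: Ploc.
    by have := xP 0; rewrite /W expr0 divr1.
  by have := yP 0; rewrite /H expr0 divr1.
have [n1 hn1] := half_pow_small w0 d0; have [n2 hn2] := half_pow_small h0 d0.
pose n := maxn n1 n2.
have mon (v : R) m k : 0 <= v -> (m <= k)%N -> v / 2 ^+ k <= v / 2 ^+ m.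
  move=> v0 mk; rewrite ler_wpM2l// lef_pV2 ?posrE ?exprn_gt0//.
  by rewrite ler_weXn2l// ler1n.
apply: (uQ n); apply: dP; rewrite ?xP ?yP//; try by have [] := hu n.
- by rewrite W0/=; apply: le_lt_trans hn1; apply: mon; rewrite ?leq_maxl.
- by rewrite H0/=; apply: le_lt_trans hn2; apply: mon; rewrite ?leq_maxr.
- by have [] := hv n.
- by have [] := hv n.
Qed.

End bisection.

(** * Primitives of complex functions of a real variable *)

Section real_calculus.
Variable R : realType.
Local Notation C := R[i].

Lemma mean_value_bound (f df : R -> R) (a b e : R) : a <= b ->
  (forall x, a <= x <= b -> is_derive x 1 f (df x)) ->
  (forall x, a <= x <= b -> `|df x| <= e) -> `|f b - f a| <= e * (b - a).
Proof.
move=> ab fdf dfe.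
have [||c cab ->] := @MVT_segment R f df a b ab.
- by move=> x /itvP xab; apply: fdf; rewrite !xab.
- apply: derivable_within_continuous => x xab.
  by have := fdf x; rewrite in_itv/= in xab; move=> /(_ xab) [].
rewrite normrM (ger0_norm (_ : 0 <= b - a)) ?subr_ge0//.
by rewrite ler_wpM2r ?subr_ge0// dfe//; rewrite in_itv/= in cab.
Qed.

Lemma antiderivative_real (g : R -> R) (B : R) : continuous g ->
  exists G : R -> R, forall x : R, `|x| < B -> is_derive x 1 G (g x).
Proof.
move=> cg.
exists (fun y => (\int[lebesgue_measure]_(t in [set` `[- B - 1, y]]) g t)%R) => x xB.
have ig : (lebesgue_measure).-integrable `[- B - 1, B + 1] (EFin \o g).
  apply: continuous_compact_integrable; first exact: segment_compact.
  exact: continuous_subspaceT.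
have [||d e] := @continuous_FTC1_closed R g (- B - 1) x (B + 1) _ ig _ (cg x).
- by have := ler_norm x; lra.
- by have := ler_norm (- x); rewrite normrN; lra.
by apply: DeriveDef; [exact: d|rewrite -derive1E].
Qed.

Definition ccontinuous (g : R -> C) :=
  continuous (fun x => complex.Re (g x)) /\ continuous (fun x => complex.Im (g x)).

Definition is_cderive (x : R) (G : R -> C) (d : C) :=
  is_derive x 1 (fun t => complex.Re (G t)) (complex.Re d) /\
  is_derive x 1 (fun t => complex.Im (G t)) (complex.Im d).

(** The mean value theorem applies to real and imaginary parts separately, whence the factor 2. *)
Lemma cmean_value_bound (f df : R -> C) (a b e : R) : a <= b ->
  (forall x, a <= x <= b -> is_cderive x f (df x)) ->
  (forall x, a <= x <= b -> normc (df x) <= e) ->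
  normc (f b - f a) <= 2 * e * (b - a).
Proof.
move=> ab fdf dfe; apply: le_trans (normc_le _) _.
rewrite ReD ImD ReN ImN -mulrA mulr_natl mulr2n; apply: lerD.
  apply: (@mean_value_bound (fun x => complex.Re (f x)) (fun x => complex.Re (df x)) a b e) => // x xab.
    by have [] := fdf _ xab.
  exact: le_trans (normc_Re _) (dfe _ xab).
apply: (@mean_value_bound (fun x => complex.Im (f x)) (fun x => complex.Im (df x)) a b e) => // x xab.
  by have [] := fdf _ xab.
exact: le_trans (normc_Im _) (dfe _ xab).
Qed.

Lemma antiderivative (g : R -> C) : ccontinuous g ->
  exists G : R -> C, forall x : R, `|x| < 2 -> is_cderive x G (g x).
Proof.
move=> [/(antiderivative_real 2) [G1 h1] /(antiderivative_real 2) [G2 h2]].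
by exists (fun x => G1 x +i* G2 x) => x x2; split; [exact: h1|exact: h2].
Qed.

(** Some primitive, of which only the derivative on [|x| < 2] is specified. Integrals are
    differences of its values, so that additivity and changes of orientation become ring
    identities. *)
Definition prim (g : R -> C) : R -> C :=
  xget (fun=> 0) [set G | forall x : R, `|x| < 2 -> is_cderive x G (g x)].

Lemma primP (g : R -> C) x : ccontinuous g -> `|x| < 2 ->
  is_cderive x (prim g) (g x).
Proof.
move=> /antiderivative [G GP]; rewrite /prim.
by move: x; case: xgetP => [H -> HP|/(_ G)].
Qed.

Definition int (g : R -> C) a b := prim g b - prim g a.

Lemma is_cderiveB x f g df dg : is_cderive x f df -> is_cderive x g dg ->
  is_cderive x (fun t => f t - g t) (df - dg).
Proof.
move=> [f1 f2] [g1 g2]; split.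
  rewrite ReD ReN (_ : (fun _ => _) = (fun t => complex.Re (f t)) - (fun t => complex.Re (g t))).
    exact: is_deriveB.
  by apply/funext => t; rewrite ReD ReN.
rewrite ImD ImN (_ : (fun _ => _) = (fun t => complex.Im (f t)) - (fun t => complex.Im (g t))).
  exact: is_deriveB.
by apply/funext => t; rewrite ImD ImN.
Qed.

(** The mean value bound is applied to [prim g - H], whose derivative is [g - h]. *)
Lemma int_approx (g h H : R -> C) a b e : ccontinuous g -> `|a| < 2 -> `|b| < 2 ->
  a <= b -> (forall x, a <= x <= b -> is_cderive x H (h x)) ->
  (forall x, a <= x <= b -> normc (g x - h x) <= e) ->
  normc (int g a b - (H b - H a)) <= 2 * e * (b - a).
Proof.
move=> cg a2 b2 ab Hh gh.
have -> : int g a b - (H b - H a) = (prim g b - H b) - (prim g a - H a).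
  by rewrite /int; ring.
apply: (@cmean_value_bound (fun x => prim g x - H x) (fun x => g x - h x)) => //.
move=> x xab; apply: is_cderiveB; last exact: Hh.
apply: primP => //; case/andP: xab => ax xb; rewrite ltr_norml.
move: a2 b2; rewrite !ltr_norml => /andP[? ?] /andP[? ?].
by apply/andP; split; lra.
Qed.

(* a primitive of the affine function [z |-> c + k z] along horizontal and
   vertical lines *)
Definition aff_prim (c k z : C) := c * z + (2^-1)%:C * (k * (z * z)).

Lemma is_cderive_affine_h (c k : C) (b x : R) :
  is_cderive x (fun t => aff_prim c k (t +i* b)) (c + k * (x +i* b)).
Proof.
rewrite /aff_prim; case: c => c1 c2; case: k => k1 k2; split.
  rewrite (_ : (fun _ => _) = (fun t : R => (c1 * t - c2 * b) + (k1 * (t ^+ 2 - b ^+ 2) - k2 * (2 * t * b)) / 2)).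
    by apply: is_derive_eq; rewrite /GRing.scale/=; field.
  by apply/funext => t /=; rewrite !mul0r !subr0; field.
rewrite (_ : (fun _ => _) = (fun t : R => (c1 * b + c2 * t) + (k2 * (t ^+ 2 - b ^+ 2) + k1 * (2 * t * b)) / 2)).
  by apply: is_derive_eq; rewrite /GRing.scale/=; field.
by apply/funext => t /=; rewrite !mul0r !addr0; field.
Qed.

(** On a vertical line [dz = i dt]; the factor [- 'i], the inverse of ['i], compensates for it. *)
Lemma is_cderive_affine_v (c k : C) (a y : R) :
  is_cderive y (fun t => - 'i * aff_prim c k (a +i* t)) (c + k * (a +i* y)).
Proof.
rewrite /aff_prim; case: c => c1 c2; case: k => k1 k2; split.
  rewrite (_ : (fun _ => _) = (fun t : R => (c1 * t + c2 * a) + (k2 * (a ^+ 2 - t ^+ 2) + k1 * (2 * a * t)) / 2)).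
    by apply: is_derive_eq; rewrite /GRing.scale/=; field.
  by apply/funext => t /=; rewrite !mul0r ?oppr0 ?addr0 ?subr0 ?mul0r ?add0r ?sub0r; field.
rewrite (_ : (fun _ => _) = (fun t : R => (c2 * t - c1 * a) - (k1 * (a ^+ 2 - t ^+ 2) - k2 * (2 * a * t)) / 2)).
  by apply: is_derive_eq; rewrite /GRing.scale/=; field.
by apply/funext => t /=; rewrite !mul0r ?oppr0 ?addr0 ?subr0 ?mul0r ?add0r ?sub0r; field.
Qed.

End real_calculus.

(** * Integrals along the boundaries of rectangles *)

Section goursat.
Variable R : realType.
Local Notation C := R[i].

Definition cdiff (f : C -> C) (z a : C) := forall e : R, 0 < e ->
  exists2 d : R, 0 < d & forall h, normc h < d ->
    normc (f (z + h) - f z - a * h) <= e * normc h.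

Definition ccont (f : C -> C) (z : C) := forall e : R, 0 < e ->
  exists2 d : R, 0 < d & forall s, normc (s - z) < d -> normc (f s - f z) <= e.

Lemma cdiff_ccont f z a : cdiff f z a -> ccont f z.
Proof.
move=> fa e e0; have [d d0 dP] := fa 1 ltr01.
have a1 : 0 < 1 + normc a by rewrite ltr_pwDl// normc_ge0.
exists (Num.min d (e / (1 + normc a))); first by rewrite lt_min d0 divr_gt0.
move=> s; rewrite lt_min => /andP[sd se].
have := dP (s - z) sd; rewrite subrKC mul1r => h.
have -> : f s - f z = (f s - f z - a * (s - z)) + a * (s - z) by rewrite subrK.
apply: le_trans (le_normcD _ _) _; rewrite normcM.
by apply: (le_trans (lerD h (lexx _))); rewrite -[X in X + _]mul1r -mulrDl mulrC -ler_pdivlMr// ltW.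
Qed.

(** Projection onto [[-1, 1]]. It extends the restriction of [f] to the square, which lies in the
    disc of radius 2, to a function continuous along all horizontal and vertical lines, as
    [ccontinuous] demands. *)
Definition clamp (x : R) : R := Num.max (-1) (Num.min x 1).

Lemma clampE x : `|x| <= 1 -> clamp x = x.
Proof.
rewrite ler_norml => /andP[x1 x2].
by rewrite /clamp min_l// max_r.
Qed.

Lemma clamp_bound x : `|clamp x| <= 1.
Proof. by rewrite /clamp ler_norml; case: (leP x 1) => h; [case: (leP (-1) x)|case: (leP (-1 : R) 1)]; lra. Qed.

Lemma clamp_lip x y : `|clamp x - clamp y| <= `|x - y|.
Proof.
have := ler_norm (x - y); have := ler_norm (y - x); rewrite (distrC y x) ler_norml.
rewrite /clamp; case: (leP x 1) => hx; case: (leP y 1) => hy;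
  rewrite ?(max_r (_ : -1 <= 1 :> R)) ?lerN10 //; try (by lra);
  case: (leP (-1) x) => hx'; case: (leP (-1) y) => hy'; lra.
Qed.

Lemma normc_box (x y : R) : `|x| <= 1 -> `|y| <= 1 -> normc (x +i* y) < 2.
Proof.
move=> x1 y1; rewrite -(ltr_pXn2r (_ : (0 < 2)%N)) ?nnegrE ?normc_ge0//.
rewrite normc_sq /= -(real_normK (num_real x)) -(real_normK (num_real y)).
by have := normr_ge0 x; have := normr_ge0 y; nra.
Qed.

Lemma normc_lineR (x y b : R) : normc ((x +i* b) - (y +i* b)) = `|x - y|.
Proof. by rewrite -normc_real /= subrr. Qed.

Lemma normc_lineI (x y b : R) : normc ((b +i* x) - (b +i* y)) = `|x - y|.
Proof. by rewrite /= subrr expr0n add0r sqrtr_sqr. Qed.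

Lemma ccontinuous_Lip (f : C -> C) (g : R -> C) :
  (forall x, ccont f (g x)) -> (forall x y, normc (g x - g y) <= `|x - y|) ->
  ccontinuous (f \o g).
Proof.
move=> cf lg; split=> x; apply/cvgrPdist_le => e e0.
  have [d d0 dP] := cf x e e0; near=> y.
  rewrite /= -ReN -ReD; apply: le_trans (normc_Re _) _; rewrite normcB; apply: dP.
  apply: le_lt_trans (lg _ _) _; rewrite distrC.
  by near: y; apply: (@cvgr_dist_lt _ _ _ (nbhs x)).
have [d d0 dP] := cf x e e0; near=> y.
rewrite /= -ImN -ImD; apply: le_trans (normc_Im _) _; rewrite normcB; apply: dP.
apply: le_lt_trans (lg _ _) _; rewrite distrC.
by near: y; apply: (@cvgr_dist_lt _ _ _ (nbhs x)).
Unshelve. all: by end_near. Qed.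

Variable f : C -> C.
Hypothesis fdiff : forall z, normc z < 2 -> exists a, cdiff f z a.

Let F x y := f (clamp x +i* clamp y).

Let FE x y : `|x| <= 1 -> `|y| <= 1 -> F x y = f (x +i* y).
Proof. by move=> x1 y1; rewrite /F !clampE. Qed.

Let fcont x y : ccont f (clamp x +i* clamp y).
Proof.
have [a /cdiff_ccont//] := fdiff (normc_box (clamp_bound x) (clamp_bound y)).
Qed.

Let hcont y : ccontinuous (F^~ y).
Proof.
apply: (@ccontinuous_Lip f (fun x => clamp x +i* clamp y)) => //.
by move=> u v; rewrite normc_lineR clamp_lip.
Qed.

Let vcont x : ccontinuous (F x).
Proof.
apply: (@ccontinuous_Lip f (fun y => clamp x +i* clamp y)) => //.
by move=> u v; rewrite normc_lineI clamp_lip.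
Qed.

(** The contour integral along the counterclockwise boundary of the rectangle between abscissas [a],
    [a'] and ordinates [b], [b']; the vertical sides carry the factor ['i] of [dz = i dy]. *)
Definition loop a a' b b' := int (F^~ b) a a' + 'i * int (F a') b b'
  - int (F^~ b') a a' - 'i * int (F a) b b'.

Lemma loop_split a m a' b n b' :
  loop a a' b b' = loop a m b n + loop m a' b n + loop a m n b' + loop m a' n b'.
Proof. by rewrite /loop /int; ring. Qed.

(** The affine approximation of [f] has a primitive and contributes nothing to the loop. On each
    side the remainder contributes at most [2 e (w + h)] times the length, and the perimeter is
    [2 (w + h)]. *)
Lemma loop_small (x y : R) (k : C) (e : R) a w b h :
  0 <= w -> 0 <= h -> `|a| <= 1 -> `|a + w| <= 1 -> `|b| <= 1 -> `|b + h| <= 1 ->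
  (forall u v, a <= u <= a + w -> b <= v <= b + h ->
     normc (f (u +i* v) - f (x +i* y) - k * ((u +i* v) - (x +i* y))) <= e * (w + h)) ->
  normc (loop a (a + w) b (b + h)) <= 4 * e * (w + h) ^+ 2.
Proof.
move=> w0 h0 a1 aw1 b1 bh1 He.
set z := x +i* y in He *; pose c := f z - k * z.
have He' u v : a <= u <= a + w -> b <= v <= b + h ->
    normc (F u v - (c + k * (u +i* v))) <= e * (w + h).
  move=> hu hv; have -> : F u v - (c + k * (u +i* v)) =
      f (u +i* v) - f z - k * ((u +i* v) - z).
    rewrite FE; first by rewrite /c; ring.
      by move: a1 aw1; rewrite !ler_norml; lra.
    by move: b1 bh1; rewrite !ler_norml; lra.
  exact: He.
have lt2 (t : R) : `|t| <= 1 -> `|t| < 2 by move=> h1; apply: le_lt_trans h1 _; rewrite ltr1n.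
have aa : a <= a <= a + w by rewrite lexx lerDl.
have awaw : a <= a + w <= a + w by rewrite lexx lerDl w0.
have bb : b <= b <= b + h by rewrite lexx lerDl.
have bhbh : b <= b + h <= b + h by rewrite lexx lerDl h0.
have A1 v : b <= v <= b + h -> normc (int (F^~ v) a (a + w) -
    (aff_prim c k ((a + w) +i* v) - aff_prim c k (a +i* v))) <= 2 * (e * (w + h)) * (a + w - a).
  move=> hv; apply: (@int_approx _ (F^~ v) (fun x => c + k * (x +i* v)) (fun x => aff_prim c k (x +i* v))); rewrite ?lerDl ?lt2//.
    by move=> u hu; exact: is_cderive_affine_h.
  by move=> u hu; apply: He'.
have A2 u : a <= u <= a + w -> normc (int (F u) b (b + h) -
    (- 'i * aff_prim c k (u +i* (b + h)) - - 'i * aff_prim c k (u +i* b))) <= 2 * (e * (w + h)) * (b + h - b).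
  move=> hu; apply: (@int_approx _ (F u) (fun y => c + k * (u +i* y)) (fun y => - 'i * aff_prim c k (u +i* y))); rewrite ?lerDl ?lt2//.
    by move=> v hv; exact: is_cderive_affine_v.
  by move=> v hv; apply: He'.
have := A1 _ bb; have := A1 _ bhbh; have := A2 _ aa; have := A2 _ awaw.
rewrite /loop (_ : a + w - a = w); last by ring.
rewrite (_ : b + h - b = h); last by ring.
set i1 := int (F^~ b) _ _; set i2 := int (F^~ (b + h)) _ _.
set j1 := int (F (a + w)) _ _; set j2 := int (F a) _ _.
set p1 := aff_prim c k (a +i* b); set p2 := aff_prim c k ((a + w) +i* b).
set p3 := aff_prim c k (a +i* (b + h)); set p4 := aff_prim c k ((a + w) +i* (b + h)).
move=> E1 E2 E3 E4.
have -> : i1 + 'i * j1 - i2 - 'i * j2 = (i1 - (p2 - p1)) + 'i * (j1 - (- 'i * p4 - - 'i * p2))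
   - (i2 - (p4 - p3)) - 'i * (j2 - (- 'i * p3 - - 'i * p1)).
  have iNi (x' : C) : 'i * (- 'i * x') = x'.
    by rewrite mulrA mulrN -expr2 sqr_i opprK mul1r.
  by rewrite !mulrBr !iNi; ring.
apply: le_trans (le_normcD _ _) _; rewrite normcN normcM normc_i mul1r.
apply: (le_trans (lerD (le_normcD _ _) (lexx _))); rewrite normcN.
apply: (le_trans (lerD (lerD (le_normcD _ _) (lexx _)) (lexx _))).
rewrite normcM normc_i mul1r.
have -> : 4 * e * (w + h) ^+ 2 = 2 * (e * (w + h)) * w + 2 * (e * (w + h)) * h + 2 * (e * (w + h)) * w + 2 * (e * (w + h)) * h by ring.
by rewrite !lerD.
Qed.

Lemma goursat_rect a w b h : 0 <= w -> 0 <= h ->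
  `|a| <= 1 -> `|a + w| <= 1 -> `|b| <= 1 -> `|b + h| <= 1 ->
  loop a (a + w) b (b + h) = 0.
Proof.
move=> w0 h0 a1 aw1 b1 bh1.
suff H : forall e, 0 < e -> normc (loop a (a + w) b (b + h)) <= e * (4 * (w + h) ^+ 2).
  apply: eq0_normc; apply/eqP; rewrite eq_le normc_ge0 andbT.
  apply/ler_addgt0Pl => e e0; rewrite addr0.
  have p0 : 0 < 4 * (w + h) ^+ 2 + 1 by rewrite ltr_wpDl// mulr_ge0// sqr_ge0.
  apply: le_trans (H (e / (4 * (w + h) ^+ 2 + 1)) _) _; first by rewrite divr_gt0.
  by rewrite mulrAC ler_pdivrMr// ler_pM2l// lerDl.
move=> e e0; rewrite (_ : e * _ = 4 * e * (w + h) ^+ 2); last by ring.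
(* The bound is quadratic in the sides: the bounds for the four quarters add up exactly to the bound
   for the whole. *)
apply: (@bisection R (fun a b w h => normc (loop a (a + w) b (b + h)) <= 4 * e * (w + h) ^+ 2)) => //.
  move=> {}a {}b {}w {}h {}w0 {}h0 {a1 aw1 b1 bh1} P1 P2 P3 P4.
  rewrite (@loop_split _ (a + w / 2) _ _ (b + h / 2)).
  have ew : a + w / 2 + w / 2 = a + w by lra.
  have eh : b + h / 2 + h / 2 = b + h by lra.
  rewrite ew eh in P2 P3 P4.
  rewrite (_ : 4 * e * (w + h) ^+ 2 = 4 * e * (w / 2 + h / 2) ^+ 2 + 4 * e * (w / 2 + h / 2) ^+ 2 + 4 * e * (w / 2 + h / 2) ^+ 2 + 4 * e * (w / 2 + h / 2) ^+ 2); last by field.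
  do 3 (apply: le_trans (le_normcD _ _) _; apply: lerD => //).
move=> x y hx hy.
have x1 : `|x| <= 1 by move: a1 aw1; rewrite !ler_norml; lra.
have y1 : `|y| <= 1 by move: b1 bh1; rewrite !ler_norml; lra.
have [k /(_ e e0) [d d0 dP]] := fdiff (normc_box x1 y1).
exists (d / 2); first by rewrite divr_gt0.
move=> a' b' w' h' /andP[w'0 w'd] /andP[h'0 h'd] hx' hy' aa' aw' bb' bh'.
apply: (@loop_small x y k) => //; try by (move: a1 aw1 b1 bh1; rewrite !ler_norml; lra).
move=> u v hu hv.
have duv : normc ((u +i* v) - (x +i* y)) <= w' + h'.
  apply: le_trans (normc_le _) _ => /=; apply: lerD; rewrite ler_norml; lra.
have := dP ((u +i* v) - (x +i* y)); rewrite addrCA subrr addr0 => H.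
apply: (le_trans (H _)); last by rewrite ler_pM2l.
by apply: le_lt_trans duv _; lra.
Qed.

Lemma loop_swaph a a' b b' : loop a' a b b' = - loop a a' b b'.
Proof. by rewrite /loop /int; ring. Qed.

Lemma loop_swapv a a' b b' : loop a a' b' b = - loop a a' b b'.
Proof. by rewrite /loop /int; ring. Qed.

Lemma goursat a a' b b' : `|a| <= 1 -> `|a'| <= 1 -> `|b| <= 1 -> `|b'| <= 1 ->
  loop a a' b b' = 0.
Proof.
wlog aa' : a a' / a <= a'.
  move=> H a1 a'1 b1 b'1; have [|/ltW] := leP a a' => h; first exact: H.
  by rewrite loop_swaph H ?oppr0.
wlog bb' : b b' / b <= b'.
  move=> H a1 a'1 b1 b'1; have [|/ltW] := leP b b' => h; first exact: H.
  by rewrite loop_swapv H ?oppr0.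
move=> a1 a'1 b1 b'1.
by have := @goursat_rect a (a' - a) b (b' - b); rewrite !subrKC !subr_ge0; apply.
Qed.

(** The primitive integrates along the real axis and then vertically. Goursat's theorem on the
    rectangle between the real axis and the horizontal side through [z] turns its increment into an
    integral along two short legs starting at [z], where [f] is close to [f z]. *)
Lemma holo_primitive : exists F : C -> C, forall z, normc z < 1 -> cdiff F z (f z).
Proof.
exists (fun z => int (F^~ 0) 0 (complex.Re z) + 'i * int (F (complex.Re z)) 0 (complex.Im z)).
move=> [x y] z1 e e0.
have n01 : `|0 : R| <= 1 by rewrite normr0.
have xy1 (u : C) : normc u < 1 -> `|complex.Re u| <= 1 /\ `|complex.Im u| <= 1.
  by move=> u1; split; apply/ltW; [apply: le_lt_trans (normc_Re u) u1|apply: le_lt_trans (normc_Im u) u1].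
have [/= x1 y1] := xy1 _ z1.
have e40 : 0 < e / 4 by rewrite divr_gt0.
have [d d0 dP] := @fcont x y (e / 4) e40.
rewrite !clampE// in dP.
exists (Num.min (1 - normc (x +i* y)) d); first by rewrite lt_min subr_gt0 z1.
move=> [h k]; rewrite lt_min ltrBrDl => /andP[zh1 hkd].
have [/= xh1 yk1] := xy1 _ (le_lt_trans (le_normcD _ _) zh1).
have := goursat n01 n01 y1 yk1.
have := goursat x1 xh1 n01 y1; rewrite /loop /=.
set c := f _.
have lt2 (t : R) : `|t| <= 1 -> `|t| < 2 by move=> h1; apply: le_lt_trans h1 _; rewrite ltr1n.
have approx (g : R -> C) (s t : R) : ccontinuous g -> `|s| <= 1 -> `|t| <= 1 ->
   (forall u, Num.min s t <= u <= Num.max s t -> normc (g u - c) <= e / 4) ->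
   normc (int g s t - c * (t - s)%:C) <= e / 2 * `|t - s|.
  move=> cg s1 t1.
  have main (s' t' : R) : s' <= t' -> `|s'| <= 1 -> `|t'| <= 1 ->
     (forall u, s' <= u <= t' -> normc (g u - c) <= e / 4) ->
     normc (int g s' t' - c * (t' - s')%:C) <= e / 2 * `|t' - s'|.
    move=> st s'1 t'1 hu; rewrite (ger0_norm (_ : 0 <= t' - s')) ?subr_ge0//.
    have := @int_approx _ g (fun u => c + 0 * (u +i* 0)) (fun u => aff_prim c 0 (u +i* 0)) s' t' (e / 4) cg (lt2 _ s'1) (lt2 _ t'1) st.
    have -> : aff_prim c 0 (t' +i* 0) - aff_prim c 0 (s' +i* 0) = c * (t' - s')%:C.
      by rewrite rmorphB mulrBr /aff_prim !mul0r !mulr0 !addr0.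
    have -> : 2 * (e / 4) = e / 2 by field.
    apply; first by move=> u _; exact: is_cderive_affine_h.
    by move=> u hu'; rewrite mul0r addr0; exact: hu.
  have [st|/ltW st] := leP s t.
    by rewrite ?(min_l st) ?(max_r st) => hu; apply: main.
  move=> hu; have := main t s st t1 s1 hu.
  rewrite distrC -normcN; congr (normc _ <= _).
  by rewrite /int -[s - t]opprB rmorphN; ring.
move=> g1 g2.
have near1 u : Num.min x (x + h) <= u <= Num.max x (x + h) -> normc (F u y - c) <= e / 4.
  move=> hu; have u1 : `|u| <= 1.
    by move: hu x1 xh1; rewrite !ler_norml; case: (leP x (x + h)); lra.
  rewrite FE//; apply: dP; rewrite normc_lineR; apply: le_lt_trans hkd.
  apply: (@le_trans _ _ `|h|); last exact: (normc_Re (h +i* k)).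
  by move: hu; have := ler_norm h; have := ler_norm (- h); rewrite normrN ler_norml; case: (leP x (x + h)); lra.
have near2 v : Num.min y (y + k) <= v <= Num.max y (y + k) -> normc (F (x + h) v - c) <= e / 4.
  move=> hv; have v1 : `|v| <= 1.
    by move: hv y1 yk1; rewrite !ler_norml; case: (leP y (y + k)); lra.
  rewrite FE//; apply: dP; apply: le_lt_trans hkd => /=.
  rewrite ler_sqrt ?addr_ge0 ?sqr_ge0// addrAC subrr add0r lerD2l.
  rewrite -(real_normK (num_real k)) -[X in X <= _]real_normK ?num_real//.
  rewrite lerXn2r ?nnegrE//.
  by move: hv; have := ler_norm k; have := ler_norm (- k); rewrite normrN ler_norml; case: (leP y (y + k)); lra.
have A1 := approx _ _ _ (hcont y) x1 xh1 near1.
have A2 := approx _ _ _ (vcont (x + h)) y1 yk1 near2.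
set T := (X in normc X).
have -> : T = (int (F^~ y) x (x + h) - c * (x + h - x)%:C) +
   'i * (int (F (x + h)) y (y + k) - c * (y + k - y)%:C).
  have Eh : (h +i* k : C) = (x + h - x)%:C + 'i * (y + k - y)%:C.
    by apply: complex_ext => /=; ring.
  rewrite /T Eh.
  have e1 : int (F^~ 0) 0 (x + h) = int (F^~ 0) 0 x + int (F^~ 0) x (x + h) by rewrite /int; ring.
  have e2 : int (F (x + h)) 0 (y + k) = int (F (x + h)) 0 y + int (F (x + h)) y (y + k) by rewrite /int; ring.
  have e3 : int (F^~ y) x (x + h) = int (F^~ 0) x (x + h) + 'i * int (F (x + h)) 0 y - 'i * int (F x) 0 y.
    by apply/eqP; rewrite eq_sym -subr_eq0 -g1; apply/eqP; ring.
  rewrite e1 e2 e3; ring.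
apply: le_trans (le_normcD _ _) _; rewrite normcM normc_i mul1r.
apply: le_trans (lerD A1 A2) _.
rewrite (_ : x + h - x = h); last by ring.
rewrite (_ : y + k - y = k); last by ring.
have := normc_Re (h +i* k); have := normc_Im (h +i* k) => /= n1 n2.
rewrite -mulrDr [leRHS](_ : _ = e / 2 * (2 * Num.sqrt (h ^+ 2 + k ^+ 2))); last by field.
by apply: ler_wpM2l; [rewrite divr_ge0// ltW|lra].
Qed.

End goursat.

(** * Harmonic functions on the disc *)

Section disc_compactness.
Variable R : realType.
Local Notation C := R[i].

(** Bisection of the square [[-1, 1]^2], where [Q] is asked of the part of each rectangle inside the
    disc. Rectangles shrinking to a point outside the disc end up missing it, so that [Q set0]
    settles them. This replaces finite subcovers. *)
Lemma disc_compact (Q : set C -> Prop) :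
  (forall A B : set C, A `<=` B -> Q B -> Q A) ->
  (forall A B, Q A -> Q B -> Q (A `|` B)) ->
  (forall z, normc z <= 1 -> exists2 d : R, 0 < d & Q [set s | normc (s - z) < d]) ->
  Q [set z | normc z <= 1].
Proof.
move=> Qsub Qunion Qloc.
have Q0 : Q set0.
  by have [d _] := Qloc 0 (eq_ind_r (fun x => x <= 1) ler01 (@normc0 R)); apply: Qsub.
pose rect (a b w h : R) := [set z : C | a <= complex.Re z <= a + w /\ b <= complex.Im z <= b + h /\ normc z <= 1].
apply: (@Qsub _ (rect (-1) (-1) 2 2)).
  move=> z /= z1; rewrite /rect/=.
  have := normc_Re z; have := normc_Im z; rewrite !ler_norml => h1 h2.
  split; [|split => //]; apply/andP; split; lra.
apply: (@bisection R (fun a b w h => Q (rect a b w h))) => //.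
  move=> a b w h w0 h0 P1 P2 P3 P4.
  apply: (Qsub _ _ _ (Qunion _ _ (Qunion _ _ P1 P2) (Qunion _ _ P3 P4))).
  move=> [x y] /=; rewrite /rect /setU /= => -[/andP[hx1 hx2] [/andP[hy1 hy2] z1]].
  have [hx|hx] := leP x (a + w / 2); have [hy|hy] := leP y (b + h / 2).
  - left; left; split; last split => //; apply/andP; split; lra.
  - right; left; split; last split => //; apply/andP; split; lra.
  - left; right; split; last split => //; apply/andP; split; lra.
  - right; right; split; last split => //; apply/andP; split; lra.
move=> x y _ _; have [z1|z1] := leP (normc (x +i* y)) 1.
  have [d d0 Qd] := Qloc _ z1; exists (d / 2); first by rewrite divr_gt0.
  move=> a b w h /andP[w0 wd] /andP[h0 hd] hx hy _ _ _ _; apply: Qsub Qd.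
  move=> [u v] [hu [hv _]]; rewrite /= in hu hv.
  change (normc ((u +i* v) - (x +i* y)) < d).
  apply: le_lt_trans (normc_le _) _ => /=.
  have h1 : `|u - x| < d / 2 by rewrite ltr_norml; lra.
  have h2 : `|v - y| < d / 2 by rewrite ltr_norml; lra.
  by have := ltrD h1 h2; rewrite -splitr.
exists ((normc (x +i* y) - 1) / 2); first by rewrite divr_gt0 ?subr_gt0.
move=> a b w h /andP[w0 wd] /andP[h0 hd] hx hy _ _ _ _; apply: Qsub Q0.
move=> [u v] [hu [hv]] uv1; exfalso; rewrite /= in hu hv.
have := ler_normcD3 (x +i* y) (u +i* v) 0; rewrite !subr0 => H.
have H2 : normc ((x +i* y) - (u +i* v)) <= w + h.
  apply: le_trans (normc_le _) _ => /=.
  have h1 : `|x - u| <= w by rewrite ler_norml; lra.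
  have h2 : `|y - v| <= h by rewrite ler_norml; lra.
  exact: lerD.
by have := le_trans H (lerD H2 uv1); lra.
Qed.

Lemma disc_bounded (u : C -> C) : (forall z, normc z <= 1 -> ccont u z) ->
  exists M, forall z, normc z <= 1 -> normc (u z) <= M.
Proof.
move=> cu; apply: (@disc_compact (fun A => exists M, forall z, A z -> normc (u z) <= M)).
- by move=> A B AB [M MP]; exists M => z /AB; apply: MP.
- move=> A B [M MP] [N NP]; exists (Num.max M N) => z [/MP|/NP] h; rewrite le_max h//.
  by rewrite orbT.
move=> z z1; have [d d0 dP] := cu z z1 1 ltr01; exists d => //.
exists (1 + normc (u z)) => s /dP h; rewrite -(subrK (u z) (u s)).
by apply: le_trans (le_normcD _ _) _; rewrite lerD2r.
Qed.

Lemma disc_unif_cont (u : C -> C) : (forall z, normc z <= 1 -> ccont u z) ->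
  forall e, 0 < e -> exists2 d, 0 < d &
    forall z s, normc z <= 1 -> normc (s - z) < d -> normc (u s - u z) <= e.
Proof.
move=> cu e e0.
apply: (@disc_compact (fun A => exists2 d : R, 0 < d & forall z s, A z -> normc (s - z) < d -> normc (u s - u z) <= e)).
- by move=> A B AB [d d0 dP]; exists d => // z s /AB; apply: dP.
- move=> A B [d d0 dP] [d' d'0 d'P]; exists (Num.min d d'); first by rewrite lt_min d0.
  by move=> z s [/dP|/d'P] h; rewrite lt_min => /andP[? ?]; apply: h.
move=> z z1; have [|d d0 dP] := cu z z1 (e / 2); first by rewrite divr_gt0.
exists (d / 2); first by rewrite divr_gt0.
exists (d / 2); first by rewrite divr_gt0.
move=> w s wz sw; apply: le_trans (ler_normcD3 _ (u z) _) _.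
rewrite [e]splitr; apply: lerD.
  apply: dP; apply: le_lt_trans (ler_normcD3 _ w _) _.
  by rewrite [d]splitr ltrD.
rewrite normcB; apply: dP; apply: lt_le_trans wz _; lra.
Qed.

Lemma disc_max (v : C -> R) :
  (forall z, normc z <= 1 -> forall e, 0 < e -> exists2 d, 0 < d &
     forall s, normc (s - z) < d -> `|v s - v z| <= e) ->
  exists2 p, normc p <= 1 & forall z, normc z <= 1 -> v z <= v p.
Proof.
move=> cv.
have [M MP] : exists M, forall z, normc z <= 1 -> v z <= M.
  apply: (@disc_compact (fun A => exists M, forall z, A z -> v z <= M)).
  - by move=> A B AB [M MP]; exists M => z /AB; apply: MP.
  - move=> A B [M MP] [N NP]; exists (Num.max M N) => z [/MP|/NP] h; rewrite le_max h//.
    by rewrite orbT.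
  move=> z z1; have [d d0 dP] := cv z z1 1 ltr01; exists d => //.
  by exists (1 + v z) => s /dP; rewrite ler_norml; lra.
have n0 : normc (0 : C) <= 1 by rewrite normc0.
pose V := [set v z | z in [set z : C | normc z <= 1]].
have supV : has_sup V.
  by split; [exists (v 0); exists 0|exists M => _ [z z1 <-]; exact: MP].
have vs z : normc z <= 1 -> v z <= sup V.
  by move=> z1; apply: sup_upper_bound => //; exists z.
apply: contrapT => nmax.
(* If the supremum is not attained, [v] stays locally below it by a positive amount, and compactness
   makes this gap uniform, which is absurd. *)
have [d d0 dP] : exists2 d, 0 < d & forall z, normc z <= 1 -> v z <= sup V - d.
  apply: (@disc_compact (fun A => exists2 d, 0 < d & forall z, A z -> v z <= sup V - d)).
  - by move=> A B AB [M' M0 M'P]; exists M' => // z /AB; apply: M'P.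
  - move=> A B [d d0 dP] [d' d'0 d'P]; exists (Num.min d d'); first by rewrite lt_min d0.
    by move=> z [/dP|/d'P] h; apply: le_trans h _; rewrite lerB// ge_min lexx ?orbT.
  move=> z z1; have vz : v z < sup V.
    rewrite lt_neqAle vs// andbT; apply/eqP => vz; apply: nmax; exists z => // s s1.
    by rewrite vz vs.
  have [|d d0 dP] := cv z z1 ((sup V - v z) / 2).
    by rewrite divr_gt0 ?subr_gt0.
  exists d => //; exists ((sup V - v z) / 2); first by rewrite divr_gt0 ?subr_gt0.
  by move=> s /dP; rewrite ler_norml; lra.
suff : sup V <= sup V - d by lra.
by apply: ge_sup; [exists (v 0); exists 0|move=> _ [z z1 <-]; exact: dP].
Qed.

End disc_compactness.

(** * The five-point Laplacian and the maximum principle *)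

Section generalized_laplacian.
Variable R : realType.
Local Notation C := R[i].

Definition cross (u : C -> C) z (r : R) :=
  u (z + r%:C) + u (z - r%:C) + u (z + 'i * r%:C) + u (z - 'i * r%:C) - 4 * u z.

(** Vanishing at [z] of a generalized Laplacian. No derivative of [u] is presupposed, so that a
    second-order expansion at the single point [z] is enough to establish it. *)
Definition genharm (u : C -> C) (z : C) := forall e : R, 0 < e ->
  exists2 d : R, 0 < d & forall r, 0 < r < d -> normc (cross u z r) <= e * r ^+ 2.

Lemma genharmB u v z : genharm u z -> genharm v z ->
  genharm (fun x => u x - v x) z.
Proof.
move=> hu hv e e0.
have [|d d0 dP] := hu (e / 2); first by rewrite divr_gt0.
have [|d' d'0 d'P] := hv (e / 2); first by rewrite divr_gt0.
exists (Num.min d d'); first by rewrite lt_min d0.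
move=> r /andP[r0]; rewrite lt_min => /andP[rd rd'].
have -> : cross (fun x => u x - v x) z r = cross u z r - cross v z r.
  by rewrite /cross; ring.
apply: le_trans (le_normcD _ _) _; rewrite normcN [e]splitr mulrDl.
by rewrite lerD ?dP ?d'P ?r0.
Qed.

(** If [u z0] exceeds [m] in modulus, rotate by [c] to make it real and add [eta |z|^2]. The
    resulting [v] attains its maximum inside the disc, where its five-point sum cannot be positive;
    but the added term makes it positive. *)
Lemma max_principle (u : C -> C) m :
  (forall z, normc z <= 1 -> ccont u z) ->
  (forall z, normc z < 1 -> genharm u z) ->
  (forall z, normc z = 1 -> normc (u z) <= m) ->
  forall z, normc z <= 1 -> normc (u z) <= m.
Proof.
move=> cu hu um z0 z01; rewrite leNgt; apply/negP => m0.
have m_ge0 : 0 <= m by apply: le_trans (um 1 (@normc1 R)); exact: normc_ge0.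
pose m1 := normc (u z0).
pose c := (u z0)^J / m1%:C.
have m1_gt0 : 0 < m1 by exact: le_lt_trans m0.
have nc : normc c = 1.
  by rewrite normcM normcV normc_conj normc_real gtr0_norm// divff// gt_eqF.
have cu0 : c * u z0 = m1%:C.
  rewrite /c mulrAC (mulrC (u z0)^J) -normc_sqE -/m1 expr2 real_complexM mulfK//.
  by rewrite -normc_gt0 normc_real gtr0_norm.
(* With [eta] half the gap, [v] is at most [m + eta] on the circle, below [v z0], so the maximum is
   interior. *)
have [eta [eta0 etaE]] : exists eta, 0 < eta /\ m + 2 * eta = m1.
  by exists ((m1 - m) / 2); rewrite divr_gt0 ?subr_gt0//; split=> //; field.
pose v z := complex.Re (c * u z) + eta * normc z ^+ 2.
have Rle z : complex.Re (c * u z) <= normc (u z).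
  by rewrite -[leRHS]mul1r -nc -normcM; apply: le_trans (ler_norm _) (normc_Re _).
have [p p1 pmax] : exists2 p, normc p <= 1 & forall z, normc z <= 1 -> v z <= v p.
  apply: disc_max => z z1 e e0.
  have [|d d0 dP] := cu z z1 (e / 2); first by rewrite divr_gt0.
  exists (Num.min (Num.min d 1) (e / 2 / (eta * 3))).
    rewrite !lt_min d0 ltr01 /=; apply: divr_gt0; first by rewrite divr_gt0.
    exact: mulr_gt0.
  move=> s; rewrite !lt_min => /andP[/andP[sd s1] se].
  have -> : v s - v z = complex.Re (c * (u s - u z)) + eta * ((normc s - normc z) * (normc s + normc z)).
    by rewrite mulrBr ReD ReN /v; ring.
  apply: le_trans (ler_normD _ _) _; rewrite [e]splitr; apply: lerD.
    by apply: le_trans (normc_Re _) _; rewrite normcM nc mul1r dP.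
  have hs : normc s <= 2.
    have := ler_normcD3 s z 0; rewrite !subr0; lra.
  have hsz : `|normc s - normc z| <= normc (s - z).
    have := ler_normcD3 s z 0; have := ler_normcD3 z s 0.
    by rewrite !subr0 (normcB z s) ler_norml; lra.
  rewrite normrM (gtr0_norm eta0) normrM.
  rewrite (ger0_norm (addr_ge0 (normc_ge0 s) (normc_ge0 z))).
  move: se; rewrite ltr_pdivlMr ?mulr_gt0// => se.
  have := normc_ge0 z; have := normc_ge0 s; have := normc_ge0 (s - z); have := normr_ge0 (normc s - normc z).
  move: hs hsz z1 se eta0; set A := `|_|; set B := normc (s - z).
  move=> hs hsz z1 se eta0 A0 B0 S0 Z0.
  apply: le_trans (ltW se); rewrite [leRHS]mulrCA ler_pM2l//.
  by nra.
have vz0 : m + eta < v z0.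
  rewrite /v cu0 /= -/m1; apply: (@lt_le_trans _ _ m1).
    by lra.
  by rewrite lerDl mulr_ge0 ?sqr_ge0// ltW.
have {}p1 : normc p < 1.
  rewrite lt_neqAle p1 andbT; apply/eqP => pe.
  have := le_lt_trans (pmax _ z01); have := um p pe; have := Rle p.
  move=> h1 h2; have := pmax _ z01; rewrite {2}/v pe expr1n mulr1; lra.
have [d d0 dP] := hu p p1 eta eta0.
pose r := Num.min d (1 - normc p) / 2.
have mn0 : 0 < Num.min d (1 - normc p) by rewrite lt_min d0 subr_gt0.
have r0 : 0 < r by rewrite divr_gt0.
have rd : r < d.
  by apply: (@lt_le_trans _ _ (Num.min d (1 - normc p))); [rewrite /r; lra|rewrite ge_min lexx].
have rp : normc p + r <= 1.
  have : r <= 1 - normc p.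
    apply: (@le_trans _ _ (Num.min d (1 - normc p))); [rewrite /r; lra|].
    by rewrite ge_min lexx orbT.
  by lra.
have := dP r; rewrite r0 rd => /(_ isT) H.
have vle h : normc h = r -> v (p + h) <= v p.
  by move=> hr; apply: pmax; apply: le_trans (le_normcD _ _) _; rewrite hr.
have nr : normc r%:C = r by rewrite normc_real gtr0_norm.
have nir : normc ('i * r%:C) = r by rewrite normcM normc_i mul1r nr.
have Rc : - (eta * r ^+ 2) <= complex.Re (c * cross u p r).
  rewrite lerNl; apply: le_trans H; rewrite -[leRHS]mul1r -nc -normcM.
  by rewrite -ReN; apply: le_trans (ler_norm _) _; rewrite -normcN; exact: normc_Re.
(* The five-point sum of [eta |z|^2] is exactly [4 eta r^2], which beats the error [eta r^2] coming
   from [u]. *)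
have sumsq : normc (p + r%:C) ^+ 2 + normc (p - r%:C) ^+ 2 + normc (p + 'i * r%:C) ^+ 2
    + normc (p - 'i * r%:C) ^+ 2 = 4 * normc p ^+ 2 + 4 * r ^+ 2.
  by rewrite !normc_sq; case: (p) => x y /=; ring.
have V : v (p + r%:C) + v (p - r%:C) + v (p + 'i * r%:C) + v (p - 'i * r%:C) - 4 * v p =
   complex.Re (c * cross u p r) + eta * (4 * r ^+ 2).
  rewrite -[eta * (4 * _)](_ : eta * (normc (p + r%:C) ^+ 2 + normc (p - r%:C) ^+ 2 + normc (p + 'i * r%:C) ^+ 2
    + normc (p - 'i * r%:C) ^+ 2) - 4 * (eta * normc p ^+ 2) = _); last by rewrite sumsq; ring.
  rewrite /cross /v !mulrDr !ReD mulrN ReN (_ : complex.Re (c * (4 * u p)) = 4 * complex.Re (c * u p)); first by ring.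
  by rewrite mulrCA (_ : 4 = (4 : R)%:C) ?ReMr// rmorph_nat.
have := vle _ nr; have := vle _ nir.
have := vle (- r%:C); rewrite normcN nr => /(_ erefl).
have := vle (- ('i * r%:C)); rewrite normcN nir => /(_ erefl).
have : 0 < eta * r ^+ 2 by rewrite mulr_gt0// exprn_gt0.
lra.
Qed.

End generalized_laplacian.

(** * Functions with vanishing generalized Laplacian *)

Section genharm_holo.
Variable R : realType.
Local Notation C := R[i].

Lemma is_derive_eps (f : R -> R) (x a : R) :
  (forall e, 0 < e -> exists2 d, 0 < d & forall h, `|h| < d ->
     `|f (x + h) - f x - a * h| <= e * `|h|) -> is_derive x 1 f a.
Proof.
move=> H.
have lim : (fun h => h^-1 *: (f (h *: 1 + x) - f x)) @ 0^' --> a.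
  apply/cvgrPdist_le => e e0; have [d d0 dP] := H e e0.
  near=> h; have h0 : h != 0 by near: h; exact: nbhs_dnbhs_neq.
  have hd : `|h| < d.
    by near: h; apply: dnbhs0_lt.
  rewrite /GRing.scale /= mulr1 (addrC h).
  rewrite -[a](mulKf h0) -mulrBr normrM normfV mulrC ler_pdivrMr ?normr_gt0//.
  by rewrite distrC [h * a]mulrC; exact: dP.
by apply: DeriveDef; [apply/cvg_ex; exists a|exact/cvg_lim].
Unshelve. all: by end_near. Qed.

Lemma is_cderive_line (F : C -> C) (z s a : C) (x : R) :
  cdiff F (z + x%:C * s) a -> is_cderive x (fun t => F (z + t%:C * s)) (a * s).
Proof.
move=> Fa.
have H e : 0 < e -> exists2 d, 0 < d & forall h : R, `|h| < d ->
    normc (F (z + (x + h)%:C * s) - F (z + x%:C * s) - a * s * h%:C) <= e * `|h|.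
  move=> e0; have s1 : 0 < normc s + 1 by rewrite ltr_wpDl// normc_ge0.
  have [d d0 dP] := Fa (e / (normc s + 1)) (divr_gt0 e0 s1).
  exists (d / (normc s + 1)); first by rewrite divr_gt0.
  move=> h; rewrite ltr_pdivlMr// => hd.
  have -> : z + (x + h)%:C * s = z + x%:C * s + h%:C * s by rewrite real_complexD; ring.
  have nh : normc (h%:C * s) = `|h| * normc s by rewrite normcM normc_real.
  have hs : `|h| * normc s <= `|h| * (normc s + 1) by rewrite ler_wpM2l// lerDl.
  have := dP (h%:C * s); rewrite nh (_ : a * (h%:C * s) = a * s * h%:C); last by ring.
  move=> /(_ (le_lt_trans hs hd)) H; apply: le_trans H _.
  rewrite mulrAC ler_pdivrMr// -mulrA ler_pM2l//.
split; apply: is_derive_eps => e e0; have [d d0 dP] := H e e0; exists d => // h hd.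
  apply: le_trans (dP h hd); rewrite -ReN -ReD; apply: le_trans (normc_Re _).
  by rewrite [X in _ <= `|X|]ReD (ReN (_ * h%:C)) [a * s * _]mulrC ReMr [h * _]mulrC.
apply: le_trans (dP h hd); rewrite -ImN -ImD; apply: le_trans (normc_Im _).
by rewrite [X in _ <= `|X|]ImD (ImN (_ * h%:C)) [a * s * _]mulrC ImMr [h * _]mulrC.
Qed.

(** The mean value bound along the segment from [z] to [z + s]: the derivative of the remainder is
    [s] times the first-order remainder of [f] at [z], so differentiability of [f] at that one point
    suffices. *)
Lemma second_order (F f : C -> C) (z a : C) (rho : R) : 0 < rho ->
  (forall h, normc h < rho -> cdiff F (z + h) (f (z + h))) -> cdiff f z a ->
  forall e, 0 < e -> exists2 d, 0 < d & forall s, normc s < d ->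
    normc (F (z + s) - F z - s * f z - s * s * a / 2) <= e * normc s ^+ 2.
Proof.
move=> rho0 Ff fa e e0.
have e20 : 0 < e / 2 by rewrite divr_gt0.
have [d d0 dP] := fa _ e20; exists (Num.min d rho); first by rewrite lt_min d0.
move=> s; rewrite lt_min => /andP[sd srho].
have half : (2^-1)%:C = 2^-1 :> C by rewrite fmorphV rmorph_nat.
pose A : C := s * f z; pose B : C := 2^-1 * (s * s * a).
pose G (x : R) := F (z + x%:C * s) - (x%:C * A + (x ^+ 2)%:C * B).
have sx (x : R) : 0 <= x <= 1 -> normc (x%:C * s) <= normc s.
  move=> /andP[x0 x1]; rewrite normcM normc_real ger0_norm//.
  by rewrite ler_piMl// normc_ge0.
have := @cmean_value_bound R G (fun x => f (z + x%:C * s) * s - (A + (2 * x)%:C * B)) 0 1 (e / 2 * normc s ^+ 2) ler01.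
have -> : G 1 - G 0 = F (z + s) - F z - s * f z - s * s * a / 2.
  by rewrite /G /A /B !expr2 mulr0 mulr1 !mul0r !mul1r !addr0 subr0; ring.
have -> : 2 * (e / 2 * normc s ^+ 2) * (1 - 0) = e * normc s ^+ 2 by field.
apply.
  move=> x x01; apply: is_cderiveB.
    by apply: is_cderive_line; apply: Ff; exact: le_lt_trans (sx _ x01) srho.
  case: (A) => A1 A2; case: (B) => B1 B2; split.
    rewrite (_ : (fun _ => _) = (fun t : R => t * A1 + t ^+ 2 * B1)).
      by apply: is_derive_eq; rewrite ReD ReMr /GRing.scale/=; ring.
    by apply/funext => t; rewrite ReD !ReMr.
  rewrite (_ : (fun _ => _) = (fun t : R => t * A2 + t ^+ 2 * B2)).
    by apply: is_derive_eq; rewrite ImD ImMr /GRing.scale/=; ring.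
  by apply/funext => t; rewrite ImD !ImMr.
move=> x x01.
have -> : f (z + x%:C * s) * s - (A + (2 * x)%:C * B) = s * (f (z + x%:C * s) - f z - a * (x%:C * s)).
  by rewrite /A /B real_complexM rmorph_nat; field.
rewrite normcM expr2 [leRHS]mulrCA; apply: ler_wpM2l; first exact: normc_ge0.
apply: le_trans (dP _ _) _; first exact: le_lt_trans (sx _ x01) sd.
by rewrite ler_pM2l// sx.
Qed.

(** In the five-point sum the linear terms cancel in opposite pairs, and the quadratic ones because
    the square of [i r] is [- r^2]. Primitives are considered because the derivative of a complex
    differentiable function is not yet known to be differentiable. *)
Lemma genharm_primitive (F f : C -> C) (z a : C) (rho : R) : 0 < rho ->
  (forall h, normc h < rho -> cdiff F (z + h) (f (z + h))) -> cdiff f z a ->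
  genharm F z.
Proof.
move=> rho0 Ff fa e e0.
have e40 : 0 < e / 4 by rewrite divr_gt0.
have [d d0 dP] := second_order rho0 Ff fa e40; exists d => // r /andP[r0 rd].
pose E s := F (z + s) - F z - s * f z - s * s * a / 2.
have i2 : 'i * 'i = -1 :> C by rewrite -expr2 sqr_i.
have -> : cross F z r = E r%:C + E (- r%:C) + E ('i * r%:C) + E (- ('i * r%:C)).
  rewrite /cross /E !mulrNN !mulNr !opprK (_ : 'i * r%:C * ('i * r%:C) = - (r%:C * r%:C)); first by field.
  by rewrite mulrACA i2 mulN1r.
have nr : normc r%:C = r by rewrite normc_real gtr0_norm.
have nir : normc ('i * r%:C) = r by rewrite normcM normc_i mul1r nr.
rewrite (_ : e * r ^+ 2 = e / 4 * r ^+ 2 + e / 4 * r ^+ 2 + e / 4 * r ^+ 2 + e / 4 * r ^+ 2); last by field.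
have P s : normc s = r -> normc (E s) <= e / 4 * r ^+ 2.
  by move=> sr; rewrite -sr; apply: dP; rewrite sr.
do 3 (apply: le_trans (le_normcD _ _) _; apply: lerD; last by apply: P; rewrite ?normcN).
by apply: P; rewrite ?normcN.
Qed.

Lemma cdiff_cst (c z : C) : cdiff (fun=> c) z 0.
Proof.
move=> e e0; exists 1 => // h _; rewrite subrr mul0r subrr normc0.
by rewrite mulr_ge0 ?normc_ge0// ltW.
Qed.

Lemma cdiffD (f g : C -> C) z a b : cdiff f z a -> cdiff g z b ->
  cdiff (fun x => f x + g x) z (a + b).
Proof.
move=> fa gb e e0.
have [|d d0 dP] := fa (e / 2); first by rewrite divr_gt0.
have [|d' d'0 d'P] := gb (e / 2); first by rewrite divr_gt0.
exists (Num.min d d'); first by rewrite lt_min d0.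
move=> h; rewrite lt_min => /andP[hd hd'].
have -> : f (z + h) + g (z + h) - (f z + g z) - (a + b) * h =
  (f (z + h) - f z - a * h) + (g (z + h) - g z - b * h) by ring.
apply: le_trans (le_normcD _ _) _; rewrite [e]splitr mulrDl.
by rewrite lerD ?dP ?d'P.
Qed.

Lemma cdiffZ k (f : C -> C) z a : cdiff f z a -> cdiff (fun x => k * f x) z (k * a).
Proof.
move=> fa e e0; have k1 : 0 < normc k + 1 by rewrite ltr_wpDl// normc_ge0.
have [|d d0 dP] := fa (e / (normc k + 1)); first by rewrite divr_gt0.
exists d => // h hd.
have -> : k * f (z + h) - k * f z - k * a * h = k * (f (z + h) - f z - a * h) by ring.
rewrite normcM; apply: le_trans (ler_wpM2l (normc_ge0 _) (dP h hd)) _.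
rewrite mulrA ler_wpM2r ?normc_ge0// mulrCA ler_piMr//; first exact: ltW.
by rewrite ler_pdivrMr// mul1r lerDl.
Qed.

Lemma cdiff_mulX (f : C -> C) z a : cdiff f z a -> cdiff (fun x => x * f x) z (f z + z * a).
Proof.
move=> fa e e0; have cf := cdiff_ccont fa.
have [|d d0 dP] := cf (e / 2); first by rewrite divr_gt0.
have z1 : 0 < normc z + 1 by rewrite ltr_wpDl// normc_ge0.
have [|d' d'0 d'P] := fa (e / 2 / (normc z + 1)); first by rewrite !divr_gt0.
exists (Num.min d d'); first by rewrite lt_min d0.
move=> h; rewrite lt_min => /andP[hd hd'].
have -> : (z + h) * f (z + h) - z * f z - (f z + z * a) * h =
  z * (f (z + h) - f z - a * h) + (f (z + h) - f z) * h by ring.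
apply: le_trans (le_normcD _ _) _; rewrite !normcM [e]splitr mulrDl; apply: lerD.
  apply: le_trans (ler_wpM2l (normc_ge0 _) (d'P h hd')) _.
  rewrite mulrA ler_wpM2r ?normc_ge0// mulrCA ler_piMr//.
    by rewrite divr_ge0// ltW.
  by rewrite ler_pdivrMr// mul1r lerDl.
rewrite ler_wpM2r ?normc_ge0//; apply: dP; by rewrite addrC addKr.
Qed.

Lemma cdiff_poly (p : {poly C}) z : cdiff (fun x => p.[x]) z (p^`()).[z].
Proof.
elim/poly_ind: p => [|p c IH].
  rewrite deriv0 horner0 (_ : (fun _ => _) = (fun=> 0)); first exact: cdiff_cst.
  by apply/funext => x; rewrite horner0.
rewrite (_ : (fun _ => _) = (fun x => x * p.[x] + c)).
  have := cdiffD (cdiff_mulX IH) (cdiff_cst c z).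
  by rewrite addr0 derivD derivC derivM derivX !hornerE addrC mulrC.
by apply/funext => x; rewrite hornerMXaddC mulrC.
Qed.

Lemma genharm_poly (p : {poly C}) z : genharm (fun x => p.[x]) z.
Proof.
apply: (@genharm_primitive _ (fun x => (p^`()).[x]) _ (p^`()^`()).[z] 1) => //.
  by move=> h _; exact: cdiff_poly.
exact: cdiff_poly.
Qed.

Lemma genharm_conj (u : C -> C) z : genharm u z^J -> genharm (fun x => u x^J) z.
Proof.
move=> hu e e0; have [d d0 dP] := hu e e0; exists d => // r /dP.
rewrite (_ : cross u z^J r = cross (fun x => u x^J) z r)//.
rewrite /cross.
have -> : (z + r%:C)^J = z^J + r%:C by case: (z) => x y; apply: complex_ext => /=; ring.
have -> : (z - r%:C)^J = z^J - r%:C by case: (z) => x y; apply: complex_ext => /=; ring.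
have -> : (z + 'i * r%:C)^J = z^J - 'i * r%:C by case: (z) => x y; apply: complex_ext => /=; ring.
have -> : (z - 'i * r%:C)^J = z^J + 'i * r%:C by case: (z) => x y; apply: complex_ext => /=; ring.
ring.
Qed.

Definition hpol (p q : {poly C}) (z : C) := p.[z] + q.[z^J].

Lemma ccont_poly (p : {poly C}) z : ccont (fun x => p.[x]) z.
Proof. exact: cdiff_ccont (cdiff_poly p z). Qed.

Lemma ccont_conj (u : C -> C) z : ccont u z^J -> ccont (fun x => u x^J) z.
Proof.
move=> cu e e0; have [d d0 dP] := cu e e0; exists d => // s sd; apply: dP.
by rewrite -rmorphB normc_conj.
Qed.

Lemma ccontD (u v : C -> C) z : ccont u z -> ccont v z -> ccont (fun x => u x + v x) z.
Proof.
move=> cu cv e e0.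
have [|d d0 dP] := cu (e / 2); first by rewrite divr_gt0.
have [|d' d'0 d'P] := cv (e / 2); first by rewrite divr_gt0.
exists (Num.min d d'); first by rewrite lt_min d0.
move=> s; rewrite lt_min => /andP[sd sd'].
have -> : u s + v s - (u z + v z) = (u s - u z) + (v s - v z) by ring.
by apply: le_trans (le_normcD _ _) _; rewrite [e]splitr lerD ?dP ?d'P.
Qed.

Lemma ccontN (u : C -> C) z : ccont u z -> ccont (fun x => - u x) z.
Proof.
move=> cu e e0; have [d d0 dP] := cu e e0; exists d => // s sd.
by rewrite -opprD normcN dP.
Qed.

Lemma ccont_hpol p q z : ccont (hpol p q) z.
Proof.
by apply: ccontD; [exact: ccont_poly|apply: (@ccont_conj (fun x => q.[x])); exact: ccont_poly].
Qed.

Lemma genharm_hpol p q z : genharm (hpol p q) z.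
Proof.
rewrite (_ : hpol p q = fun x => p.[x] - (- q).[x^J]).
  apply: genharmB; first exact: genharm_poly.
  by apply: (@genharm_conj (fun x => (- q).[x])); exact: genharm_poly.
by apply/funext => x; rewrite hornerN opprK.
Qed.

End genharm_holo.

(** * Orthogonality of powers of roots of unity *)

Section roots_of_unity.
Variable R : realType.
Local Notation C := R[i].

Lemma complex_prim_root n : (0 < n)%N -> exists w : C, n.-primitive_root w.
Proof.
move=> n_gt0; pose p : {poly C} := 'X^n - 1.
have [r Dp] := closed_field_poly_normal p.
rewrite (monicP _) ?monicXnsubC// scale1r in Dp.
have rn1 : all n.-unity_root r by apply/allP=> z; rewrite -root_prod_XsubC -Dp.
have sz_r : (n < (size r).+1)%N.
  by rewrite -(size_prod_XsubC r id) -Dp size_XnsubC.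
have [|z] := hasP (has_prim_root n_gt0 rn1 _ sz_r); last by exists z.
by rewrite -separable_prod_XsubC -Dp separable_Xn_sub_1// pnatr_eq0 -lt0n.
Qed.

Lemma normc1_conjM (w : C) : normc w = 1 -> w * w^J = 1.
Proof. by rewrite -normc_sqE => ->; rewrite expr1n. Qed.

Lemma unity_normc n (w : C) : (0 < n)%N -> w ^+ n = 1 -> normc w = 1.
Proof.
move=> n0 /(congr1 (@normc R)); rewrite normcX normc1 => /eqP.
by rewrite pexpr_eq1 ?normc_ge0// => /eqP.
Qed.

Variables (N : nat) (w : C).
Hypothesis w_prim : N.-primitive_root w.

Lemma root_normc j : normc (w ^+ j) = 1.
Proof.
have N0 := prim_order_gt0 w_prim.
by rewrite normcX (unity_normc N0 (prim_expr_order w_prim)) expr1n.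
Qed.

(** Conjugation inverts [w], so this is a geometric sum whose ratio is an [N]-th root of unity,
    equal to 1 exactly when [k] and [l] agree modulo [N]. *)
Lemma root_sum k l : \sum_(j < N) (w ^+ j) ^+ k * ((w ^+ j)^J) ^+ l =
  if (k == l %[mod N]) then N%:R else 0.
Proof.
have N0 := prim_order_gt0 w_prim.
have nw : w * w^J = 1 by apply: normc1_conjM; have := root_normc 1; rewrite expr1.
pose x := w ^+ k * w^J ^+ l.
have -> : \sum_(j < N) (w ^+ j) ^+ k * ((w ^+ j)^J) ^+ l = \sum_(j < N) x ^+ j.
  apply: eq_bigr => j _; rewrite rmorphXn /x exprMn.
  by rewrite -!exprM ![(j * _)%N]mulnC.
have xl : x * w ^+ l = w ^+ k by rewrite /x -mulrA -exprMn [w^J * _]mulrC nw expr1n mulr1.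
have xN : x ^+ N = 1.
  rewrite /x exprMn -!exprM ![(_ * N)%N]mulnC !exprM (prim_expr_order w_prim).
  by rewrite -(rmorphXn conjc) (prim_expr_order w_prim) rmorph1 !expr1n mulr1.
have w0 : w != 0 by rewrite -normc_gt0; have := root_normc 1; rewrite expr1 => ->.
case: ifPn => [|ne].
  rewrite -(eq_prim_root_expr w_prim) -xl => /eqP xl1.
  have -> : x = 1 by apply: (mulIf (expf_neq0 l w0)); rewrite xl1 mul1r.
  by rewrite (eq_bigr (fun=> 1)) => [|i _]; rewrite ?expr1n// sumr_const card_ord.
have x1 : x != 1.
  apply: contra ne => /eqP x1; move: xl; rewrite x1 mul1r => /eqP.
  by rewrite (eq_prim_root_expr w_prim) eq_sym.
apply/eqP; have := subrX1 x N; rewrite xN subrr => /eqP.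
by rewrite eq_sym mulf_eq0 subr_eq0 (negPf x1).
Qed.

End roots_of_unity.

(** * Korovkin approximation on the circle *)

Section korovkin.
Variable R : realType.
Local Notation C := R[i].

Definition istrig (g : C -> C) := exists p q, forall w, normc w = 1 -> g w = hpol p q w.

Lemma istrig_monomial c k l : istrig (fun w => c * (w ^+ k * w^J ^+ l)).
Proof.
have [kl|/ltnW kl] := leqP l k.
  exists (c *: 'X^(k - l)), 0 => w w1; rewrite /hpol horner0 addr0 hornerZ hornerXn.
  have -> : w ^+ k = w ^+ (k - l) * w ^+ l by rewrite -exprD subnK.
  by rewrite -[_ * _ * w^J ^+ l]mulrA -exprMn normc1_conjM// expr1n mulr1.
exists 0, (c *: 'X^(l - k)) => w w1; rewrite /hpol horner0 add0r hornerZ hornerXn.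
have -> : w^J ^+ l = w^J ^+ k * w^J ^+ (l - k) by rewrite -exprD subnKC.
by rewrite [w ^+ k * _]mulrA -exprMn normc1_conjM// expr1n mul1r.
Qed.

Lemma istrig_sum (I : Type) (s : seq I) (P : pred I) (F : I -> C -> C) :
  (forall i, istrig (F i)) -> istrig (fun w => \sum_(i <- s | P i) F i w).
Proof.
move=> HF; elim: s => [|i s [p [q pq]]].
  by exists 0, 0 => w _; rewrite big_nil /hpol !horner0 addr0.
have [p' [q' pq']] := HF i; exists (if P i then p' + p else p), (if P i then q' + q else q) => w w1.
rewrite big_cons; case: ifP => _; rewrite pq// pq'// /hpol !hornerD; ring.
Qed.

(** The de la Vallee Poussin kernel: on the unit circle it is [|1 + z|^(2 n)] divided by the central
    binomial coefficient, hence nonnegative, and it is a trigonometric polynomial of degree [n]. *)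
Definition kern n (z : C) : C := ('C(n.*2, n)%:R)^-1 * (z^J ^+ n * (1 + z) ^+ n.*2).

Lemma kern_ge0 n z : normc z = 1 -> kern n z = (normc (kern n z))%:C.
Proof.
move=> z1; have E : z^J * (1 + z) ^+ 2 = (normc (1 + z) ^+ 2)%:C.
  rewrite normc_sqE rmorphD rmorph1.
  have -> : z^J * (1 + z) ^+ 2 = z^J + 2 * (z * z^J) + z * (z * z^J) by ring.
  have -> : (1 + z) * (1 + z^J) = 1 + z + z^J + z * z^J by ring.
  by rewrite normc1_conjM//; ring.
have K : kern n z = (('C(n.*2, n)%:R)^-1 * (normc (1 + z) ^+ 2) ^+ n)%:C.
  rewrite /kern -mul2n exprM -exprMn E [RHS]real_complexM fmorphV rmorph_nat.
  by rewrite [in RHS]real_complexX.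
by rewrite K normc_real ger0_norm// mulr_ge0 ?invr_ge0 ?ler0n// exprn_ge0 ?sqr_ge0.
Qed.

Variables (n : nat) (w : C).
Hypothesis w_prim : (n.+2).-primitive_root w.
Let N := n.+2.

(** Convolution with the kernel, discretized on the roots of unity of order [n + 2]. A finite sum
    avoids integration, keeps positivity, and is a trigonometric polynomial in [z]. *)
Definition kop (u : C -> C) (z : C) : C :=
  N%:R^-1 * \sum_(j < N) u (w ^+ j) * kern n (z * (w ^+ j)^J).

Lemma kop_trig u : istrig (kop u).
Proof.
have -> : kop u = fun z => \sum_(j < N) \sum_(k < n.*2.+1) (N%:R^-1 * u (w ^+ j) * ('C(n.*2, n)%:R)^-1 *
    ((w ^+ j) ^+ n * (w ^+ j)^J ^+ k *+ 'C(n.*2, k)) * (z ^+ k * z^J ^+ n)).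
  apply/funext => z; rewrite /kop mulr_sumr; apply: eq_bigr => j _.
  rewrite /kern exprDn !mulr_sumr; apply: eq_bigr => k _.
  rewrite expr1n mul1r conjcM conjcK !exprMn.
  rewrite !mulrnAr !mulrnAl; congr (_ *+ _); ring.
by apply: istrig_sum => j; apply: istrig_sum => k; exact: istrig_monomial.
Qed.

End korovkin.

Section korovkin_estimate.
Variable R : realType.
Local Notation C := R[i].
Variables (n : nat) (w : C).
Hypothesis n0 : (0 < n)%N.
Hypothesis w_prim : (n.+2).-primitive_root w.
Let N := n.+2.

Let N0 : N%:R != 0 :> C. Proof. by rewrite pnatr_eq0. Qed.

(** The orthogonality relations select the [k <= 2 n] congruent to [n + e] modulo [n + 2]. For
    [e <= 1] only [k = n + e] qualifies, so that [n + 2] nodes already give exact moments. *)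
Lemma kop_moment e z : (e <= 1)%N ->
  kop n w (fun x => x ^+ e) z =
    'C(n.*2, n + e)%:R / 'C(n.*2, n)%:R * (z ^+ (n + e) * z^J ^+ n).
Proof.
move=> e1; rewrite /kop -/N.
have -> : \sum_(j < N) (w ^+ j) ^+ e * kern n (z * (w ^+ j)^J) =
   \sum_(k < n.*2.+1) (('C(n.*2, n)%:R)^-1 * (z^J ^+ n * (z ^+ k *+ 'C(n.*2, k)))) *
     \sum_(j < N) (w ^+ j) ^+ (n + e) * (w ^+ j)^J ^+ k.
  rewrite (eq_bigr (fun j : 'I_N => \sum_(k < n.*2.+1) (('C(n.*2, n)%:R)^-1 *
      (z^J ^+ n * (z ^+ k *+ 'C(n.*2, k)))) * ((w ^+ j) ^+ (n + e) * (w ^+ j)^J ^+ k))).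
    by rewrite exchange_big; apply: eq_bigr => k _; rewrite mulr_sumr.
  move=> j _; rewrite /kern exprDn !mulr_sumr; apply: eq_bigr => k _.
  rewrite expr1n mul1r conjcM conjcK !exprMn exprD.
  rewrite !mulrnAr !mulrnAl; congr (_ *+ _); ring.
have ne : (n + e < n.*2.+1)%N by lia.
rewrite (bigD1 (Ordinal ne)) //= (root_sum w_prim) eqxx big1 => [|k kne].
  by rewrite addr0 -mulr_natr; field; rewrite N0 pnatr_eq0 -lt0n bin_gt0; lia.
rewrite (root_sum w_prim) ifF ?mulr0//; apply/negbTE.
apply: contra kne => /eqP H; apply/eqP/val_inj => /=.
move: H; rewrite modn_small; last by lia.
have := ltn_ord k; have [kN|Nk] := ltnP k n.+2; first by rewrite modn_small.
move=> k2; rewrite -(subnK Nk) modnDr modn_small; lia.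
Qed.

Lemma kop_moment0 z : normc z = 1 -> kop n w (fun=> 1) z = 1.
Proof.
move=> z1; have := @kop_moment 0 z isT; rewrite addn0 -exprMn normc1_conjM// expr1n mulr1.
by rewrite divff// pnatr_eq0 -lt0n bin_gt0; lia.
Qed.

Lemma kop_moment1 z : normc z = 1 -> kop n w id z = (n%:R / n.+1%:R)%:C * z.
Proof.
move=> z1; have := @kop_moment 1 z isT.
rewrite (_ : (fun x => x ^+ 1) = id) => [->|]; last first.
  by apply/funext => x; rewrite expr1.
rewrite addn1 exprS -[z * _ * _]mulrA -exprMn normc1_conjM// expr1n mulr1; congr (_ * _).
rewrite real_complexM fmorphV !rmorph_nat.
have b0 : 'C(n.*2, n)%:R != 0 :> C by rewrite pnatr_eq0 -lt0n bin_gt0; lia.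
have := mul_bin_left n.*2 n => /(congr1 (fun k => k%:R : C)).
rewrite !natrM (_ : (n.*2 - n)%N = n); last by lia.
move=> E; apply: (mulIf b0); rewrite divfK//; apply: (@mulfI _ n.+1%:R); first by rewrite pnatr_eq0.
by rewrite E mulrA mulrCA divff ?mulr1// pnatr_eq0.
Qed.

(** Korovkin's argument: the weights are nonnegative with mean 1, and the mean of [|x - z|^2],
    computed from the moments of 1 and the identity, is [2 - 2 n / (n + 1) = 2 / (n + 1)]. *)
Lemma kop_estimate (u : C -> C) (z : C) (e A : R) : normc z = 1 -> 0 <= e -> 0 <= A ->
  (forall x, normc x = 1 -> normc (u x - u z) <= e + A * normc (x - z) ^+ 2) ->
  normc (kop n w u z - u z) <= e + A * (2 / n.+1%:R).
Proof.
move=> z1 e0 A0 Hu.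
pose k j := normc (kern n (z * (w ^+ j)^J)).
have rn j : normc (w ^+ j) = 1 by apply: root_normc w_prim _.
have kE (j : nat) : kern n (z * (w ^+ j)^J) = (k j)%:C.
  by apply: kern_ge0; rewrite normcM normc_conj rn z1 mulr1.
have k0 j : 0 <= k j by exact: normc_ge0.
have M0 : N%:R^-1 * \sum_(j < N) k j = 1 :> R.
  apply/complexI; rewrite -[RHS](kop_moment0 z1) /kop real_complexM fmorphV rmorph_nat.
  congr (_ * _); rewrite real_complex_sum; apply: eq_bigr => j _.
  by rewrite mul1r kE.
have M1 : N%:R^-1 * \sum_(j < N) k j * normc (w ^+ j - z) ^+ 2 = 2 / n.+1%:R :> R.
  have m1 := kop_moment1 z1; rewrite /kop -/N in m1.
  have m0 := kop_moment0 z1; rewrite /kop -/N in m0.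
  rewrite (eq_bigr (fun j : 'I_N => kern n (z * (w ^+ j)^J))) in m0; last by move=> j _; rewrite mul1r.
  have m1' : N%:R^-1 * \sum_(j < N) (w ^+ j)^J * kern n (z * (w ^+ j)^J) = (n%:R / n.+1%:R)%:C * z^J.
    have := congr1 (@conjc R) m1; rewrite !conjcM conjc_real conjc_sum => <-.
    rewrite conjc_inv conjc_nat; congr (_ * _); apply: eq_bigr => j _.
    by rewrite conjcM kE conjc_real.
  have zz := normc1_conjM z1.
  have nn : n.+1%:R != 0 :> C by rewrite pnatr_eq0.
  apply/complexI; rewrite real_complexM fmorphV rmorph_nat real_complex_sum.
  rewrite (eq_bigr (fun j : 'I_N => 2 * kern n (z * (w ^+ j)^J) - z^J * (w ^+ j * kern n (z * (w ^+ j)^J))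
      - z * ((w ^+ j)^J * kern n (z * (w ^+ j)^J)))); last first.
    move=> j _; rewrite real_complexM normc_sqE kE conjcB.
    have ww := normc1_conjM (rn j).
    have -> : (w ^+ j - z) * ((w ^+ j)^J - z^J) = w ^+ j * (w ^+ j)^J + z * z^J
       - z^J * w ^+ j - z * (w ^+ j)^J by ring.
    by rewrite ww zz; ring.
  rewrite !big_split /= !sumrN -[X in _ * (X - _ - _)]mulr_sumr -[X in _ * (_ - X - _)]mulr_sumr -[X in _ * (_ - _ - X)]mulr_sumr.
  rewrite (_ : N%:R^-1 * _ = 2 * (N%:R^-1 * \sum_(j < N) kern n (z * (w ^+ j)^J))
     - z^J * (N%:R^-1 * \sum_(j < N) w ^+ j * kern n (z * (w ^+ j)^J))
     - z * (N%:R^-1 * \sum_(j < N) (w ^+ j)^J * kern n (z * (w ^+ j)^J))); last by ring.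
  rewrite m0 m1 m1' !real_complexM fmorphV !rmorph_nat.
  have -> : 2 * 1 - z^J * (n%:R / n.+1%:R * z) - z * (n%:R / n.+1%:R * z^J) =
     2 - 2 * (n%:R / n.+1%:R) * (z * z^J) by ring.
  by rewrite zz mulr1 -[n.+1]addn1 natrD; field; rewrite natr1.
have -> : kop n w u z - u z = N%:R^-1 * \sum_(j < N) (u (w ^+ j) - u z) * (k j)%:C.
  have uzE : u z = N%:R^-1 * \sum_(j < N) u z * (k j)%:C.
    have := congr1 (fun x : R => x%:C) M0; rewrite /= real_complexM fmorphV rmorph_nat real_complex_sum => E.
    by rewrite -mulr_sumr mulrCA E mulr1.
  rewrite {1}uzE /kop -mulrBr -sumrB; congr (_ * _); apply: eq_bigr => j _.
  by rewrite kE; ring.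
rewrite normcM normcV (_ : normc N%:R = N%:R); last first.
  by rewrite -(rmorph_nat (real_complex R)) normc_real ger0_norm.
have -> : e + A * (2 / n.+1%:R) = N%:R^-1 * \sum_(j < N) (e + A * normc (w ^+ j - z) ^+ 2) * k j.
  rewrite -M1; have {1}-> : e = e * (N%:R^-1 * \sum_(j < N) k j) by rewrite M0 mulr1.
  rewrite (mulrCA e) (mulrCA A) -mulrDr; congr (_ * _).
  by rewrite !mulr_sumr -big_split; apply: eq_bigr => j _ /=; ring.
rewrite ler_wpM2l ?invr_ge0 ?ler0n//; apply: le_trans (normc_sum _ _ _) _.
apply: ler_sum => j _; rewrite normcM normc_real (ger0_norm (k0 j)) ler_wpM2r//.
by apply: Hu.
Qed.

End korovkin_estimate.

(** * Uniform approximation by harmonic polynomials *)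

Section harmonic_approximation.
Variable R : realType.
Local Notation C := R[i].

Definition happrox (u : C -> C) := forall e : R, 0 < e ->
  exists p q, forall z, normc z <= 1 -> normc (u z - hpol p q z) <= e.

(** On the circle [u] is approximated by a trigonometric polynomial, which extends to a harmonic
    polynomial on the disc; the maximum principle carries the estimate inside. *)
Lemma genharm_happrox (u : C -> C) :
  (forall z, normc z <= 1 -> ccont u z) ->
  (forall z, normc z < 1 -> genharm u z) -> happrox u.
Proof.
move=> cu hu e e0.
suff [p [q pq]] : exists p q, forall z, normc z = 1 -> normc (u z - hpol p q z) <= e.
  exists p, q; apply: (@max_principle R (fun z => u z - hpol p q z)) => //.
    move=> z z1; apply: ccontD; first exact: cu.
    by apply: ccontN; exact: ccont_hpol.
  by move=> z z1; apply: genharmB; [exact: hu|exact: genharm_hpol].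
have [M MP] := disc_bounded cu.
have M0 : 0 <= M by apply: le_trans (MP 0 _); rewrite ?normc_ge0// normc0.
have [|d d0 dP] := disc_unif_cont cu (e := e / 2); first by rewrite divr_gt0.
(* Points closer than [d] are handled by uniform continuity; for the others, the trivial bound [2 M]
   is at most [A |x - z|^2]. The choice of [n] then makes [A * (2 / (n + 1))] at most [e / 2]. *)
pose A := 2 * M / d ^+ 2.
have A0 : 0 <= A by apply: divr_ge0; [exact: mulr_ge0|exact: sqr_ge0].
pose n := (Num.bound (4 * A / e)).+1.
have [w w_prim] := @complex_prim_root R n.+2 isT.
have [p [q pq]] := kop_trig n w u; exists p, q => z z1.
rewrite -pq// normcB.
apply: le_trans (@kop_estimate R n w isT w_prim u z (e / 2) A z1 _ A0 _) _.
- by rewrite divr_ge0// ltW.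
- move=> x x1; have [xz|xz] := ltP (normc (x - z)) d.
    apply: (@le_trans _ _ (e / 2)); last by rewrite lerDl mulr_ge0 ?sqr_ge0.
    by apply: dP xz; rewrite z1.
  apply: (@le_trans _ _ (2 * M)).
    apply: le_trans (le_normcD _ _) _; rewrite normcN mulr_natl mulr2n.
    by rewrite lerD// MP// ?x1 ?z1.
  apply: (@le_trans _ _ (A * normc (x - z) ^+ 2)); last by rewrite lerDr divr_ge0// ltW.
  rewrite /A mulrAC ler_pdivlMr ?exprn_gt0// ler_wpM2l ?mulr_ge0//.
  by rewrite lerXn2r ?nnegrE ?normc_ge0// ltW.
rewrite [leRHS]splitr lerD2l mulrA ler_pdivrMr//.
have : 4 * A / e < n.+1%:R.
  apply: lt_trans (archi_boundP _) _; first by apply: divr_ge0; [exact: mulr_ge0|exact: ltW].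
  by rewrite ltr_nat /n.
rewrite ltr_pdivrMr// => H; lra.
Qed.

End harmonic_approximation.

(** * Taylor polynomials of limits of harmonic polynomials *)

Section harmonic_taylor.
Variable R : realType.
Local Notation C := R[i].

Lemma real_limit (x e : nat -> R) : (forall n m, `|x n - x m| <= e n + e m) ->
  exists l, forall n, `|x n - l| <= e n.
Proof.
move=> H; have H' n m : x n - e n <= x m + e m.
  by have := H n m; rewrite ler_norml; lra.
exists (sup (range (fun n => x n - e n))) => n.
have h1 : x n - e n <= sup (range (fun n => x n - e n)).
  by apply: ub_le_sup; [exists (x 0 + e 0) => _ [k _ <-]|exists n].
have h2 : sup (range (fun n => x n - e n)) <= x n + e n.
  by apply: ge_sup; [exists (x 0 - e 0); exists 0|move=> _ [k _ <-]].
by rewrite ler_norml; lra.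
Qed.

Lemma complex_limit (x : nat -> C) (e : nat -> R) :
  (forall n m, normc (x n - x m) <= e n + e m) ->
  exists l, forall n, normc (x n - l) <= 2 * e n.
Proof.
move=> H.
have [a aP] : exists l, forall n, `|complex.Re (x n) - l| <= e n.
  apply: real_limit => n m; apply: le_trans (H n m).
  by rewrite -ReN -ReD; exact: normc_Re.
have [b bP] : exists l, forall n, `|complex.Im (x n) - l| <= e n.
  apply: real_limit => n m; apply: le_trans (H n m).
  by rewrite -ImN -ImD; exact: normc_Im.
exists (a +i* b) => n; apply: le_trans (normc_le _) _.
by rewrite ReD ImD ReN ImN mulr_natl mulr2n lerD//=.
Qed.

(** Cauchy's estimate by a discrete Fourier transform: [N] exceeds every frequency that occurs, so
    the mean over the roots of unity isolates the coefficient. The two constant terms cannot be told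
    apart, whence the sum at [k = 0]. *)
Lemma hpol_coef_bound (p q : {poly C}) M k :
  (forall z, normc z = 1 -> normc (hpol p q z) <= M) ->
  normc (p`_k + q`_k *+ (k == 0)%N) <= M.
Proof.
move=> H; pose n := (maxn (size p) (size q) + k.+1)%N; pose N := (2 * n)%N.
have N0 : (0 < N)%N by rewrite /N /n; lia.
have [w w_prim] := @complex_prim_root R N N0.
have NC : N%:R != 0 :> C by rewrite pnatr_eq0 -lt0n.
have sp : (size p <= n)%N by rewrite /n; lia.
have sq : (size q <= n)%N by rewrite /n; lia.
have kn : (k < n)%N by rewrite /n; lia.
have E : N%:R^-1 * \sum_(j < N) hpol p q (w ^+ j) * (w ^+ j)^J ^+ k = p`_k + q`_k *+ (k == 0)%N.
  rewrite (eq_bigr (fun j : 'I_N => \sum_(l < n) p`_l * ((w ^+ j) ^+ l * (w ^+ j)^J ^+ k) +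
     \sum_(l < n) q`_l * ((w ^+ j) ^+ 0 * (w ^+ j)^J ^+ (l + k)))); last first.
    move=> j _; rewrite /hpol (horner_coef_wide _ sp) (horner_coef_wide _ sq) mulrDl !mulr_suml.
    congr (_ + _); apply: eq_bigr => l _; last by rewrite expr0 mul1r exprD mulrA.
    by rewrite mulrA.
  rewrite big_split /= exchange_big /= [X in _ * (_ + X)]exchange_big /=.
  rewrite (bigD1 (Ordinal kn)) //= -mulr_sumr (root_sum w_prim) eqxx.
  have kN : (k < N)%N by rewrite /N; lia.
  have lN (l : 'I_n) : (l < N)%N by have := ltn_ord l; rewrite /N; lia.
  have lkN (l : 'I_n) : (l + k < N)%N by have := ltn_ord l; rewrite /N; lia.
  rewrite [X in _ + X + _]big1 => [|l lk]; last first.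
    rewrite -mulr_sumr (root_sum w_prim) !modn_small// ifF ?mulr0//.
    by apply/negbTE; apply: contra lk => /eqP H1; exact/eqP/val_inj.
  have n0 : (0 < n)%N by lia.
  rewrite (bigD1 (Ordinal n0)) //= -mulr_sumr (root_sum w_prim).
  rewrite [X in _ + (_ + X)]big1 => [|l l0]; last first.
    rewrite -mulr_sumr (root_sum w_prim) !modn_small// ifF ?mulr0//.
    by apply/negbTE; apply: contra l0 => /eqP H1; apply/eqP/val_inj => /=; lia.
  rewrite add0n !modn_small//.
  rewrite (eq_sym 0%N k); case: eqP => [->|_] /=; last by rewrite mulr0 ?mulr0n !addr0; field.
  by rewrite ?mulr1n !addr0; field.
rewrite -E normcM normcV.
have -> : normc (N%:R : C) = N%:R.
  by rewrite -(rmorph_nat (real_complex R)) normc_real ger0_norm.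
rewrite ler_pdivrMl ?ltr0n//; apply: le_trans (normc_sum _ _ _) _.
rewrite mulr_natl -[N in leRHS]card_ord -sumr_const; apply: ler_sum => j _.
have rj := root_normc w_prim j.
by rewrite normcM normcX normc_conj rj expr1n mulr1; exact: H.
Qed.

Lemma hpol_swap (p q : {poly C}) z : hpol p q z = hpol q p z^J.
Proof. by rewrite /hpol conjcK addrC. Qed.

Lemma geometric_bound (x : R) n K : 0 <= x <= 2^-1 ->
  \sum_(K <= l < n) x ^+ l <= 2 * x ^+ K.
Proof.
move=> /andP[x0 x1].
have [nK|Kn] := leqP n K; first by rewrite big_geq// mulr_ge0// exprn_ge0.
suff H m : \sum_(K <= l < K + m) x ^+ l <= 2 * x ^+ K - 2 * x ^+ (K + m).
  rewrite -(subnKC (ltnW Kn)); apply: le_trans (H _) _.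
  by rewrite gerBl mulr_ge0// exprn_ge0.
elim: m => [|m IH]; first by rewrite addn0 big_geq// subrr.
rewrite addnS big_nat_recr ?leq_addr//=; apply: le_trans (lerD IH (lexx _)) _.
have : 0 <= x ^+ (K + m) by rewrite exprn_ge0.
by rewrite exprS; nra.
Qed.

(** Coefficients of positive degree are at most [M], and on the disc of radius 1/2 the geometric
    tail at most doubles its first term; the factor 4 accounts for the two polynomials. *)
Lemma hpol_trunc_bound (p q : {poly C}) M K : 
  (forall z, normc z = 1 -> normc (hpol p q z) <= M) ->
  forall z, normc z <= 2^-1 ->
  normc (hpol p q z - hpol (take_poly K.+1 p) (take_poly K.+1 q) z) <= 4 * M * normc z ^+ K.+1.
Proof.
move=> H z z2; pose n := (maxn (size p) (size q) + K.+1)%N.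
have sp : (size p <= n)%N by rewrite /n; lia.
have sq : (size q <= n)%N by rewrite /n; lia.
have Kn : (K.+1 <= n)%N by rewrite /n; lia.
have cut (r : {poly C}) x : (size r <= n)%N ->
    r.[x] - (take_poly K.+1 r).[x] = \sum_(K.+1 <= l < n) r`_l * x ^+ l.
  move=> sr; rewrite (horner_coef_wide _ sr) (horner_coef_wide _ (size_take_poly _ _)).
  rewrite (eq_bigr (fun i : 'I_K.+1 => r`_i * x ^+ i)) => [|i _]; last first.
    by rewrite coef_take_poly ltn_ord.
  rewrite -(big_mkord xpredT (fun i => r`_i * x ^+ i)).
  rewrite -(big_mkord xpredT (fun i => r`_i * x ^+ i)).
  rewrite (big_cat_nat _ Kn)//=. ring.
have -> : hpol p q z - hpol (take_poly K.+1 p) (take_poly K.+1 q) z =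
   \sum_(K.+1 <= l < n) (p`_l * z ^+ l + q`_l * z^J ^+ l).
  by rewrite big_split /= -!cut// /hpol; ring.
have M0 : 0 <= M by apply: le_trans (H 1 (@normc1 R)); exact: normc_ge0.
apply: le_trans (normc_sum _ _ _) _.
apply: (@le_trans _ _ (\sum_(K.+1 <= l < n) 2 * M * normc z ^+ l)).
  rewrite big_nat_cond [leRHS]big_nat_cond; apply: ler_sum => l /andP[/andP[Kl _] _].
  apply: le_trans (le_normcD _ _) _; rewrite !normcM !normcX normc_conj -mulrDl.
  rewrite ler_wpM2r ?exprn_ge0 ?normc_ge0// mulr_natl mulr2n; apply: lerD.
    have := hpol_coef_bound l H; case: l Kl => // l _; by rewrite mulr0n addr0.
  have := @hpol_coef_bound q p M l; case: l Kl => // l _; rewrite mulr0n addr0; apply.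
  by move=> x x1; rewrite hpol_swap; apply: H; rewrite normc_conj.
rewrite -mulr_sumr.
have := @geometric_bound (normc z) n K.+1; rewrite normc_ge0 z2 => /(_ isT) h.
apply: le_trans (ler_wpM2l (_ : 0 <= 2 * M) h) _; first by rewrite mulr_ge0.
by rewrite le_eqVlt; apply/orP; left; apply/eqP; ring.
Qed.

(** Each coefficient of the approximants is a Cauchy sequence, by the coefficient bound applied to
    their differences. The truncation estimate holds for every approximant with [M + e m] in place
    of [M], and passes to the limit of the truncations. *)
Lemma happrox_taylor (u : C -> C) M K : happrox u ->
  (forall z, normc z <= 1 -> normc (u z) <= M) ->
  exists p q : {poly C}, [/\ (size p <= K.+1)%N, (size q <= K.+1)%N &
    forall z, normc z <= 2^-1 -> normc (u z - hpol p q z) <= 4 * M * normc z ^+ K.+1].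
Proof.
move=> hu uM; pose e (m : nat) : R := m.+1%:R^-1.
have e0 m : 0 < e m by rewrite invr_gt0 ltr0n.
have ex m : exists pq : {poly C} * {poly C}, pq.2`_0 = 0 /\
    forall z, normc z <= 1 -> normc (u z - hpol pq.1 pq.2 z) <= e m.
  (* The constant term is moved to the holomorphic part, which makes the coefficients of the two
     parts separately convergent. *)
  have [p [q pq]] := hu _ (e0 m); exists (p + (q`_0)%:P, q - (q`_0)%:P); split.
    by rewrite /= coefB coefC subrr.
  move=> z z1; have -> : hpol (p + (q`_0)%:P) (q - (q`_0)%:P) z = hpol p q z.
    by rewrite /hpol !hornerD !hornerN !hornerC; ring.
  exact: pq.
have [F FP] := choice ex; pose P m := (F m).1; pose Q m := (F m).2.
have Q0 m : (Q m)`_0 = 0 by have [] := FP m.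
have uPQ m z : normc z <= 1 -> normc (u z - hpol (P m) (Q m) z) <= e m.
  by move=> z1; have [_] := FP m; apply.
have diff m l z : normc z = 1 -> normc (hpol (P m - P l) (Q m - Q l) z) <= e m + e l.
  move=> z1; have -> : hpol (P m - P l) (Q m - Q l) z =
     (u z - hpol (P l) (Q l) z) - (u z - hpol (P m) (Q m) z).
    by rewrite /hpol !hornerD !hornerN; ring.
  by apply: le_trans (le_normcD _ _) _; rewrite normcN addrC lerD// uPQ// z1.
have limP k : exists l, forall m, normc ((P m)`_k - l) <= 2 * e m.
  apply: complex_limit => m l; have := hpol_coef_bound k (diff m l).
  by rewrite !coefB; case: k => [|k]; rewrite ?Q0 ?subrr ?mul0rn ?mulr0n addr0.
have limQ k : exists l, forall m, normc ((Q m)`_k - l) <= 2 * e m.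
  apply: complex_limit => m l.
  have diff' z : normc z = 1 -> normc (hpol (Q m - Q l) (P m - P l) z) <= e m + e l.
    by move=> z1; rewrite hpol_swap; apply: diff; rewrite normc_conj.
  have := hpol_coef_bound k diff'.
  case: k => [|k]; rewrite !coefB; last by rewrite mulr0n addr0.
  by rewrite !Q0 subrr normc0 => _; rewrite addr_ge0// ltW.
have [a aP] := choice limP; have [b bP] := choice limQ.
exists (\poly_(k < K.+1) a k), (\poly_(k < K.+1) b k); split; try exact: size_poly.
move=> z z2; have z1 : normc z <= 1 by apply: le_trans z2 _; rewrite invf_le1 ?ler1n.
have bound m : normc (u z - hpol (\poly_(k < K.+1) a k) (\poly_(k < K.+1) b k) z) <=
    4 * M * normc z ^+ K.+1 + e m * (5 + 4 * K.+1%:R).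
  pose T := hpol (take_poly K.+1 (P m)) (take_poly K.+1 (Q m)) z.
  have h1 := uPQ m z z1.
  have h2 : normc (hpol (P m) (Q m) z - T) <= 4 * (M + e m) * normc z ^+ K.+1.
    apply: hpol_trunc_bound => // x x1.
    rewrite -[hpol _ _ _](subKr (u x)); apply: le_trans (le_normcD _ _) _.
    by rewrite normcN lerD ?uM ?uPQ ?x1.
  have h3 : normc (T - hpol (\poly_(k < K.+1) a k) (\poly_(k < K.+1) b k) z) <= 4 * e m * K.+1%:R.
    have -> : T - hpol (\poly_(k < K.+1) a k) (\poly_(k < K.+1) b k) z =
        \sum_(k < K.+1) (((P m)`_k - a k) * z ^+ k + ((Q m)`_k - b k) * z^J ^+ k).
      rewrite /T /hpol !horner_poly [RHS](eq_bigr (fun k : 'I_K.+1 => ((P m)`_k * z ^+ k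
        + (Q m)`_k * z^J ^+ k) - (a k * z ^+ k + b k * z^J ^+ k))) => [|k _]; last by ring.
      by rewrite sumrB !big_split.
    apply: le_trans (normc_sum _ _ _) _; rewrite mulr_natr -[K.+1 in leRHS]card_ord -sumr_const.
    apply: ler_sum => k _; apply: le_trans (le_normcD _ _) _.
    rewrite !normcM !normcX normc_conj.
    have zk : normc z ^+ k <= 1 by rewrite exprn_ile1 ?normc_ge0.
    have zk0 : 0 <= normc z ^+ k by rewrite exprn_ge0 ?normc_ge0.
    have := aP k m; have := bP k m; have := normc_ge0 ((P m)`_k - a k).
    have := normc_ge0 ((Q m)`_k - b k); have := e0 m.
    move: zk zk0; set Z := _ ^+ k; nra.
  have -> : u z - hpol (\poly_(k < K.+1) a k) (\poly_(k < K.+1) b k) z =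
    (u z - hpol (P m) (Q m) z) + (hpol (P m) (Q m) z - T) +
    (T - hpol (\poly_(k < K.+1) a k) (\poly_(k < K.+1) b k) z) by ring.
  apply: le_trans (le_normcD _ _) _; apply: le_trans (lerD (le_normcD _ _) (lexx _)) _.
  apply: le_trans (lerD (lerD h1 h2) h3) _.
  have : normc z ^+ K.+1 <= 1 by rewrite exprn_ile1 ?normc_ge0.
  have := e0 m; set Z := _ ^+ K.+1; set Y := K.+1%:R; nra.
have c0 : 0 < 5 + 4 * K.+1%:R :> R by rewrite addr_gt0// mulr_gt0// ltr0n.
apply/ler_addgt0Pl => x x0.
pose m := Num.bound ((5 + 4 * K.+1%:R) / x).
rewrite [leRHS]addrC; apply: le_trans (bound m) _; rewrite lerD2l.
have B := @archi_boundP _ ((5 + 4 * K.+1%:R) / x) (divr_ge0 (ltW c0) (ltW x0)).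
have {}B : (5 + 4 * K.+1%:R) / x < m.+1%:R by apply: lt_trans B _; rewrite ltr_nat.
by rewrite /e mulrC ler_pdivrMr ?ltr0n// [x * _]mulrC -ler_pdivrMr// ltW.
Qed.

Lemma genharm_taylor (u : C -> C) M K :
  (forall z, normc z <= 1 -> ccont u z) ->
  (forall z, normc z < 1 -> genharm u z) ->
  (forall z, normc z <= 1 -> normc (u z) <= M) ->
  exists p q : {poly C}, [/\ (size p <= K.+1)%N, (size q <= K.+1)%N &
    forall z, normc z <= 2^-1 -> normc (u z - hpol p q z) <= 4 * M * normc z ^+ K.+1].
Proof. by move=> cu hu; apply: happrox_taylor; exact: genharm_happrox. Qed.

End harmonic_taylor.

(** * Jets *)

Section jets.
Variable R : realType.
Local Notation C := R[i].

Definition bigO (N : nat) (e : C -> C) := exists K r : R, 0 < r /\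
  forall t, normc t < r -> normc (e t) <= K * normc t ^+ N.

Lemma bigO_pos N e : bigO N e -> exists K r : R, [/\ 0 < K, 0 < r, r <= 1 &
  forall t, normc t < r -> normc (e t) <= K * normc t ^+ N].
Proof.
move=> [K [r [r0 H]]]; exists (Num.max K 1), (Num.min r 1); split.
- by rewrite lt_max ltr01 orbT.
- by rewrite lt_min r0 ltr01.
- by rewrite ge_min lexx orbT.
move=> t; rewrite lt_min => /andP[tr _]; apply: le_trans (H t tr) _.
by rewrite ler_wpM2r ?exprn_ge0 ?normc_ge0// le_max lexx.
Qed.

Lemma eq_bigO N e f : (forall t, e t = f t) -> bigO N e -> bigO N f.
Proof. by move=> /funext ->. Qed.

Lemma bigO_near N e f r : 0 < r -> (forall t, normc t < r -> e t = f t) ->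
  bigO N e -> bigO N f.
Proof.
move=> r0 ef [K [s [s0 H]]]; exists K, (Num.min r s); split; first by rewrite lt_min r0.
by move=> t; rewrite lt_min => /andP[tr ts]; rewrite -ef// H.
Qed.

Lemma bigOD N e f : bigO N e -> bigO N f -> bigO N (fun t => e t + f t).
Proof.
move=> /bigO_pos [K [r [K0 r0 _ H]]] /bigO_pos [L [s [L0 s0 _ G]]].
exists (K + L), (Num.min r s); split; first by rewrite lt_min r0.
move=> t; rewrite lt_min => /andP[tr ts]; apply: le_trans (le_normcD _ _) _.
by rewrite mulrDl lerD ?H ?G.
Qed.

Lemma bigOM N M e f : bigO N e -> bigO M f -> bigO (N + M) (fun t => e t * f t).
Proof.
move=> /bigO_pos [K [r [K0 r0 _ H]]] /bigO_pos [L [s [L0 s0 _ G]]].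
exists (K * L), (Num.min r s); split; first by rewrite lt_min r0.
move=> t; rewrite lt_min => /andP[tr ts]; rewrite normcM exprD mulrACA.
by rewrite ler_pM ?normc_ge0 ?H ?G.
Qed.

Lemma bigO_cst c : bigO 0 (fun=> c).
Proof. by exists (normc c), 1; split=> // t _; rewrite expr0 mulr1. Qed.

Lemma bigOZ c N e : bigO N e -> bigO N (fun t => c * e t).
Proof. by move=> he; have := bigOM (bigO_cst c) he; rewrite add0n. Qed.

Lemma bigON N e : bigO N e -> bigO N (fun t => - e t).
Proof. by move=> /(bigOZ (-1)); apply: eq_bigO => t; rewrite mulN1r. Qed.

Lemma bigOB N e f : bigO N e -> bigO N f -> bigO N (fun t => e t - f t).
Proof. by move=> he /bigON; exact: bigOD. Qed.

Lemma bigO_0 N : bigO N (fun=> 0).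
Proof. by exists 0, 1; split=> // t _; rewrite mul0r normc0. Qed.

Lemma bigO_sum N (I : Type) (s : seq I) (P : pred I) (F : I -> C -> C) :
  (forall i, P i -> bigO N (F i)) -> bigO N (fun t => \sum_(i <- s | P i) F i t).
Proof.
move=> H; elim: s => [|i s IH].
  by apply: eq_bigO (bigO_0 N) => t; rewrite big_nil.
case: (boolP (P i)) => Pi.
  by apply: eq_bigO (bigOD (H i Pi) IH) => t; rewrite big_cons Pi.
by apply: eq_bigO IH => t; rewrite big_cons (negPf Pi).
Qed.

Lemma bigO_le N M e : (M <= N)%N -> bigO N e -> bigO M e.
Proof.
move=> MN /bigO_pos [K [r [K0 r0 r1 H]]]; exists K, r; split=> // t tr.
apply: le_trans (H t tr) _; rewrite ler_pM2l// ler_wiXn2l ?normc_ge0//.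
by apply/ltW/(lt_le_trans tr).
Qed.

Lemma bigO_conj N e : bigO N e -> bigO N (fun t => (e t)^J).
Proof. by move=> [K [r [r0 H]]]; exists K, r; split=> // t tr; rewrite normc_conj H. Qed.

Lemma bigO_at0 N e : bigO N.+1 e -> e 0 = 0.
Proof.
move=> [K [r [r0 H]]]; apply: eq0_normc; apply/eqP.
have := H 0; rewrite normc0 r0 => /(_ isT); rewrite expr0n /= mulr0 => h.
by rewrite eq_le h normc_ge0.
Qed.

Lemma bigO_poly (p : {poly C}) : bigO 0 (fun t => p.[t]).
Proof.
have [M MP] := disc_bounded (fun z _ => ccont_poly p z).
by exists M, 1; split=> // t /ltW /MP; rewrite expr0 mulr1.
Qed.

Lemma bigO_id : bigO 1 id.
Proof. by exists 1, 1; split=> // t _; rewrite mul1r expr1. Qed.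

Implicit Types (A B : {poly {poly C}}) (u v : C -> C).

(* A bivariate polynomial is evaluated at [t] (inner variable) and at its
   conjugate (outer variable); [cf A k l] is the coefficient of [t^k conj(t)^l]. *)
Definition ev A (t : C) := A.[(t^J)%:P].[t].

Definition cf A (k l : nat) := A`_l`_k.

Lemma evD A B t : ev (A + B) t = ev A t + ev B t.
Proof. by rewrite /ev !hornerD. Qed.
Lemma evN A t : ev (- A) t = - ev A t.
Proof. by rewrite /ev !hornerN. Qed.
Lemma evM A B t : ev (A * B) t = ev A t * ev B t.
Proof. by rewrite /ev !hornerM. Qed.
Lemma evC c t : ev (c%:P%:P) t = c.
Proof. by rewrite /ev !hornerC. Qed.
Lemma ev1 t : ev 1 t = 1.
Proof. exact: evC. Qed.
Lemma evX A n t : ev (A ^+ n) t = ev A t ^+ n.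
Proof. by rewrite /ev !horner_exp. Qed.
Lemma ev_sum I (s : seq I) (P : pred I) (F : I -> {poly {poly C}}) t :
  ev (\sum_(i <- s | P i) F i) t = \sum_(i <- s | P i) ev (F i) t.
Proof. by rewrite /ev !horner_sum. Qed.

Lemma cfD A B k l : cf (A + B) k l = cf A k l + cf B k l.
Proof. by rewrite /cf !coefD. Qed.
Lemma cfN A k l : cf (- A) k l = - cf A k l.
Proof. by rewrite /cf !coefN. Qed.
Lemma cfC c A k l : cf (c%:P%:P * A) k l = c * cf A k l.
Proof. by rewrite /cf !coefCM. Qed.
Lemma cf_sum I (s : seq I) (P : pred I) (F : I -> {poly {poly C}}) k l :
  cf (\sum_(i <- s | P i) F i) k l = \sum_(i <- s | P i) cf (F i) k l.
Proof. by rewrite /cf !coef_sum. Qed.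

Lemma cfM A B k l : cf (A * B) k l =
  \sum_(j < l.+1) \sum_(i < k.+1) cf A i j * cf B (k - i) (l - j).
Proof. by rewrite /cf coefM coef_sum; apply: eq_bigr => j _; rewrite coefM. Qed.

Definition hol (p : {poly C}) : {poly {poly C}} := p%:P.
Definition ahol (p : {poly C}) : {poly {poly C}} := map_poly (fun c => (c^J)%:P) p.

Lemma aholE p : ahol p = map_poly (polyC \o conjc) p. Proof. by []. Qed.

Lemma ev_hol p t : ev (hol p) t = p.[t].
Proof. by rewrite /ev hornerC. Qed.

Lemma ev_ahol p t : ev (ahol p) t = (p.[t])^J.
Proof.
rewrite /ev aholE; elim/poly_ind: p => [|p c IH].
  by rewrite map_poly0 !horner0 conjc0.
rewrite rmorphD rmorphM /= map_polyX map_polyC /= !hornerE /=.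
by rewrite IH conjcD conjcM.
Qed.

Lemma cf_hol p k l : cf (hol p) k l = if l == 0%N then p`_k else 0.
Proof. by rewrite /cf coefC; case: eqP => // _; rewrite coef0. Qed.

Lemma cf_ahol p k l : cf (ahol p) k l = if k == 0%N then (p`_l)^J else 0.
Proof.
by rewrite /cf aholE coef_map /= coefC.
Qed.

Lemma holM p q : hol (p * q) = hol p * hol q. Proof. exact: polyCM. Qed.
Lemma aholM p q : ahol (p * q) = ahol p * ahol q.
Proof. by rewrite !aholE rmorphM. Qed.

Lemma ev_cf A : exists d, (forall k l, (d <= k)%N || (d <= l)%N -> cf A k l = 0) /\
  forall t, ev A t = \sum_(l < d) \sum_(k < d) cf A k l * (t ^+ k * t^J ^+ l).
Proof.
pose d := maxn (size A) (\max_(l < size A) size (A`_l)%R).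
have sA : (size A <= d)%N by rewrite leq_maxl.
have sAl l : (size (A`_l)%R <= d)%N.
  have [lA|Al] := ltnP l (size A); last by rewrite nth_default// size_poly0.
  by rewrite leq_max; apply/orP; right; exact: (@leq_bigmax _ (fun l : 'I_(size A) => size (A`_l)%R) (Ordinal lA)).
exists d; split=> [k l /orP[dk|dl]|t].
- by rewrite /cf nth_default//; exact: leq_trans dk.
- by rewrite /cf [A`_l]nth_default ?coef0//; exact: leq_trans dl.
rewrite /ev (horner_coef_wide _ sA) horner_sum; apply: eq_bigr => l _.
rewrite hornerM horner_exp hornerC (horner_coef_wide _ (sAl l)) mulr_suml.
by apply: eq_bigr => k _; rewrite mulrA.
Qed.

(** The constant term vanishes by continuity; then divide by ['X] and induct. Only positive real
    arguments are used, since they will be radii of circles. *)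
Lemma poly_small (p : {poly C}) N (K r : R) : 0 < r ->
  (forall x : R, 0 < x < r -> normc p.[x%:C] <= K * x ^+ N) ->
  forall m, (m < N)%N -> p`_m = 0.
Proof.
move=> r0; elim: N p => // N IH p H.
have p0 : p`_0 = 0.
  rewrite -horner_coef0; apply: eq0_normc; apply/eqP; rewrite eq_le normc_ge0 andbT.
  apply/ler_addgt0Pl => e e0; rewrite addr0.
  have [d d0 dP] := ccont_poly p 0 (e := e / 2) (divr_gt0 e0 (ltr0n _ 2)).
  have K1 : 0 < Num.max K 1 by rewrite lt_max ltr01 orbT.
  pose x := Num.min (Num.min (r / 2) (d / 2)) (Num.min 1 (e / 2 / Num.max K 1)).
  have x0 : 0 < x.
    by rewrite /x !lt_min ltr01 !divr_gt0.
  have xr : x < r by apply: (@le_lt_trans _ _ (r / 2)); [rewrite /x !ge_min lexx|lra].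
  have xd : x < d by apply: (@le_lt_trans _ _ (d / 2)); [rewrite /x !ge_min lexx ?orbT|lra].
  have x1 : x <= 1 by rewrite /x !ge_min lexx ?orbT.
  have xe : x <= e / 2 / Num.max K 1 by rewrite /x !ge_min lexx ?orbT.
  have xin : 0 < x < r by rewrite x0.
  rewrite -[p.[0]](subKr p.[x%:C]); apply: le_trans (le_normcD _ _) _.
  rewrite normcN [e]splitr; apply: lerD; last first.
    by apply: dP; rewrite subr0 normc_real gtr0_norm.
  apply: le_trans (H x xin) _; rewrite ler_pdivlMr// in xe.
  apply: le_trans xe; rewrite mulrC; apply: (@le_trans _ _ (x ^+ N.+1 * Num.max K 1)).
    by rewrite ler_wpM2l ?exprn_ge0 ?(ltW x0)// le_max lexx.
  by rewrite ler_pM2r// exprS ler_piMr ?(ltW x0)// exprn_ile1// ltW.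
have pE : p = drop_poly 1 p * 'X.
  by apply/polyP => -[|i]; rewrite coefMX ?p0//= coef_drop_poly addn1.
have IHq : forall m, (m < N)%N -> (drop_poly 1 p)`_m = 0.
  apply: IH => x /andP[x0 xr]; rewrite -(ler_pM2r x0).
  have := H x; rewrite x0 xr => /(_ isT); rewrite {1}pE hornerMX normcM normc_real.
  by rewrite gtr0_norm// exprS; move=> h; apply: le_trans h _; rewrite mulrA mulrAC.
by case=> [//|m]; rewrite ltnS => /IHq; rewrite coef_drop_poly addn1.
Qed.

(** Averaging over the circle of radius [x] against a character isolates the diagonal
    [k - l = k0 - l0]. On it, [k + l] determines [k] and [l], so the average is a polynomial [P] in
    [x] whose coefficients are single [cf A k l]. *)
Lemma bigO_ev_eq0 A N : bigO N (ev A) -> forall k l, (k + l < N)%N -> cf A k l = 0.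
Proof.
move=> /bigO_pos [K [r [K0 r0 r1 H]]] k0 l0 kl0.
have [d [dP evE]] := ev_cf A.
have [dk|kd] := leqP d k0; first by rewrite dP ?dk.
have [dl|ld] := leqP d l0; first by rewrite dP ?dl ?orbT.
pose N' := (2 * d)%N; have N'0 : (0 < N')%N by rewrite /N'; lia.
have [w w_prim] := @complex_prim_root R N' N'0.
pose P : {poly C} := \sum_(l < d) \sum_(k < d)
  (if (k + l0 == l + k0)%N then cf A k l else 0) *: 'X^(k + l).
have PE (x : R) : P.[x%:C] = N'%:R^-1 * \sum_(j < N') ev A (x%:C * w ^+ j) *
    ((w ^+ j) ^+ l0 * (w ^+ j)^J ^+ k0).
  have NC : N'%:R != 0 :> C by rewrite pnatr_eq0 -lt0n.
  rewrite (eq_bigr (fun j : 'I_N' => \sum_(l < d) \sum_(k < d) cf A k l * x%:C ^+ (k + l) *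
     ((w ^+ j) ^+ (k + l0) * (w ^+ j)^J ^+ (l + k0)))); last first.
    move=> j _; rewrite evE mulr_suml; apply: eq_bigr => l _; rewrite mulr_suml.
    apply: eq_bigr => k _; rewrite conjcM conjc_real !exprMn !exprD; ring.
  rewrite exchange_big /= mulr_sumr /P horner_sum; apply: eq_bigr => l _.
  rewrite exchange_big /= mulr_sumr horner_sum; apply: eq_bigr => k _.
  rewrite -mulr_sumr (root_sum w_prim) hornerZ hornerXn !modn_small; last first.
  - by have := ltn_ord k; rewrite /N'; lia.
  - by have := ltn_ord l; rewrite /N'; lia.
  by case: ifP => _; [field|rewrite !mulr0 mul0r].
have P0 : forall m, (m < N)%N -> P`_m = 0.
  apply: (@poly_small P N K r r0) => x /andP[x0 xr].
  rewrite PE normcM normcV (_ : normc N'%:R = N'%:R); last first.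
    by rewrite -(rmorph_nat (real_complex R)) normc_real ger0_norm.
  rewrite ler_pdivrMl ?ltr0n//; apply: le_trans (normc_sum _ _ _) _.
  rewrite mulr_natl -[N' in leRHS]card_ord -sumr_const; apply: ler_sum => j _.
  have wj := root_normc w_prim j.
  have w1 : normc w = 1 by have := root_normc w_prim 1; rewrite expr1.
  rewrite !normcM !normcX normc_conj !normcX w1 !expr1n !mulr1.
  have nx : normc (x%:C * w ^+ j) = x by rewrite normcM normc_real wj mulr1 gtr0_norm.
  have := H (x%:C * w ^+ j); by rewrite nx; apply.
have := P0 _ kl0; rewrite /P coef_sum (bigD1 (Ordinal ld)) //= [X in _ + X]big1 ?addr0.
  rewrite coef_sum (bigD1 (Ordinal kd)) //= [X in _ + X]big1 ?addr0.
    by rewrite coefZ coefXn eqxx mulr1 addnC eqxx.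
  move=> k kk0; rewrite coefZ ifF ?mul0r//; apply/negbTE; apply: contra kk0 => /eqP h.
  by apply/eqP/val_inj => /=; lia.
move=> l ll0; rewrite coef_sum big1// => k _; rewrite coefZ coefXn.
have [h|_] := eqVneq (k + l0)%N (l + k0)%N; last by rewrite mul0r.
rewrite (_ : (_ == _) = false) ?mulr0//; apply/negbTE; apply: contra ll0 => /eqP h2.
by apply/eqP/val_inj => /=; lia.
Qed.

Definition jet N u A := bigO N (fun t => u t - ev A t).

(** The bridge from identities between functions to identities between coefficients. *)
Lemma jet_uniq N u A B : jet N u A -> jet N u B ->
  forall k l, (k + l < N)%N -> cf A k l = cf B k l.
Proof.
move=> uA uB k l kl; apply/eqP; rewrite -subr_eq0 -cfN -cfD; apply/eqP.
apply: (@bigO_ev_eq0 _ N) kl.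
by apply: eq_bigO (bigOB uB uA) => t; rewrite evD evN; ring.
Qed.

Lemma jet_near N u v A r : 0 < r -> (forall t, normc t < r -> u t = v t) ->
  jet N u A -> jet N v A.
Proof. by move=> r0 uv; apply: bigO_near r0 _ => t /uv ->. Qed.

Lemma eq_jet N u v A : (forall t, u t = v t) -> jet N u A -> jet N v A.
Proof. by move=> /funext ->. Qed.

Lemma jet_le N M u A : (M <= N)%N -> jet N u A -> jet M u A.
Proof. exact: bigO_le. Qed.

Lemma jetD N u v A B : jet N u A -> jet N v B -> jet N (fun t => u t + v t) (A + B).
Proof. by move=> uA vB; apply: eq_bigO (bigOD uA vB) => t; rewrite evD; ring. Qed.

Lemma jetN N u A : jet N u A -> jet N (fun t => - u t) (- A).
Proof. by move=> uA; apply: eq_bigO (bigON uA) => t; rewrite evN; ring. Qed.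

Lemma jetB N u v A B : jet N u A -> jet N v B -> jet N (fun t => u t - v t) (A - B).
Proof. by move=> uA /jetN; exact: jetD. Qed.

Lemma jet_cst N c : jet N (fun=> c) c%:P%:P.
Proof. by apply: eq_bigO (bigO_0 N) => t; rewrite evC subrr. Qed.

Lemma bigO_ev A : bigO 0 (ev A).
Proof.
elim/poly_ind: A => [|A c IH]; first by apply: eq_bigO (bigO_0 0) => t; rewrite /ev !horner0.
apply: (@eq_bigO 0 (fun t => ev A t * t^J + c.[t])).
  by move=> t; rewrite /ev !hornerE.
apply: bigOD; last exact: bigO_poly.
have := bigOM IH (bigO_conj (bigO_id)); exact: bigO_le.
Qed.

Lemma jetM N u v A B : jet N u A -> jet N v B -> jet N (fun t => u t * v t) (A * B).
Proof.
move=> uA vB.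
apply: (@eq_bigO N (fun t => (u t - ev A t) * (v t - ev B t) + ev A t * (v t - ev B t)
    + (u t - ev A t) * ev B t)); first by move=> t; rewrite evM; ring.
apply: bigOD; last by have := bigOM uA (bigO_ev B); rewrite addn0.
apply: bigOD; last by have := bigOM (bigO_ev A) vB; rewrite add0n.
by apply: bigO_le (bigOM uA vB); rewrite leq_addr.
Qed.

Lemma jetZ N c u A : jet N u A -> jet N (fun t => c * u t) (c%:P%:P * A).
Proof. exact/jetM/jet_cst. Qed.

Lemma jetX N u A n : jet N u A -> jet N (fun t => u t ^+ n) (A ^+ n).
Proof.
move=> uA; elim: n => [|n IH].
  by apply: eq_bigO (bigO_0 N) => t; rewrite !expr0 ev1 subrr.
by have := jetM uA IH; rewrite -exprS; apply: eq_jet => t; rewrite exprS.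
Qed.

Lemma jet_sum N (I : Type) (s : seq I) (P : pred I) (F : I -> C -> C) (G : I -> {poly {poly C}}) :
  (forall i, P i -> jet N (F i) (G i)) ->
  jet N (fun t => \sum_(i <- s | P i) F i t) (\sum_(i <- s | P i) G i).
Proof.
move=> H; elim: s => [|i s IH].
  by apply: eq_bigO (bigO_0 N) => t; rewrite !big_nil /ev !horner0 subrr.
rewrite big_cons; case: ifPn => [Pi|nPi].
  by have := jetD (H i Pi) IH; apply: eq_jet => t; rewrite big_cons Pi.
by move: IH; apply: eq_jet => t; rewrite big_cons (negPf nPi).
Qed.

Lemma jet_prod N (I : Type) (s : seq I) (P : pred I) (F : I -> C -> C) (G : I -> {poly {poly C}}) :
  (forall i, P i -> jet N (F i) (G i)) ->
  jet N (fun t => \prod_(i <- s | P i) F i t) (\prod_(i <- s | P i) G i).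
Proof.
move=> H; elim: s => [|i s IH].
  by apply: eq_bigO (bigO_0 N) => t; rewrite !big_nil ev1 subrr.
rewrite big_cons; case: ifPn => [Pi|nPi].
  by have := jetM (H i Pi) IH; apply: eq_jet => t; rewrite big_cons Pi.
by move: IH; apply: eq_jet => t; rewrite big_cons (negPf nPi).
Qed.

Lemma jet_at0 N u A : jet N.+1 u A -> u 0 = cf A 0 0.
Proof.
move=> /bigO_at0 /eqP; rewrite subr_eq0 => /eqP ->.
by rewrite /ev conjc0 !horner_coef0.
Qed.

Lemma jet_hol N u p : bigO N (fun t => u t - p.[t]) -> jet N u (hol p).
Proof. by apply: eq_bigO => t; rewrite ev_hol. Qed.

Lemma jet_ahol N u p : bigO N (fun t => u t - p.[t]) -> jet N (fun t => (u t)^J) (ahol p).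
Proof. by move=> /bigO_conj; apply: eq_bigO => t; rewrite ev_ahol conjcB. Qed.

Lemma bigO1_jet N u A : jet N.+1 u A -> u 0 = 0 -> bigO 1 u.
Proof.
move=> uA u0; have A0 := jet_at0 uA; rewrite u0 in A0.
have E : bigO 1 (ev A).
  have [d [dP evE]] := ev_cf A.
  apply: eq_bigO (fun t => esym (evE t)) _.
  apply: bigO_sum => l _; apply: bigO_sum => k _.
  have [/eqP h|h] := boolP (k + l == 0)%N.
    have [-> ->] : (k : nat) = 0%N /\ (l : nat) = 0%N by lia.
    by apply: eq_bigO (bigO_0 1) => t; rewrite -A0 mul0r.
  apply: bigOZ; have pw n v : bigO 1 v -> bigO n (fun t => v t ^+ n).
    move=> hv; elim: n => [|n IH]; first exact: bigO_cst.
    by have := bigOM hv IH; rewrite add1n; apply: eq_bigO => t; rewrite exprS.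
  apply: (@bigO_le (k + l)); first by rewrite lt0n.
  by apply: bigOM; apply: pw; [exact: bigO_id|exact/bigO_conj/bigO_id].
have := bigOD (bigO_le (ltn0Sn N) uA) E; apply: eq_bigO => t; by rewrite subrK.
Qed.

End jets.

(** * Taylor estimates for the exponential and the logarithm *)

Section taylor_exp_ln.
Variable R : realType.

Lemma mean_value_bound0 (f df : R -> R) (x e : R) :
  (forall y : R, `|y| <= `|x| -> is_derive y 1 f (df y)) ->
  (forall y, `|y| <= `|x| -> `|df y| <= e) -> `|f x - f 0| <= e * `|x|.
Proof.
move=> fdf dfe; have [x0|x0] := leP 0 x.
  have := @mean_value_bound R f df 0 x e x0; rewrite (ger0_norm x0) subr0; apply.
    by move=> y /andP[y0 yx]; apply: fdf; rewrite !ger0_norm.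
  by move=> y /andP[y0 yx]; apply: dfe; rewrite !ger0_norm.
have := @mean_value_bound R f df x 0 e (ltW x0); rewrite (ltr0_norm x0) sub0r distrC; apply.
  by move=> y /andP[y0 yx]; apply: fdf; rewrite !ler0_norm ?lerN2 ?(ltW x0).
by move=> y /andP[y0 yx]; apply: dfe; rewrite !ler0_norm ?lerN2 ?(ltW x0).
Qed.

Definition exp_poly N : {poly R} := \poly_(m < N) (m`!%:R)^-1.
(** The Taylor polynomial of [- ln (1 - x)]; its constant term is 0 because the inverse of 0 is
    0. *)
Definition ln_poly N : {poly R} := \poly_(m < N) (m%:R)^-1.

(** The derivative of the remainder of order [N + 1] is the remainder of order [N], so the mean
    value bound carries the estimate up with the same [K]. *)
Lemma expR_taylor N : exists K : R, forall x, `|x| <= 1 ->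
  `|expR x - (exp_poly N).[x]| <= K * `|x| ^+ N.
Proof.
elim: N => [|N [K IH]].
  exists (expR 1) => x x1; rewrite /exp_poly poly_def big_ord0 horner0 subr0 expr0 mulr1.
  by rewrite ger0_norm ?expR_ge0// ler_expR; move: x1; rewrite ler_norml => /andP[].
have dp : (exp_poly N.+1)^`() = exp_poly N.
  apply/polyP => m; rewrite coef_deriv !coef_poly ltnS; case: ifP => _; last by rewrite mul0rn.
  rewrite factS natrM invfM -[_ *+ m.+1]mulr_natr mulrAC mulVf ?mul1r// pnatr_eq0.
exists K => x x1.
pose f y : R := expR y - (exp_poly N.+1).[y].
have f0 : f 0 = 0.
  by rewrite /f expR0 horner_coef0 coef_poly /= fact0 invr1 subrr.
have K0 : 0 <= K.
  have := IH 1; rewrite normr1 expr1n mulr1 => h; exact: le_trans (h (lexx _)).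
have := @mean_value_bound0 f (fun y => expR y - (exp_poly N).[y]) x (K * `|x| ^+ N).
rewrite f0 subr0 -mulrA -exprSr; apply.
  by move=> y _; rewrite -dp; exact: is_deriveB.
move=> y yx; apply: le_trans (IH y (le_trans yx x1)) _.
by rewrite ler_wpM2l// lerXn2r ?nnegrE.
Qed.

Lemma is_derive_ln1B (y : R) : y < 1 -> is_derive y 1 (fun y : R => - ln (1 - y)) (1 - y)^-1.
Proof.
move=> y1; have y10 : 0 < 1 - y by rewrite subr_gt0.
have := is_derive1_ln y10 => h1.
have h2 : is_derive y 1 (fun y : R => 1 - y) (- 1).
  apply: is_derive_eq; rewrite /GRing.scale /=; ring.
have h3 := @is_derive1_comp R (@ln R) (fun y : R => 1 - y) y _ _ h1 h2.
have := is_deriveN h3; rewrite mulrN1 opprK.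
by move=> h; exact: h.
Qed.

Lemma ln_taylor N : exists K : R, forall x : R, `|x| <= 2^-1 ->
  `|- ln (1 - x) - (ln_poly N).[x]| <= K * `|x| ^+ N.
Proof.
case: N => [|N].
  exists 1 => x x2; rewrite /ln_poly poly_def big_ord0 horner0 subr0 expr0 mulr1.
  have [x20 x21] : - 2^-1 <= x /\ x <= 2^-1 by move: x2; rewrite ler_norml => /andP.
  have e1 : expR (- 1 : R) <= 2^-1.
    rewrite expRN lef_pV2 ?posrE ?expR_gt0//; have := expR_ge1Dx (1 : R); lra.
  rewrite normrN ler_norml; apply/andP; split.
    by rewrite -ler_expR lnK ?posrE; lra.
  by rewrite -ler_expR lnK ?posrE; have := expR_ge1Dx (1 : R); lra.
exists 2 => x x2.
have x20 y : `|y| <= `|x| -> - 2^-1 <= y /\ y <= 2^-1.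
  by move=> yx; have := le_trans yx x2; rewrite ler_norml => /andP.
pose f y : R := - ln (1 - y) - (ln_poly N.+1).[y].
have f0 : f 0 = 0.
  by rewrite /f subr0 ln1 horner_coef0 coef_poly /= invr0 !oppr0 addr0.
have dp : (ln_poly N.+1)^`() = \poly_(m < N) 1.
  apply/polyP => m; rewrite coef_deriv !coef_poly ltnS; case: ifP => _; last by rewrite mul0rn.
  by rewrite -[_ *+ m.+1]mulr_natr mulVf// pnatr_eq0.
have := @mean_value_bound0 f (fun y => (1 - y)^-1 - (\poly_(m < N) 1 : {poly R}).[y]) x (2 * `|x| ^+ N).
rewrite f0 subr0 -mulrA -exprSr; apply.
  move=> y /x20 [y1 y2]; rewrite -dp; apply: is_deriveB; apply: is_derive_ln1B; lra.
move=> y yx; have [y1 y2] := x20 y yx.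
have y10 : 1 - y != 0 by rewrite gt_eqF//; lra.
have -> : (1 - y)^-1 - (\poly_(m < N) 1 : {poly R}).[y] = y ^+ N / (1 - y).
  apply: (mulIf y10); rewrite mulrBl mulVf// divfK// horner_poly.
  rewrite (eq_bigr (fun i : 'I_N => y ^+ i)) => [|i _]; last by rewrite mul1r.
  have := subrX1 y N => h; rewrite -[y ^+ N](subrK 1) h; ring.
rewrite normrM normfV normrX mulrC; apply: ler_pM; rewrite ?invr_ge0 ?exprn_ge0//.
  rewrite -[leRHS]invrK lef_pV2 ?posrE ?invr_gt0 ?normr_gt0// ger0_norm; lra.
by rewrite lerXn2r ?nnegrE.
Qed.

End taylor_exp_ln.

(** * Composition of jets with real functions *)

Section jet_composition.
Variable R : realType.
Local Notation C := R[i].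

Definition jcomp (p : {poly R}) (A : {poly {poly C}}) : {poly {poly C}} :=
  \sum_(m < size p) ((p`_m)%:C)%:P%:P * A ^+ m.

(** As [v] vanishes at 0 it is [O(t)], which turns a remainder of order [N + 1] in [v] into one of
    order [N + 1] in [t]. *)
Lemma jet_comp (g : R -> R) (p : {poly R}) N (v : C -> R) A (K r : R) : 0 < r ->
  (forall x, `|x| <= r -> `|g x - p.[x]| <= K * `|x| ^+ N.+1) ->
  v 0 = 0 -> jet N.+1 (fun t => (v t)%:C) A ->
  jet N.+1 (fun t => (g (v t))%:C) (jcomp p A).
Proof.
move=> r0 H v0 vA.
have v1 : bigO 1 (fun t => (v t)%:C) by apply: bigO1_jet vA _; rewrite v0.
have [L [s [L0 s0 s1 vL]]] := bigO_pos v1.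
have vN : bigO N.+1 (fun t => (g (v t) - p.[v t])%:C).
  exists (Num.max K 0 * L ^+ N.+1), (Num.min s (r / L)); split.
    by rewrite lt_min s0 divr_gt0.
  move=> t; rewrite lt_min => /andP[ts tr]; have := vL t ts.
  rewrite !normc_real expr1 => vt.
  have vr : `|v t| <= r.
    by apply: le_trans vt _; rewrite mulrC -ler_pdivlMr// ltW.
  apply: le_trans (H _ vr) _; apply: (@le_trans _ _ (Num.max K 0 * `|v t| ^+ N.+1)).
    by rewrite ler_wpM2r ?exprn_ge0// le_max lexx.
  rewrite -mulrA ler_wpM2l ?le_max ?lexx ?orbT// -exprMn lerXn2r ?nnegrE//.
  by rewrite mulr_ge0 ?normc_ge0// ltW.
have pj : jet N.+1 (fun t => (p.[v t])%:C) (jcomp p A).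
  apply: (@eq_jet _ _ (fun t => \sum_(m < size p) (p`_m)%:C * (v t)%:C ^+ m)).
    move=> t; rewrite horner_coef real_complex_sum; apply: eq_bigr => m _.
    by rewrite real_complexM real_complexX.
  by apply: jet_sum => m _; apply: jetZ; exact: jetX.
by apply: eq_bigO (bigOD vN pj) => t; rewrite rmorphB /=; ring.
Qed.

Lemma jet_exp N (v : C -> R) A : v 0 = 0 -> jet N.+1 (fun t => (v t)%:C) A ->
  jet N.+1 (fun t => (expR (v t))%:C) (jcomp (exp_poly R N.+1) A).
Proof. have [K KP] := expR_taylor R N.+1; exact: jet_comp KP. Qed.

Lemma jet_ln N (v : C -> R) A : v 0 = 0 -> jet N.+1 (fun t => (v t)%:C) A ->
  jet N.+1 (fun t => (- ln (1 - v t))%:C) (jcomp (ln_poly R N.+1) A).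
Proof. by have [K KP] := ln_taylor R N.+1; apply: jet_comp KP; rewrite invr_gt0. Qed.

Lemma bigO_ev_vanish N (A : {poly {poly C}}) :
  (forall k l, (k + l < N)%N -> cf A k l = 0) -> bigO N (ev A).
Proof.
move=> A0; have [d [dP evE]] := ev_cf A.
apply: eq_bigO (fun t => esym (evE t)) _.
apply: bigO_sum => l _; apply: bigO_sum => k _.
have [h|h] := ltnP (k + l) N.
  apply: (@eq_bigO _ _ (fun=> 0)); last exact: bigO_0. by move=> t; rewrite A0// mul0r.
apply: bigOZ; have pw n v : bigO 1 v -> bigO n (fun t : C => v t ^+ n).
  move=> hv; elim: n => [|n IH]; first exact: bigO_cst.
  by have := bigOM hv IH; rewrite add1n; apply: eq_bigO => t; rewrite exprS.
apply: (bigO_le h); apply: bigOM; apply: pw; first exact: bigO_id.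
exact/bigO_conj/bigO_id.
Qed.

Lemma jet_trunc N u (A B : {poly {poly C}}) :
  (forall k l, (k + l < N)%N -> cf A k l = cf B k l) -> jet N u A -> jet N u B.
Proof.
move=> AB uA; have AB0 : bigO N (ev (A - B)).
  by apply: bigO_ev_vanish => k l /AB; rewrite cfD cfN => ->; rewrite subrr.
by apply: eq_bigO (bigOD uA AB0) => t; rewrite evD evN; ring.
Qed.

Lemma ahol_hpol (p q : {poly C}) t : ev (hol p + ahol q) t = hpol p (map_poly conjc q) t.
Proof. by rewrite evD ev_hol ev_ahol /hpol horner_map. Qed.

(** Up to degree two, the only monomial mixing [t] and its conjugate is [t * t^J]. Without it the
    jet is a harmonic polynomial, and the cubic remainder is [o(r^2)]. *)
Lemma jet_genharm (u : C -> C) z A : jet 3 (fun t => u (z + t)) A -> cf A 1 1 = 0 ->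
  genharm u z.
Proof.
move=> uA A11.
pose p := \poly_(k < 3) cf A k 0.
(* The constant term is already counted in [p]. *)
pose q := \poly_(l < 3) (if l == 0%N then 0 else (cf A 0 l)^J).
have {}uA : jet 3 (fun t => u (z + t)) (hol p + ahol q).
  have cj l : (if l == 0%N then 0 else (cf A 0 l)^J)^J = if l == 0%N then 0 else cf A 0 l.
    by case: eqP => _; rewrite ?conjc0 ?conjcK.
  apply: jet_trunc uA => k l kl; rewrite cfD cf_hol cf_ahol !coef_poly.
  have -> : (k < 3)%N by lia.
  have -> : (l < 3)%N by lia.
  rewrite cj; case: k kl => [|[|[|//]]]; case: l => [|[|[|//]]] //= _;
    by rewrite ?A11 ?addr0 ?add0r.
have [K [r [K0 r0 r1 H]]] := bigO_pos uA.
have u0 : u z = hpol p (map_poly conjc q) 0.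
  by have := bigO_at0 uA; rewrite addr0 ahol_hpol => /eqP; rewrite subr_eq0 => /eqP.
move=> e e0; have [|d d0 dP] := genharm_hpol p (map_poly conjc q) 0 (e := e / 2).
  by rewrite divr_gt0.
exists (Num.min (Num.min d r) (e / (8 * K))).
  by rewrite !lt_min d0 r0 divr_gt0// mulr_gt0.
move=> x /andP[x0]; rewrite !lt_min => /andP[/andP[xd xr] xe].
pose E t := u (z + t) - hpol p (map_poly conjc q) t.
have -> : cross u z x = cross (hpol p (map_poly conjc q)) 0 x +
   (E x%:C + E (- x%:C) + E ('i * x%:C) + E (- ('i * x%:C))).
  by rewrite /cross /E u0 !add0r; ring.
have nr : normc x%:C = x by rewrite normc_real gtr0_norm.
have nir : normc ('i * x%:C) = x by rewrite normcM normc_i mul1r nr.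
have HE t : normc t = x -> normc (E t) <= K * x ^+ 3.
  by move=> tx; have := H t; rewrite tx ahol_hpol => /(_ xr).
apply: le_trans (le_normcD _ _) _; rewrite [e]splitr mulrDl; apply: lerD.
  by apply: dP; rewrite x0.
apply: (@le_trans _ _ (K * x ^+ 3 + K * x ^+ 3 + K * x ^+ 3 + K * x ^+ 3)).
  do 3 (apply: le_trans (le_normcD _ _) _; apply: lerD; last by apply: HE; rewrite ?normcN).
  by apply: HE; rewrite ?normcN.
move: xe; rewrite ltr_pdivlMr ?mulr_gt0// => xe.
have -> : K * x ^+ 3 + K * x ^+ 3 + K * x ^+ 3 + K * x ^+ 3 = (x * (8 * K)) / 2 * x ^+ 2 by field.
by rewrite ler_wpM2r ?sqr_ge0// ler_wpM2r ?invr_ge0// ltW.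
Qed.

(* Equality modulo the ideal generated by the squares of the two variables. *)
Definition eq2 (A B : {poly {poly C}}) :=
  forall k l, (k <= 1)%N -> (l <= 1)%N -> cf A k l = cf B k l.

Lemma eq2_refl A : eq2 A A. Proof. by []. Qed.

Lemma eq2D A B A' B' : eq2 A A' -> eq2 B B' -> eq2 (A + B) (A' + B').
Proof. by move=> hA hB k l k1 l1; rewrite !cfD hA// hB. Qed.

Lemma eq2N A A' : eq2 A A' -> eq2 (- A) (- A').
Proof. by move=> hA k l k1 l1; rewrite !cfN hA. Qed.

Lemma eq2M A B A' B' : eq2 A A' -> eq2 B B' -> eq2 (A * B) (A' * B').
Proof.
move=> hA hB k l k1 l1; rewrite !cfM; apply: eq_bigr => j _; apply: eq_bigr => i _.
by rewrite hA ?hB//; have := ltn_ord i; have := ltn_ord j; lia.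
Qed.

Lemma eq2X A A' n : eq2 A A' -> eq2 (A ^+ n) (A' ^+ n).
Proof. by move=> hA; elim: n => [|n IH]//; rewrite !exprS; exact: eq2M. Qed.

Lemma eq2_sum (I : Type) (s : seq I) (P : pred I) (F G : I -> {poly {poly C}}) :
  (forall i, P i -> eq2 (F i) (G i)) ->
  eq2 (\sum_(i <- s | P i) F i) (\sum_(i <- s | P i) G i).
Proof. by move=> H; elim/big_ind2: _ => //; move=> A A' B B'; exact: eq2D. Qed.

Lemma eq2_prod (I : Type) (s : seq I) (P : pred I) (F G : I -> {poly {poly C}}) :
  (forall i, P i -> eq2 (F i) (G i)) ->
  eq2 (\prod_(i <- s | P i) F i) (\prod_(i <- s | P i) G i).
Proof. by move=> H; elim/big_ind2: _ => //; move=> A A' B B'; exact: eq2M. Qed.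

Lemma eq2_jcomp p A A' : eq2 A A' -> eq2 (jcomp p A) (jcomp p A').
Proof.
by move=> hA; apply: eq2_sum => m _; apply: eq2M; [exact: eq2_refl|exact: eq2X].
Qed.

End jet_composition.

(** * Taylor polynomials of complex differentiable functions *)

Section holomorphic_taylor.
Variable R : realType.
Local Notation C := R[i].

Lemma cdiff_scale (f : C -> C) (k z a : C) : k != 0 -> cdiff f (k * z) a ->
  cdiff (fun x => f (k * x)) z (k * a).
Proof.
move=> k0 fa e e0; have nk : 0 < normc k by rewrite normc_gt0.
have [|d d0 dP] := fa (e / normc k); first by rewrite divr_gt0.
exists (d / normc k); first by rewrite divr_gt0.
move=> h; rewrite ltr_pdivlMr// mulrC -normcM => /dP.
have -> : k * (z + h) = k * z + k * h by ring.
have -> : k * a * h = a * (k * h) by ring.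
by rewrite [normc (k * h)]normcM [_ * (normc k * _)]mulrA divfK ?gt_eqF.
Qed.

(** The generalized Laplacian of [f] itself is out of reach, but that of a primitive [F] vanishes,
    since its derivative [f] is differentiable. Difference quotients of [F] with a real step
    approximate [f], and those of harmonic polynomials are harmonic polynomials. From radius 8, a
    rescaling by 4 gives the radius 2 needed for the primitive, so [F] lives on radius 4 and is
    approximated on radius 2. *)
Lemma holo_happrox (f : C -> C) :
  (forall z, normc z < 8 -> exists a, cdiff f z a) -> happrox f.
Proof.
move=> fd.
have n4 : normc (4 : C) = 4 by rewrite -(rmorph_nat (real_complex R)) normc_real ger0_norm.
have n2 : normc (2 : C) = 2 by rewrite -(rmorph_nat (real_complex R)) normc_real ger0_norm.
have [G GP] : exists G : C -> C, forall z, normc z < 1 -> cdiff G z (f (4 * z)).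
  apply: (@holo_primitive R (fun z => f (4 * z))) => z z2.
  have [|a fa] := fd (4 * z); first by rewrite normcM n4; lra.
  by exists (4 * a); apply: cdiff_scale => //; rewrite pnatr_eq0.
pose F z := 4 * G (4^-1 * z).
have FP z : normc z < 4 -> cdiff F z (f z).
  move=> z4; have z1 : normc (4^-1 * z) < 1 by rewrite normcM normcV n4; lra.
  have := cdiffZ 4 (cdiff_scale (_ : 4^-1 != 0) (GP _ z1)).
  by rewrite invr_eq0 pnatr_eq0 => /(_ isT); rewrite !mulrA divff ?pnatr_eq0// !mul1r.
have Fh : happrox (fun w => F (2 * w)).
  have F2 z : normc z <= 1 -> cdiff (fun w => F (2 * w)) z (2 * f (2 * z)).
    by move=> z1; apply: cdiff_scale; rewrite ?pnatr_eq0//; apply: FP; rewrite normcM n2; lra.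
  apply: genharm_happrox => z z1; first exact: cdiff_ccont (F2 z z1).
  have [|a fa] := fd (2 * z); first by rewrite normcM n2; lra.
  have f2 : cdiff (fun w => 2 * f (2 * w)) z (2 * (2 * a)).
    by apply: cdiffZ; apply: cdiff_scale; rewrite ?pnatr_eq0.
  apply: (@genharm_primitive R _ (fun w => 2 * f (2 * w)) z _ (1 - normc z)) f2.
    by rewrite subr_gt0.
  move=> h hz; apply: F2; apply: le_trans (le_normcD _ _) _; lra.
have fc z : normc z <= 1 -> ccont f z.
  by move=> z1; have [|a /cdiff_ccont] := fd z; first lra.
move=> e e0; have e4 : 0 < e / 4 by rewrite divr_gt0.
have [d d0 dP] := disc_unif_cont fc e4.
pose h := Num.min (d / 2) 1; have h0 : 0 < h by rewrite lt_min ltr01 divr_gt0.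
have h1 : h <= 1 by rewrite ge_min lexx orbT.
have hd : h < d by apply: (@le_lt_trans _ _ (d / 2)); [rewrite ge_min lexx|lra].
have hC : h%:C != 0 by rewrite -normc_gt0 normc_real gtr0_norm.
(* The tolerance is proportional to the step because the difference quotient divides by [h]. The
   quotient itself costs [e / 2], its two endpoints [e / 4] each. *)
have [|p [q pq]] := Fh (e / 4 * h); first by rewrite mulr_gt0.
pose sh (r : {poly C}) := (h%:C)^-1 *: ((r \Po (2^-1 *: ('X + (h%:C)%:P))) - (r \Po (2^-1 *: 'X))).
have shE r z : (sh r).[z] = (h%:C)^-1 * (r.[2^-1 * (z + h%:C)] - r.[2^-1 * z]).
  by rewrite /sh hornerZ hornerD hornerN !horner_comp !hornerZ hornerD hornerX hornerC.
exists (sh p), (sh q) => z z1.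
have -> : hpol (sh p) (sh q) z = (h%:C)^-1 * (hpol p q (2^-1 * (z + h%:C)) - hpol p q (2^-1 * z)).
  rewrite /hpol !shE !conjcM conjcD conjc_real.
  have -> : (2^-1)^J = 2^-1 :> C by rewrite conjc_inv conjc_nat.
  ring.
have nz : normc (2^-1 * z) <= 1 by rewrite normcM normcV n2; lra.
have nzh : normc (2^-1 * (z + h%:C)) <= 1.
  rewrite normcM normcV n2; have := le_normcD z h%:C.
  by rewrite normc_real gtr0_norm//; lra.
have := pq _ nz; have := pq _ nzh; rewrite !mulrA !divff ?pnatr_eq0// !mul1r => B1 B2.
have B3 : normc (F (z + h%:C) - F z - h%:C * f z) <= 2 * (e / 4) * h.
  pose L (x : R) := F (z + x%:C * 1) - x%:C * f z.
  have LE : L h - L 0 = F (z + h%:C) - F z - h%:C * f z.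
    by rewrite /L mulr1 !mul0r addr0 subr0; ring.
  have := @cmean_value_bound R L (fun x => f (z + x%:C * 1) * 1 - f z) 0 h (e / 4) (ltW h0).
  rewrite LE subr0; apply.
    move=> x /andP[x0 xh]; apply: is_cderiveB.
      apply: is_cderive_line; apply: FP; rewrite mulr1; apply: le_lt_trans (le_normcD _ _) _.
      by rewrite normc_real ger0_norm//; lra.
    case: (f z) => a b; split.
      rewrite (_ : (fun _ => _) = (fun t : R => t * a)); last by apply/funext => t; rewrite ReMr.
      by apply: is_derive_eq; rewrite /GRing.scale/=; ring.
    rewrite (_ : (fun _ => _) = (fun t : R => t * b)); last by apply/funext => t; rewrite ImMr.
    by apply: is_derive_eq; rewrite /GRing.scale/=; ring.
  move=> x /andP[x0 xh]; rewrite !mulr1; apply: dP => //.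
  by rewrite addrC addKr normc_real ger0_norm//; apply: le_lt_trans xh hd.
have -> : f z - (h%:C)^-1 * (hpol p q (2^-1 * (z + h%:C)) - hpol p q (2^-1 * z)) =
  (h%:C)^-1 * (- (F (z + h%:C) - F z - h%:C * f z)
    + (F (z + h%:C) - hpol p q (2^-1 * (z + h%:C))) - (F z - hpol p q (2^-1 * z))).
  by field.
rewrite normcM normcV normc_real gtr0_norm// ler_pdivrMl//.
apply: le_trans (le_normcD _ _) _; rewrite normcN.
apply: le_trans (lerD (le_normcD _ _) (lexx _)) _; rewrite normcN.
apply: le_trans (lerD (lerD B3 B1) B2) _.
by rewrite le_eqVlt; apply/orP; left; apply/eqP; field.
Qed.

(** The antiholomorphic part must be shown constant. Multiplication by [z] keeps the function
    holomorphic, so the jet of [z * f z] has no mixed monomial either; but a term in a positive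
    power of [t^J] in the jet of [f] would produce one. *)
Lemma holo_taylor (f : C -> C) M K :
  (forall z, normc z < 8 -> exists a, cdiff f z a) ->
  (forall z, normc z <= 1 -> normc (f z) <= M) ->
  exists p : {poly C}, (size p <= K.+1)%N /\
    forall z, normc z <= 2^-1 -> normc (f z - p.[z]) <= 4 * M * normc z ^+ K.+1.
Proof.
move=> fd fM.
have [p [q [sp sq pq]]] := happrox_taylor K (holo_happrox fd) fM.
have xd z : normc z < 8 -> exists a, cdiff (fun x => x * f x) z a.
  by move=> /fd [a fa]; exists (f z + z * a); exact: cdiff_mulX.
have M0 : 0 <= M by apply: le_trans (fM 0 _); rewrite ?normc_ge0// normc0.
have xM z : normc z <= 1 -> normc (z * f z) <= M.
  move=> z1; rewrite normcM -[M]mul1r; apply: ler_pM; rewrite ?normc_ge0//; exact: fM.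
have [p' [q' [_ _ pq']]] := happrox_taylor K.+1 (holo_happrox xd) xM.
pose qc (r : {poly C}) := map_poly conjc r.
have qcK r : map_poly conjc (qc r) = r.
  by apply/polyP => i; rewrite !coef_map /= conjcK.
have jf : jet K.+1 f (hol p + ahol (qc q)).
  exists (4 * M), 2^-1; split; first by rewrite invr_gt0.
  by move=> t /ltW tr; rewrite ahol_hpol qcK pq.
have jx : jet K.+2 (fun t => t * f t) (hol p' + ahol (qc q')).
  exists (4 * M), 2^-1; split; first by rewrite invr_gt0.
  by move=> t /ltW tr; rewrite ahol_hpol qcK pq'.
have jx' : jet K.+2 (fun t => t * f t) (hol 'X * (hol p + ahol (qc q))).
  apply: (@eq_bigO _ _ (fun t => t * (f t - ev (hol p + ahol (qc q)) t))).
    by move=> t; rewrite evM ev_hol hornerX; ring.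
  by have := bigOM (@bigO_id R) jf; rewrite add1n.
have q0 l : (0 < l)%N -> q`_l = 0.
  move=> l0; have [lK|Kl] := ltnP l K.+1; last by rewrite nth_default// (leq_trans sq).
  have kl : (1 + l < K.+2)%N by lia.
  have := jet_uniq jx' jx kl.
  rewrite cfD cf_hol cf_ahol /= ifF ?gtn_eqF// addr0.
  rewrite /cf /hol coefCM coefXM /= coefD coefC ifF ?gtn_eqF//.
  rewrite add0r -/(cf (ahol (qc q)) 0 l) cf_ahol /= /qc coef_map /= conjcK.
  by [].
exists (p + (q`_0)%:P); split.
  by apply: leq_trans (size_polyD _ _) _; rewrite geq_max sp; apply: leq_trans (size_polyC_leq1 _) _.
move=> z /pq; rewrite /hpol hornerD hornerC.
have -> : q = (q`_0)%:P by apply/polyP => -[|l]; rewrite coefC //= q0.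
by rewrite hornerC coefC.
Qed.

End holomorphic_taylor.

(** * Gram matrices of square-summable families *)

Section sums.
Variable R : realType.
Local Notation C := R[i].

Definition rsum (a : nat -> R) (s : R) :=
  (forall n, \sum_(j < n) a j <= s) /\
  forall e, 0 < e -> exists N, forall n, (N <= n)%N -> s - e <= \sum_(j < n) a j.

Definition csum (a : nat -> C) (s : C) := forall e : R, 0 < e ->
  exists N, forall n, (N <= n)%N -> normc (\sum_(j < n) a j - s) <= e.

Lemma sum_mono (a : nat -> R) n m : (forall j, 0 <= a j) -> (n <= m)%N ->
  \sum_(j < n) a j <= \sum_(j < m) a j.
Proof.
move=> a0 nm; rewrite -(big_mkord xpredT a) -(big_mkord xpredT a).
by rewrite (big_cat_nat _ nm)//= lerDl sumr_ge0.
Qed.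

Lemma rsum_bounded (a : nat -> R) M : (forall j, 0 <= a j) ->
  (forall n, \sum_(j < n) a j <= M) -> exists s, rsum a s /\ s <= M.
Proof.
move=> a0 aM; pose V := range (fun n => \sum_(j < n) a j).
have supV : has_sup V by split; [exists (\sum_(j < 0) a j); exists 0%N|exists M => _ [n _ <-]].
exists (sup V); split; last first.
  by apply: ge_sup; [exists (\sum_(j < 0) a j); exists 0%N|move=> _ [n _ <-]].
split=> [n|e e0]; first by apply: sup_upper_bound => //; exists n.
have [_ [N _ <-] h] := sup_adherent e0 supV.
by exists N => n Nn; apply: le_trans (ltW h) _; exact: sum_mono.
Qed.

Lemma csum_abs (a : nat -> C) (c : nat -> R) M : (forall j, normc (a j) <= c j) ->
  (forall n, \sum_(j < n) c j <= M) -> exists s, csum a s.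
Proof.
move=> ac cM; have c0 j : 0 <= c j := le_trans (normc_ge0 _) (ac j).
have [s [[sc sP] _]] := rsum_bounded c0 cM.
pose e n := s - \sum_(j < n) c j.
have dif n m : (n <= m)%N -> normc (\sum_(j < m) a j - \sum_(j < n) a j) <= e n + e m.
  move=> nm; rewrite -(big_mkord xpredT a) -(big_mkord xpredT a) (big_cat_nat _ nm)//=.
  rewrite addrAC subrr add0r; apply: le_trans (normc_sum _ _ _) _.
  apply: (@le_trans _ _ (\sum_(n <= j < m) c j)); first exact: ler_sum.
  have := sc m; have := sc n; rewrite /e -!(big_mkord xpredT c) (big_cat_nat _ nm)//=; lra.
have [l lP] : exists l, forall n, normc (\sum_(j < n) a j - l) <= 2 * e n.
  apply: complex_limit => n m; have [nm|/ltnW mn] := leqP n m.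
    by rewrite normcB dif.
  by rewrite [leRHS]addrC dif.
exists l => x x0; have [|N NP] := sP (x / 2); first by rewrite divr_gt0.
exists N => n /NP h; apply: le_trans (lP n) _; rewrite /e; lra.
Qed.

Lemma cauchy_schwarz (b x : nat -> R) n :
  (\sum_(j < n) b j * x j) ^+ 2 <= (\sum_(j < n) b j ^+ 2) * (\sum_(j < n) x j ^+ 2).
Proof.
elim: n => [|n IH]; first by rewrite !big_ord0 expr0n mulr0.
rewrite !big_ord_recr /=.
set c := \sum_(j < n) b j * x j in IH *; set A := \sum_(j < n) b j ^+ 2 in IH *.
set B := \sum_(j < n) x j ^+ 2 in IH *.
have A0 : 0 <= A by apply: sumr_ge0 => j _; exact: sqr_ge0.
have B0 : 0 <= B by apply: sumr_ge0 => j _; exact: sqr_ge0.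
set u := b n; set v := x n.
suff : 2 * c * u * v <= A * v ^+ 2 + B * u ^+ 2 by nra.
have h : (2 * c * u * v) ^+ 2 <= (A * v ^+ 2 + B * u ^+ 2) ^+ 2.
  apply: (@le_trans _ _ (4 * (A * B) * (u * v) ^+ 2)).
    have := sqr_ge0 (u * v); nra.
  have := sqr_ge0 (A * v ^+ 2 - B * u ^+ 2); nra.
have p0 : 0 <= A * v ^+ 2 + B * u ^+ 2.
  by rewrite addr_ge0// mulr_ge0// sqr_ge0.
apply: le_trans (ler_norm _) _; rewrite -(ler_pXn2r (_ : 0 < 2)%N) ?nnegrE//.
by rewrite -normrX ger0_norm ?sqr_ge0.
Qed.

Lemma cauchy_schwarz_normc (b x : nat -> C) n :
  normc (\sum_(j < n) b j * x j) ^+ 2 <=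
  (\sum_(j < n) normc (b j) ^+ 2) * (\sum_(j < n) normc (x j) ^+ 2).
Proof.
apply: le_trans (cauchy_schwarz (fun j => normc (b j)) (fun j => normc (x j)) n).
rewrite lerXn2r ?nnegrE ?normc_ge0//.
  by apply: sumr_ge0 => j _; rewrite mulr_ge0 ?normc_ge0.
by apply: le_trans (normc_sum _ _ _) _; apply: ler_sum => j _; rewrite normcM.
Qed.

Lemma csumD a b s t : csum a s -> csum b t -> csum (fun j => a j + b j) (s + t).
Proof.
move=> ha hb e e0; have e2 : 0 < e / 2 by rewrite divr_gt0.
have [N NP] := ha _ e2; have [N' N'P] := hb _ e2.
exists (maxn N N') => n; rewrite geq_max => /andP[nN nN'].
rewrite big_split /= (_ : _ - _ = (\sum_(j < n) a j - s) + (\sum_(j < n) b j - t)); last by ring.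
by apply: le_trans (le_normcD _ _) _; rewrite [e]splitr lerD ?NP ?N'P.
Qed.

Lemma csumZ k a s : csum a s -> csum (fun j => k * a j) (k * s).
Proof.
move=> ha e e0; have k1 : 0 < normc k + 1 by rewrite ltr_wpDl// normc_ge0.
have [N NP] := ha (e / (normc k + 1)) (divr_gt0 e0 k1).
exists N => n /NP h; rewrite -mulr_sumr -mulrBr normcM.
apply: le_trans (ler_wpM2l (normc_ge0 _) h) _.
by rewrite mulrCA ler_piMr ?(ltW e0)// ler_pdivrMr// mul1r lerDl.
Qed.

Lemma eq_csum a b s : (forall j, a j = b j) -> csum a s -> csum b s.
Proof. by move=> /funext ->. Qed.

Lemma csum0 : csum (fun=> 0) 0.
Proof. by move=> e e0; exists 0%N => n _; rewrite big1// subrr normc0 ltW. Qed.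

Lemma csum_big (I : Type) (r : seq I) (P : pred I) (F : I -> nat -> C) (G : I -> C) :
  (forall i, P i -> csum (F i) (G i)) ->
  csum (fun j => \sum_(i <- r | P i) F i j) (\sum_(i <- r | P i) G i).
Proof.
move=> H; elim: r => [|i r IH].
  by rewrite big_nil; apply: eq_csum csum0 => j; rewrite big_nil.
rewrite big_cons; case: (boolP (P i)) => Pi.
  by apply: eq_csum (csumD (H i Pi) IH) => j; rewrite big_cons Pi.
by apply: eq_csum IH => j; rewrite big_cons (negPf Pi).
Qed.

End sums.

(** * Taylor expansion of a sum of squared moduli *)

Section gram.
Variable R : realType.
Local Notation C := R[i].

Lemma poly_bigO_eq (p q : {poly C}) N : (size p <= N)%N -> (size q <= N)%N ->
  bigO N (fun t => p.[t] - q.[t]) -> p = q.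
Proof.
move=> sp sq pq; apply/polyP => k; have [kN|Nk] := ltnP k N; last first.
  by rewrite !nth_default// ?(leq_trans sp)// (leq_trans sq).
have := @jet_uniq R N (fun t => p.[t]) (hol p) (hol q).
have jp : jet N (fun t => p.[t]) (hol p).
  by apply: eq_bigO (bigO_0 R N) => t; rewrite ev_hol subrr.
have jq : jet N (fun t => p.[t]) (hol q) by apply: eq_bigO pq => t; rewrite ev_hol.
by move=> /(_ jp jq k 0); rewrite addn0 => /(_ kN); rewrite !cf_hol.
Qed.

Variables (f : nat -> C -> C) (S : C -> R) (M : R) (K : nat).
Hypothesis M0 : 0 <= M.
Hypothesis fd : forall j z, normc z < 8 -> exists a, cdiff (f j) z a.
Hypothesis fS : forall z, normc z <= 1 -> rsum (fun j => normc (f j z) ^+ 2) (S z).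
Hypothesis SM : forall z, normc z <= 1 -> S z <= M ^+ 2.

Lemma comb_cdiff (b : nat -> C) J z : normc z < 8 ->
  exists a, cdiff (fun x => \sum_(j < J) b j * f j x) z a.
Proof.
move=> z8; elim: J => [|J [a IH]].
  exists 0; rewrite (_ : (fun _ => _) = (fun=> 0)); first exact: cdiff_cst.
  by apply/funext => x; rewrite big_ord0.
have [a' fa'] := fd J z8; exists (a + b J * a').
rewrite (_ : (fun _ => _) = (fun x => \sum_(j < J) b j * f j x + b J * f J x)).
  by apply: cdiffD => //; exact: cdiffZ.
by apply/funext => x; rewrite big_ord_recr.
Qed.

Lemma comb_bound (b : nat -> C) J B z : 0 <= B ->
  \sum_(j < J) normc (b j) ^+ 2 <= B ^+ 2 -> normc z <= 1 ->
  normc (\sum_(j < J) b j * f j z) <= B * M.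
Proof.
move=> B0 bB z1; rewrite -(ler_pXn2r (_ : 0 < 2)%N) ?nnegrE ?normc_ge0 ?mulr_ge0//.
apply: le_trans (cauchy_schwarz_normc b (fun j => f j z) J) _.
rewrite exprMn; apply: ler_pM => //; try by apply: sumr_ge0 => j _; exact: sqr_ge0.
by apply: le_trans (SM z1); have [] := fS z1.
Qed.

Lemma coord_taylor j : exists p : {poly C}, (size p <= K.+1)%N /\
  forall z, normc z <= 2^-1 -> normc (f j z - p.[z]) <= 4 * M * normc z ^+ K.+1.
Proof.
apply: holo_taylor => [z|z z1]; first exact: fd.
rewrite -(ler_pXn2r (_ : 0 < 2)%N) ?nnegrE ?normc_ge0//.
apply: le_trans (SM z1); have [+ _] := fS z1 => /(_ j.+1); apply: le_trans.
by rewrite big_ord_recr /= lerDr; apply: sumr_ge0 => i _; exact: sqr_ge0.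
Qed.

Variable p : nat -> {poly C}.
Hypothesis ps : forall j, (size (p j) <= K.+1)%N.
Hypothesis pP : forall j z, normc z <= 2^-1 ->
  normc (f j z - (p j).[z]) <= 4 * M * normc z ^+ K.+1.

(** By Cauchy-Schwarz the combination is bounded by [B * M], so its Taylor remainder is controlled
    independently of [J]. Its Taylor polynomial is the combination of the [p j], by uniqueness of
    jets. *)
Lemma comb_taylor (b : nat -> C) J B : 0 <= B ->
  \sum_(j < J) normc (b j) ^+ 2 <= B ^+ 2 ->
  forall z, normc z <= 2^-1 ->
  normc (\sum_(j < J) b j * f j z - (\sum_(j < J) b j *: p j).[z]) <= 4 * (B * M) * normc z ^+ K.+1.
Proof.
move=> B0 bB.
have [q [qs qP]] := @holo_taylor R (fun x => \sum_(j < J) b j * f j x) (B * M) K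
  (@comb_cdiff b J) (fun z => comb_bound B0 bB (z := z)).
suff -> : \sum_(j < J) b j *: p j = q by [].
apply: (@poly_bigO_eq _ _ K.+1) => //.
  apply: leq_trans (size_sum _ _ _) _; apply/bigmax_leqP => j _.
  exact: leq_trans (size_scale_leq _ _) (ps j).
have half0 : 0 < 2^-1 :> R by rewrite invr_gt0.
have e1 : bigO K.+1 (fun t => \sum_(j < J) b j * (f j t - (p j).[t])).
  apply: bigO_sum => j _; apply: bigOZ; exists (4 * M), 2^-1; split=> // t /ltW.
  exact: pP.
have e2 : bigO K.+1 (fun t => \sum_(j < J) b j * f j t - q.[t]).
  by exists (4 * (B * M)), 2^-1; split=> // t /ltW /qP.
apply: eq_bigO (bigOB e2 e1) => t; rewrite horner_sum.
have -> : \sum_(j < J) b j * (f j t - (p j).[t]) =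
    \sum_(j < J) b j * f j t - \sum_(j < J) (b j *: p j).[t].
  by rewrite -sumrB; apply: eq_bigr => j _; rewrite hornerZ mulrBr.
ring.
Qed.

(** Duality in finite dimension: a linear functional tested on the conjugate of [x] returns the
    squared norm of [x], and one factor of the norm cancels. *)
Lemma dual_bound (x : nat -> C) J L : 0 <= L ->
  (forall B, 0 <= B -> \sum_(j < J) normc (x j) ^+ 2 <= B ^+ 2 ->
     normc (\sum_(j < J) (x j)^J * x j) <= B * L) ->
  \sum_(j < J) normc (x j) ^+ 2 <= L ^+ 2.
Proof.
move=> L0 H; set T := \sum_(j < J) _.
have T0 : 0 <= T by apply: sumr_ge0 => j _; exact: sqr_ge0.
have := H (Num.sqrt T) (sqrtr_ge0 _); rewrite sqr_sqrtr// => /(_ (lexx _)).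
have -> : \sum_(j < J) (x j)^J * x j = T%:C.
  by rewrite /T real_complex_sum; apply: eq_bigr => j _; rewrite normc_sqE mulrC.
rewrite normc_real ger0_norm// -{1}(sqr_sqrtr T0) => h.
have [s0|s0] := eqVneq (Num.sqrt T) 0.
  by rewrite -(sqr_sqrtr T0) s0 expr0n sqr_ge0.
have sp : 0 < Num.sqrt T by rewrite lt_neqAle eq_sym s0 sqrtr_ge0.
rewrite -(sqr_sqrtr T0) lerXn2r ?nnegrE ?sqrtr_ge0//.
by rewrite -(ler_pM2l sp) -expr2.
Qed.

Lemma rem_bound z J : normc z <= 2^-1 ->
  \sum_(j < J) normc (f j z - (p j).[z]) ^+ 2 <= (4 * M * normc z ^+ K.+1) ^+ 2.
Proof.
move=> z2; apply: (@dual_bound (fun j => f j z - (p j).[z])).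
  by rewrite !mulr_ge0// exprn_ge0// normc_ge0.
move=> B B0 hB.
have := @comb_taylor (fun j => (f j z - (p j).[z])^J) J B B0.
rewrite (eq_bigr (fun j : 'I_J => normc (f j z - (p j).[z]) ^+ 2)); last first.
  by move=> j _; rewrite normc_conj.
move=> /(_ hB z z2); rewrite horner_sum -sumrB.
rewrite (eq_bigr (fun j : 'I_J => (f j z - (p j).[z])^J * (f j z - (p j).[z]))); last first.
  by move=> j _; rewrite hornerZ -mulrBr.
by move=> h; apply: le_trans h _; rewrite le_eqVlt; apply/orP; left; apply/eqP; ring.
Qed.

(** By duality it suffices to bound one coefficient of a combination. The factor 5 is 1 for the
    function plus 4 for its remainder on the circle of radius 1/2, and rescaling this circle to the
    unit circle costs [2 ^+ k]. *)
Lemma coef_bound k J : \sum_(j < J) normc ((p j)`_k) ^+ 2 <= (5 * 2 ^+ k * M) ^+ 2.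
Proof.
apply: (@dual_bound (fun j => (p j)`_k)).
  by rewrite !mulr_ge0// exprn_ge0.
move=> B B0 hB.
pose b j := ((p j)`_k)^J.
have hB' : \sum_(j < J) normc (b j) ^+ 2 <= B ^+ 2.
  by rewrite (eq_bigr (fun j : 'I_J => normc ((p j)`_k) ^+ 2))// => j _; rewrite normc_conj.
pose g := \sum_(j < J) b j *: p j.
have gk : \sum_(j < J) ((p j)`_k)^J * (p j)`_k = g`_k.
  by rewrite /g coef_sum; apply: eq_bigr => j _; rewrite coefZ.
rewrite gk; pose h := g \Po (2^-1 *: 'X).
have hb z : normc z = 1 -> normc (hpol h 0 z) <= 5 * (B * M).
  move=> z1; rewrite /hpol horner0 addr0 /h horner_comp hornerZ hornerX.
  have z2 : normc (2^-1 * z) <= 2^-1.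
    by rewrite normcM normcV z1 mulr1 -(rmorph_nat (real_complex R)) normc_real ger0_norm.
  have t := comb_taylor B0 hB' z2.
  have bb := comb_bound B0 hB' (le_trans z2 (_ : 2^-1 <= 1)).
  have {}bb : normc (\sum_(j < J) b j * f j (2^-1 * z)) <= B * M by apply: bb; rewrite invf_le1 ?ler1n.
  rewrite -[(g).[_]](subKr (\sum_(j < J) b j * f j (2^-1 * z))).
  apply: le_trans (le_normcD _ _) _; rewrite normcN.
  apply: le_trans (lerD bb t) _.
  have : normc (2^-1 * z) ^+ K.+1 <= 1.
    rewrite exprn_ile1 ?normc_ge0//; apply: le_trans z2 _; by rewrite invf_le1 ?ler1n.
  have : 0 <= B * M by rewrite mulr_ge0.
  by set X := _ ^+ K.+1; nra.
have := hpol_coef_bound k hb; rewrite coef0 mul0rn addr0.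
have -> : h`_k = 2^-1 ^+ k * g`_k.
  rewrite /h comp_polyE coef_sum.
  rewrite (eq_bigr (fun i : 'I_(size g) => g`_i * (2^-1 ^+ i * (k == i)%:R))); last first.
    by move=> i _; rewrite coefZ exprZn coefZ coefXn.
  have [kg|gk'] := ltnP k (size g); last first.
    rewrite nth_default// mulr0 big1// => i _.
    by rewrite gtn_eqF ?mulr0//; apply: leq_trans gk'.
  rewrite (bigD1 (Ordinal kg))//= eqxx mulr1 big1 ?addr0 1?mulrC// => i ik.
  rewrite (_ : (k == i) = false) ?mulr0//; apply/negbTE; apply: contra ik => /eqP h1.
  by apply/eqP/val_inj.
rewrite normcM normcX normcV -(rmorph_nat (real_complex R)) normc_real ger0_norm//.
rewrite exprVn ler_pdivrMl ?exprn_gt0// => h1; apply: le_trans h1 _.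
by rewrite le_eqVlt; apply/orP; left; apply/eqP; ring.
Qed.

Lemma gram_csum k l : exists s, csum (fun j => (p j)`_k * ((p j)`_l)^J) s.
Proof.
apply: (@csum_abs R _ (fun j => normc ((p j)`_k) ^+ 2 + normc ((p j)`_l) ^+ 2)
   ((5 * 2 ^+ k * M) ^+ 2 + (5 * 2 ^+ l * M) ^+ 2)).
  move=> j; rewrite normcM normc_conj.
  have := sqr_ge0 (normc (p j)`_k - normc (p j)`_l).
  have := sqr_ge0 (normc (p j)`_k); have := sqr_ge0 (normc (p j)`_l); nra.
by move=> n; rewrite big_split lerD ?coef_bound.
Qed.

(** The expansion of the infinite sum [S] may be taken term by term because the sum of the squared
    remainders is bounded independently of the number of terms. Its coefficients form the Gram
    matrix of the sequences of Taylor coefficients. *)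
Lemma gram_jet : exists B : {poly {poly C}},
  jet K.+1 (fun z => (S z)%:C) B /\
  forall k l, csum (fun j => (p j)`_k * ((p j)`_l)^J) (cf B k l).
Proof.
have [g gP] := choice (fun kl : nat * nat => gram_csum kl.1 kl.2).
pose B : {poly {poly C}} := \poly_(l < K.+1) \poly_(k < K.+1) g (k, l).
have BP k l : csum (fun j => (p j)`_k * ((p j)`_l)^J) (cf B k l).
  rewrite /cf coef_poly; case: ifP => lK; last first.
    rewrite coef0; apply: (eq_csum _ (@csum0 R)) => j.
    by rewrite [_`_l]nth_default ?conjc0 ?mulr0// (leq_trans (ps j))// leqNgt lK.
  rewrite coef_poly; case: ifP => kK; first exact: (gP (k, l)).
  apply: (eq_csum _ (@csum0 R)) => j.
  by rewrite nth_default ?mul0r// (leq_trans (ps j))// leqNgt kK.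
exists B; split=> //.
have evB z : csum (fun j => (normc (p j).[z] ^+ 2)%:C) (ev B z).
  have -> : ev B z = \sum_(l < K.+1) \sum_(k < K.+1) (z ^+ k * z^J ^+ l) * cf B k l.
    rewrite /ev /B horner_poly horner_sum; apply: eq_bigr => l _.
    rewrite hornerM horner_exp hornerC horner_poly mulr_suml; apply: eq_bigr => k _.
    by rewrite /cf coef_poly ltn_ord coef_poly ltn_ord; ring.
  apply: (@eq_csum _ (fun j => \sum_(l < K.+1) \sum_(k < K.+1) (z ^+ k * z^J ^+ l) *
     ((p j)`_k * ((p j)`_l)^J))).
    move=> j; rewrite normc_sqE (horner_coef_wide _ (ps j)) conjc_sum mulr_sumr.
    apply: eq_bigr => l _; rewrite mulr_suml; apply: eq_bigr => k _.
    by rewrite conjcM conjcX; ring.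
  by apply: csum_big => l _; apply: csum_big => k _; apply: csumZ.
pose c := M + 4 * M.
(* The first summand bounds the squared remainders, the second the cross terms between [f j] and its
   remainder; [2 * c ^+ 2 + 1] only serves as a majorant of [M]. *)
exists ((4 * M) ^+ 2 + 2 * (2 * c ^+ 2 + 1) * (4 * M)), 2^-1; split; first by rewrite invr_gt0.
move=> z /ltW z2.
have zlt : normc z <= 1 by apply: le_trans z2 _; rewrite invf_le1 ?ler1n.
have Z1 : normc z ^+ K.+1 <= 1 by rewrite exprn_ile1 ?normc_ge0.
have Z0 : 0 <= normc z ^+ K.+1 by rewrite exprn_ge0 ?normc_ge0.
set Z := normc z ^+ K.+1 in Z1 Z0 *.
set D := (X in X * Z).
have fin n : normc (\sum_(j < n) (normc (f j z) ^+ 2)%:C - \sum_(j < n) (normc (p j).[z] ^+ 2)%:C) <= D * Z.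
  rewrite -sumrB; apply: le_trans (normc_sum _ _ _) _.
  pose r j := normc (f j z - (p j).[z]); pose a j := normc (f j z).
  have rb := rem_bound n z2; rewrite -/Z in rb.
  have ab : \sum_(j < n) a j ^+ 2 <= M ^+ 2.
    by apply: le_trans (SM zlt); have [] := fS zlt.
  apply: (@le_trans _ _ (\sum_(j < n) (r j ^+ 2 + 2 * (a j * r j)))).
    apply: ler_sum => j _; rewrite -rmorphB normc_real.
    have t1 : `|a j - normc (p j).[z]| <= r j.
      have := ler_normcD3 (f j z) (p j).[z] 0; have := ler_normcD3 (p j).[z] (f j z) 0.
      by rewrite !subr0 (normcB (p j).[z]) ler_norml -/(r j) -/(a j); lra.
    have a0 : 0 <= a j := normc_ge0 _. have r0 : 0 <= r j := normc_ge0 _.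
    rewrite -/(a j) subr_sqr normrM.
    have t2 : `|a j + normc (p j).[z]| <= 2 * a j + r j.
      rewrite ger0_norm ?addr_ge0 ?normc_ge0//; move: t1; rewrite ler_norml; lra.
    apply: le_trans (ler_pM _ _ t1 t2) _; rewrite ?normr_ge0//; nra.
  rewrite big_split -mulr_sumr /=.
  have cs := cauchy_schwarz a r n.
  set P := \sum_(j < n) a j * r j in cs *; set Rr := \sum_(j < n) r j ^+ 2 in rb cs *.
  have P0 : 0 <= P by apply: sumr_ge0 => j _; rewrite mulr_ge0 ?normc_ge0.
  have A0 : 0 <= \sum_(j < n) a j ^+ 2 by apply: sumr_ge0 => j _; exact: sqr_ge0.
  have R0 : 0 <= Rr by apply: sumr_ge0 => j _; exact: sqr_ge0.
  have Pb : P <= M * (4 * M * Z).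
    rewrite -(ler_pXn2r (_ : 0 < 2)%N) ?nnegrE ?mulr_ge0//.
    by apply: le_trans cs _; rewrite [leRHS]exprMn ler_pM.
  apply: le_trans (lerD rb (ler_wpM2l (_ : 0 <= 2) Pb)) _ => //.
  have MM : 0 <= M * M by rewrite mulr_ge0.
  rewrite exprMn; apply: (@le_trans _ _ ((4 * M) ^+ 2 * Z + 2 * (M * (4 * M * Z)))).
    by rewrite lerD2r ler_wpM2l ?sqr_ge0// expr2 ler_piMr.
  rewrite /D [leRHS]mulrDl lerD2l.
  have : M <= 2 * c ^+ 2 + 1 by rewrite /c; nra.
  move=> Mc; rewrite -!mulrA ler_wpM2l//; apply: ler_wpM2r; last by [].
  by rewrite !mulr_ge0.
apply/ler_addgt0Pl => e e0.
have e2 : 0 < e / 2 by rewrite divr_gt0.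
have [N NP] := evB z _ e2; have [Su /(_ _ e2) [N' N'P]] := fS zlt.
pose n := maxn N N'.
have h1 := NP n (leq_maxl _ _); have h2 := N'P n (leq_maxr _ _); have h3 := Su n.
have -> : (S z)%:C - ev B z = ((S z)%:C - \sum_(j < n) (normc (f j z) ^+ 2)%:C) +
   (\sum_(j < n) (normc (f j z) ^+ 2)%:C - \sum_(j < n) (normc (p j).[z] ^+ 2)%:C) +
   (\sum_(j < n) (normc (p j).[z] ^+ 2)%:C - ev B z) by ring.
apply: le_trans (le_normcD _ _) _; apply: le_trans (lerD (le_normcD _ _) (lexx _)) _.
rewrite [e]splitr -addrA addrCA -addrA [leLHS]addrA.
have h4 : normc ((S z)%:C - \sum_(j < n) (normc (f j z) ^+ 2)%:C) <= e / 2.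
  rewrite -real_complex_sum -rmorphB normc_real ler_norml; lra.
by have := fin n; lra.
Qed.

End gram.

Lemma l2_taylor (R : realType) (f : nat -> R[i] -> R[i]) (S : R[i] -> R) (M : R) (K : nat) :
  0 <= M -> (forall j z, normc z < 8 -> exists a, cdiff (f j) z a) ->
  (forall z, normc z <= 1 -> rsum (fun j => normc (f j z) ^+ 2) (S z)) ->
  (forall z, normc z <= 1 -> S z <= M ^+ 2) ->
  exists (p : nat -> {poly R[i]}) (B : {poly {poly R[i]}}),
  [/\ forall j, bigO K.+1 (fun t => f j t - (p j).[t]),
      jet K.+1 (fun z => (S z)%:C) B &
      forall k l, csum (fun j => (p j)`_k * ((p j)`_l)^J) (cf B k l)].
Proof.
move=> M0 fd fS SM.
have [p pP] := choice (coord_taylor K M0 fd fS SM).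
have [B [jB BP]] := gram_jet M0 fd fS SM (fun j => (pP j).1) (fun j => (pP j).2).
exists p, B; split=> // j; exists (4 * M), 2^-1; split; first by rewrite invr_gt0.
by move=> t /ltW; exact: (pP j).2.
Qed.

(** * Positivity and rank *)

Section psd_cone.
Variable R : realType.
Local Notation C := R[i].
Local Notation bipoly := {poly {poly C}}.
Implicit Types (A B : bipoly) (p : nat -> C) (g h : {poly C}).

Definition pfun m p g := \sum_(k < m) p k * g`_k.

(** The value at [p] of the form given by the coefficient matrix of [A]. *)
Definition lam m p A := \sum_(l < m) \sum_(k < m) p k * (p l)^J * cf A k l.

Lemma lamD m p A B : lam m p (A + B) = lam m p A + lam m p B.
Proof.
rewrite /lam -big_split; apply: eq_bigr => l _; rewrite -big_split.
by apply: eq_bigr => k _; rewrite cfD mulrDr.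
Qed.

Lemma lamZ m p c A : lam m p (c%:P%:P * A) = c * lam m p A.
Proof.
rewrite /lam mulr_sumr; apply: eq_bigr => l _; rewrite mulr_sumr.
by apply: eq_bigr => k _; rewrite cfC; ring.
Qed.

Lemma lamN m p A : lam m p (- A) = - lam m p A.
Proof.
by rewrite -[RHS]mulN1r -lamZ !polyCN !polyC1 mulN1r.
Qed.

Lemma lam0 m p : lam m p 0 = 0.
Proof. by rewrite -[X in lam _ _ X](mul0r 1) -!polyC0 lamZ mul0r. Qed.

Lemma lam_sum m p (I : Type) (s : seq I) (P : pred I) (F : I -> bipoly) :
  lam m p (\sum_(i <- s | P i) F i) = \sum_(i <- s | P i) lam m p (F i).
Proof.
by elim/big_rec2: _ => [|i y1 y2 _ <-]; [exact: lam0|rewrite lamD].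
Qed.

Lemma lam_ext m p A B :
  (forall k l, (k < m)%N -> (l < m)%N -> p k != 0 -> p l != 0 -> cf A k l = cf B k l) ->
  lam m p A = lam m p B.
Proof.
move=> AB; apply: eq_bigr => l _; apply: eq_bigr => k _.
have [->|pk] := eqVneq (p k) 0; first by rewrite !mul0r.
have [->|pl] := eqVneq (p l) 0; first by rewrite conjc0 mulr0 !mul0r.
by rewrite AB.
Qed.

Lemma cf_rank1 g h k l : cf (hol g * ahol h) k l = g`_k * (h`_l)^J.
Proof. by rewrite /cf /hol coefCM aholE coef_map /= coefMC. Qed.

Lemma lam_rank1 m p g h : lam m p (hol g * ahol h) = pfun m p g * (pfun m p h)^J.
Proof.
rewrite /lam /pfun conjc_sum mulr_sumr; apply: eq_bigr => l _.
rewrite mulr_suml; apply: eq_bigr => k _; rewrite cf_rank1 conjcM; ring.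
Qed.

Definition psd A := forall m p, 0 <= lam m p A.
(** Multipliers preserving positivity rather than positive elements: closure under products is then
    immediate, and [B = 1] gives back positivity. *)
Definition cone A := forall B, psd B -> psd (A * B).

Lemma mulJ_ge0 (x : C) : 0 <= x * x^J.
Proof. by rewrite -normc_sqE ler0c sqr_ge0. Qed.

Lemma psd_rank1 g : psd (hol g * ahol g).
Proof. by move=> m p; rewrite lam_rank1 mulJ_ge0. Qed.

Lemma psd1 : psd 1.
Proof.
have := psd_rank1 1; rewrite /hol (_ : ahol 1 = 1) ?mulr1//.
by rewrite aholE rmorph1.
Qed.

Lemma cone_psd A : cone A -> psd A.
Proof. by move=> /(_ 1 psd1); rewrite mulr1. Qed.

Lemma bipoly_cf B : exists d, (forall k l, (d <= k)%N || (d <= l)%N -> cf B k l = 0) /\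
  B = \sum_(l < d) \sum_(k < d) (cf B k l)%:P%:P * (hol 'X^k * ahol 'X^l).
Proof.
have [d [dP _]] := ev_cf B; exists d; split=> //.
have cfX i j k l : @cf R (hol 'X^i * ahol 'X^j) k l = ((k == i) && (l == j))%:R.
  by rewrite cf_rank1 !coefXn conjc_nat -natrM mulnb.
apply/polyP => l; apply/polyP => k; rewrite -!/(cf _ k l) cf_sum.
have [kd|dk] := ltnP k d; last first.
  rewrite dP ?dk// big1// => j _; rewrite cf_sum big1// => i _.
  by rewrite cfC cfX gtn_eqF ?mulr0// (leq_trans (ltn_ord i)).
have [ld|dl] := ltnP l d; last first.
  rewrite dP ?dl ?orbT// big1// => j _; rewrite cf_sum big1// => i _.
  by rewrite cfC cfX (gtn_eqF (leq_trans (ltn_ord j) dl)) andbF mulr0.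
rewrite (bigD1 (Ordinal ld))//= cf_sum (bigD1 (Ordinal kd))//= cfC cfX !eqxx mulr1.
rewrite big1 => [|i ik]; last first.
  rewrite cfC cfX (_ : (k == i) = false) ?mulr0//.
  by apply/negbTE; apply: contra ik => /eqP h; apply/eqP/val_inj.
rewrite addr0 big1 ?addr0// => j jl; rewrite cf_sum big1// => i _.
rewrite cfC cfX (_ : (l == j) = false) ?andbF ?mulr0//.
by apply/negbTE; apply: contra jl => /eqP h; apply/eqP/val_inj.
Qed.

(** Multiplication by [g] is transposed onto the vector: the form of [hol g * ahol g * B] at [p] is
    the form of [B] at the vector of pairings of [p] with the [g * 'X^a]. *)
Lemma cone_rank1 g : cone (hol g * ahol g).
Proof.
move=> B psdB m p; have [d [_ BE]] := bipoly_cf B.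
have -> : lam m p (hol g * ahol g * B) = lam d (fun a => pfun m p (g * 'X^a)) B.
  rewrite [in LHS]BE mulr_sumr lam_sum /lam -/(lam _ _ _); apply: eq_bigr => l _.
  rewrite mulr_sumr -/(lam m p _) lam_sum; apply: eq_bigr => k _.
  have -> : hol g * ahol g * ((cf B k l)%:P%:P * (hol 'X^k * ahol 'X^l)) =
     (cf B k l)%:P%:P * (hol (g * 'X^k) * ahol (g * 'X^l)).
    by rewrite holM aholM; ring.
  by rewrite lamZ lam_rank1; ring.
exact: psdB.
Qed.

Lemma psdD A B : psd A -> psd B -> psd (A + B).
Proof. by move=> hA hB m p; rewrite lamD addr_ge0. Qed.

Lemma coneD A B : cone A -> cone B -> cone (A + B).
Proof. by move=> hA hB X hX; rewrite mulrDl; apply: psdD; [exact: hA|exact: hB]. Qed.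

Lemma coneM A B : cone A -> cone B -> cone (A * B).
Proof. by move=> hA hB X hX; rewrite -mulrA; apply: hA; exact: hB. Qed.

Lemma cone0 : cone 0.
Proof. by move=> B _ m p; rewrite mul0r lam0. Qed.

Lemma cone1 : cone 1. Proof. by move=> B; rewrite mul1r. Qed.

Lemma coneZ (c : R) A : 0 <= c -> cone A -> cone ((c%:C)%:P%:P * A).
Proof.
move=> c0 hA B hB m p; rewrite -mulrA lamZ mulr_ge0//; first by rewrite ler0c.
exact: hA.
Qed.

Lemma coneX A n : cone A -> cone (A ^+ n).
Proof. by move=> hA; elim: n => [|n IH]; rewrite ?exprS; [exact: cone1|exact: coneM]. Qed.

Lemma cone_sum (I : Type) (s : seq I) (P : pred I) (F : I -> bipoly) :
  (forall i, P i -> cone (F i)) -> cone (\sum_(i <- s | P i) F i).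
Proof. by move=> H; elim/big_ind: _ => //; [exact: cone0|exact: coneD]. Qed.

Lemma cone_jcomp (q : {poly R}) A : (forall k, 0 <= q`_k) -> cone A -> cone (jcomp q A).
Proof. by move=> q0 hA; apply: cone_sum => i _; apply: coneZ => //; exact: coneX. Qed.

Lemma csum_ge0 (a : nat -> C) s : (forall j, 0 <= a j) -> csum a s -> 0 <= s.
Proof.
move=> a0 sa; have aR n : exists2 r : R, 0 <= r & \sum_(j < n) a j = r%:C.
  have h : 0 <= \sum_(j < n) a j by apply: sumr_ge0.
  exists (complex.Re (\sum_(j < n) a j)); first by move: h; rewrite lecE => /andP[].
  by apply: complex_ext => //=; move: h; rewrite lecE => /andP[/eqP -> _].
rewrite lecE; apply/andP; split.
  rewrite -normr_eq0 eq_le normr_ge0 andbT; apply/ler_addgt0Pl => e e0; rewrite addr0.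
  have [N /(_ N (leqnn _))] := sa e e0; have [r _ ->] := aR N; move=> h.
  by apply: le_trans h; apply: le_trans (normc_Im _); rewrite ImD ImN /= add0r normrN.
rewrite -[leLHS]/(0 : R); apply/ler_addgt0Pl => e e0.
have [N /(_ N (leqnn _))] := sa e e0; have [r r0 ->] := aR N; move=> h.
have := le_trans (normc_Re _) h; rewrite ReD ReN /= ler_norml; lra.
Qed.

Lemma csum_shift (a : nat -> C) s n : csum a s ->
  csum (fun j => if (j < n)%N then 0 else a j) (s - \sum_(j < n) a j).
Proof.
move=> sa e e0; have [N NP] := sa e e0; exists (maxn N n) => m.
rewrite geq_max => /andP[Nm nm]; have := NP m Nm.
congr (normc _ <= _).
suff -> : \sum_(j < m) (if (j < n)%N then 0 else a j) = \sum_(j < m) a j - \sum_(j < n) a j by ring.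
rewrite -(big_mkord xpredT a) -(big_mkord xpredT a).
rewrite -(big_mkord xpredT (fun j => if (j < n)%N then 0 else a j)).
rewrite (big_cat_nat (leq0n n) nm)//= [X in X + _]big_nat_cond [X in X + _]big1; last first.
  by move=> j /andP[/andP[_ ->] _].
rewrite add0r [X in X - _](big_cat_nat (leq0n n) nm)//= addrAC subrr add0r.
by apply: eq_big_nat => j /andP[nj _]; rewrite ltnNge nj.
Qed.

Lemma csum_term_le (a : nat -> C) s n : (forall j, 0 <= a j) -> csum a s -> a n <= s.
Proof.
move=> a0 sa; have := csum_shift n.+1 sa => /csum_ge0 h.
have {}h : 0 <= s - \sum_(j < n.+1) a j by apply: h => j; case: ifP.
apply: (@le_trans _ _ (\sum_(j < n.+1) a j)); last by rewrite -subr_ge0.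
by rewrite big_ord_recr /= lerDr sumr_ge0.
Qed.

Lemma csum_lam m p (G : nat -> bipoly) A B :
  (forall k l, csum (fun j => cf (G j) k l) (cf A k l)) ->
  csum (fun j => lam m p (G j * B)) (lam m p (A * B)).
Proof.
move=> GA.
apply: csum_big => l _; apply: csum_big => k _; apply: csumZ.
rewrite cfM; apply: (@eq_csum R (fun j => \sum_(b < l.+1) \sum_(a < k.+1)
   cf B (k - a) (l - b) * cf (G j) a b)).
  by move=> j; rewrite cfM; apply: eq_bigr => b _; apply: eq_bigr => a _; rewrite mulrC.
apply: csum_big => b _.
rewrite (eq_bigr (fun a : 'I_k.+1 => cf B (k - a) (l - b) * cf A a b)); last first.
  by move=> a _; rewrite mulrC.
by apply: csum_big => a _; apply: csumZ.
Qed.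

Lemma cone_lim (G : nat -> bipoly) A : (forall j, cone (G j)) ->
  (forall k l, csum (fun j => cf (G j) k l) (cf A k l)) -> cone A.
Proof.
move=> hG GA B hB m p; apply: csum_ge0 (csum_lam m p B GA) => j.
by apply: hG.
Qed.

(** A convergent series of nonnegative terms dominates each of them. This is how a single coordinate
    of the immersion is extracted from its squared norm. *)
Lemma cone_lim_term (G : nat -> bipoly) A n : (forall j, cone (G j)) ->
  (forall k l, csum (fun j => cf (G j) k l) (cf A k l)) -> cone (A - G n).
Proof.
move=> hG GA B hB m p; rewrite mulrBl lamD lamN subr_ge0.
by apply: (csum_term_le n (a := fun j => lam m p (G j * B))) (csum_lam m p B GA) => j; apply: hG.
Qed.

End psd_cone.

(** * The negative binomial series *)

Section negative_binomial.
Variable R : realType.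
Local Notation C := R[i].
Variable x : R.
Hypotheses (x0 : 0 <= x) (x1 : x < 1).

(** Division of a series by [1 - x]: the [P n] tend to [p] from below, and the boundary term
    [x * t n] tends to 0 because the nonnegative series of the [t j] converges. *)
Lemma rsum_telescope (t : nat -> R) (P : nat -> R) (p : R) : (forall j, 0 <= t j) ->
  (forall n, P n <= p) ->
  (forall e, 0 < e -> exists N, forall n, (N <= n)%N -> p - e <= P n) ->
  (forall n, (1 - x) * (\sum_(j < n.+1) t j) = P n - x * t n) ->
  rsum t (p / (1 - x)).
Proof.
move=> t0 Pp Plim tel; have y0 : 0 < 1 - x by rewrite subr_gt0.
have [|s [rs _]] := @rsum_bounded R t (p / (1 - x)) t0.
  move=> n; apply: (@le_trans _ _ (\sum_(j < n.+1) t j)); first by rewrite big_ord_recr lerDl.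
  rewrite ler_pdivlMr// mulrC tel; apply: le_trans (Pp n).
  by rewrite gerBl mulr_ge0.
suff <- : s = p / (1 - x) by [].
have [sT slim] := rs.
apply: (canRL (mulfK _)); first by rewrite gt_eqF.
apply/eqP; rewrite eq_le; apply/andP; split; apply/ler_addgt0Pl => e e0.
  have [N NP] := slim e e0.
  have h1 := NP N.+1 (leqnSn N); have h2 := tel N; have h3 := Pp N; have h4 := t0 N.
  have : 0 <= x * t N by rewrite mulr_ge0.
  have : (1 - x) * (s - e) <= (1 - x) * \sum_(j < N.+1) t j by rewrite ler_pM2l.
  have : (1 - x) * e <= e by have := mulr_ge0 x0 (ltW e0); lra.
  rewrite [s * _]mulrC; lra.
have e2 : 0 < e / 2 by rewrite divr_gt0.
have [N NP] := slim _ e2; have [N' N'P] := Plim _ e2.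
pose n := maxn N N'; have h1 := NP n (leq_maxl _ _); have h2 := N'P n (leq_maxr _ _).
have h3 := tel n; have h4 := sT n.+1; rewrite big_ord_recr /= in h3 h4.
have h5 : t n <= e / 2 by lra.
have h6 : (1 - x) * (\sum_(i < n) t i + t n) <= (1 - x) * s by rewrite ler_pM2l.
have h7 : x * t n <= e / 2.
  by apply: le_trans h5; rewrite ler_piMl// ltW.
rewrite [s * _]mulrC; lra.
Qed.

(** The truncated exponent for [k < r] is harmless, as the binomial coefficient is then 0. *)
Definition binterm r k : R := 'C(k, r)%:R * x ^+ (k - r).

Lemma binterm_ge0 r k : 0 <= binterm r k.
Proof. by rewrite mulr_ge0 ?ler0n// exprn_ge0. Qed.

Lemma negbin_rsum r : rsum (binterm r) ((1 - x) ^- r.+1).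
Proof.
elim: r => [|r IH].
  have -> : (1 - x) ^- 1 = 1 / (1 - x) by rewrite expr1 mul1r.
  apply: (@rsum_telescope _ (fun=> 1)) => //.
  - exact: binterm_ge0.
  - by move=> e e0; exists 0%N => n _; rewrite gerBl ltW.
  elim=> [|n IH]; first by rewrite big_ord_recr big_ord0 /= /binterm bin0 subn0 expr0; ring.
  by rewrite big_ord_recr /= mulrDr IH /binterm !bin0 !subn0 exprS; ring.
have -> : (1 - x) ^- r.+2 = (1 - x) ^- r.+1 / (1 - x) by rewrite [in LHS]exprS invfM mulrC.
have [IH1 IH2] := IH.
apply: (@rsum_telescope _ (fun n => \sum_(j < n) binterm r j)) => //.
  exact: binterm_ge0.
have rec n : binterm r.+1 n.+1 = binterm r n + x * binterm r.+1 n.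
  rewrite /binterm binS natrD mulrDl addrC subSS; congr (_ + _).
  have [rn|nr] := ltnP r n; first by rewrite mulrCA -exprS -subSn// subSS.
  by rewrite bin_small// !mul0r mulr0.
elim=> [|n IHn]; first by rewrite big_ord_recr !big_ord0 /= /binterm bin0n /=; ring.
by rewrite big_ord_recr /= mulrDr IHn big_ord_recr /= rec; ring.
Qed.

Lemma rsum_csum (a : nat -> R) s : rsum a s -> csum (fun j => (a j)%:C) s%:C.
Proof.
move=> [h1 h2] e e0; have [N NP] := h2 e e0; exists N => k kN.
rewrite -real_complex_sum -rmorphB normc_real ler_norml.
by have := NP k kN; have := h1 k => h h'; apply/andP; split; lra.
Qed.

End negative_binomial.

(** * The rank argument *)

Section core.
Variable R : realType.
Local Notation C := R[i].
Local Notation bipoly := {poly {poly C}}.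

Lemma cf_pow_low (B : bipoly) i k l : cf B 0 0 = 0 -> (k + l < i)%N -> cf (B ^+ i) k l = 0.
Proof.
move=> B0; elim: i k l => // i IH k l kl; rewrite exprS cfM big1// => b _; rewrite big1// => a _.
have := ltn_ord a; have := ltn_ord b => hb ha.
have [h|h] := eqVneq (a + b)%N 0%N.
  have [-> ->] : (a : nat) = 0%N /\ (b : nat) = 0%N by lia.
  by rewrite B0 mul0r.
by rewrite IH ?mulr0//; lia.
Qed.

Lemma jcomp_wide (p : {poly R}) A n : (size p <= n)%N ->
  jcomp p A = \sum_(m < n) ((p`_m)%:C)%:P%:P * A ^+ m.
Proof.
move=> pn; rewrite /jcomp -(big_mkord xpredT (fun m => ((p`_m)%:C)%:P%:P * A ^+ m)).
rewrite -(big_mkord xpredT (fun m => ((p`_m)%:C)%:P%:P * A ^+ m)).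
rewrite (big_cat_nat (leq0n _) pn)//= [X in _ + X]big_nat_cond [X in _ + X]big1 ?addr0//.
by move=> m /andP[/andP[pm _] _]; rewrite nth_default// !polyC0 mul0r.
Qed.

Lemma sum_cut (V : nmodType) (F : nat -> V) a b : (forall r, (a <= r)%N -> F r = 0) ->
  (forall r, (b <= r)%N -> F r = 0) -> \sum_(r < a) F r = \sum_(r < b) F r.
Proof.
wlog ab : a b / (a <= b)%N.
  by move=> H Fa Fb; have [|/ltnW] := leqP a b => h; [|symmetry]; apply: H.
move=> Fa _; rewrite -(big_mkord xpredT F) -(big_mkord xpredT F).
rewrite (big_cat_nat (leq0n _) ab)//= [X in _ + X]big_nat_cond [X in _ + X]big1 ?addr0//.
by move=> r /andP[/andP[ar _] _]; exact: Fa.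
Qed.

(** Since [X] has constant term [x], every power of [X] contributes to each coefficient. Expanded in
    powers of [X' = X - x], only exponents [i] with [0 < i < N] are seen by [lam], and the
    coefficient of each is summed over [k] by the negative binomial series. Up to a constant, which
    [p 0 = 0] kills, this compares the expansions of [- ln (1 - X)] at [x] and at 0. *)
Lemma lam_ln (m : nat) (p : nat -> C) (N : nat) (X : bipoly) (x : R) :
  p 0%N = 0 -> (forall k l, (k < m)%N -> (l < m)%N -> (k + l < N)%N) ->
  0 <= x < 1 -> cf X 0 0 = x%:C ->
  csum (fun k => lam m p (X ^+ k.+1) / k.+1%:R)
    (lam m p (jcomp (ln_poly R N) (((1 - x)^-1)%:C%:P%:P * (X - (x%:C)%:P%:P)))).
Proof.
move=> p0 mN /andP[x0 x1] X0; pose X' := X - (x%:C)%:P%:P.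
have X'0 : cf X' 0 0 = 0 by rewrite cfD cfN X0 /cf !coefC subrr.
pose L i := lam m p (X' ^+ i).
have L0 : L 0%N = 0.
  have E1 : X' ^+ 0 = hol 1%:P by rewrite expr0 /hol !polyC1.
  rewrite /L E1 /lam big1// => l _; rewrite big1// => k _; rewrite cf_hol coefC.
  have [k0|_] := eqVneq (k : nat) 0%N; last by case: ifP => _; rewrite mulr0.
  by rewrite k0 p0 !mul0r.
have LN i : (N <= i)%N -> L i = 0.
  move=> Ni; rewrite /L /lam big1// => l _; rewrite big1// => k _.
  by rewrite cf_pow_low ?mulr0//; exact: leq_trans (mN _ _ (ltn_ord k) (ltn_ord l)) Ni.
have sln : (size (ln_poly R N) <= N.+1)%N by apply: leq_trans (size_poly _ _) _.
have -> : lam m p (jcomp (ln_poly R N) (((1 - x)^-1)%:C%:P%:P * X')) =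
    \sum_(r < N) L r.+1 / r.+1%:R * ((1 - x) ^- r.+1)%:C.
  rewrite (jcomp_wide _ sln) big_ord_recl lamD lam_sum expr0.
  rewrite lamZ -(expr0 X') -/(L 0%N) L0 mulr0 add0r; apply: eq_bigr => r _.
  rewrite lamZ /= /bump /= add1n exprMn -!polyC_exp lamZ -/(L r.+1) coef_poly.
  case: ltnP => rN; last by rewrite LN// !mulr0 !mul0r.
  by rewrite -real_complexX exprVn fmorphV rmorph_nat; ring.
have E k : lam m p (X ^+ k.+1) / k.+1%:R = \sum_(r < N) (L r.+1 / r.+1%:R) * (binterm x r k)%:C.
  have -> : X ^+ k.+1 = \sum_(i < k.+2) (('C(k.+1, i)%:R * x ^+ (k.+1 - i))%:C)%:P%:P * X' ^+ i.
    have -> : X = (x%:C)%:P%:P + X' by rewrite /X' addrC subrK.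
    rewrite exprDn; apply: eq_bigr => i _.
    by rewrite real_complexM rmorph_nat real_complexX !polyCM !polyC_exp !polyC_natr mulr_natl mulrnAl.
  rewrite lam_sum big_ord_recl lamZ -/(L 0%N) L0 mulr0 add0r mulr_suml.
  rewrite (eq_bigr (fun r : 'I_k.+1 => (L r.+1 / r.+1%:R) * (binterm x r k)%:C)); last first.
    move=> r _; rewrite lamZ /= /bump /= add1n subSS -/(L r.+1) /binterm !real_complexM !rmorph_nat.
    have k0 : k.+1%:R != 0 :> C by rewrite pnatr_eq0.
    have r0 : r.+1%:R != 0 :> C by rewrite pnatr_eq0.
    have := mul_bin_diag k.+1 r => /(congr1 (fun n => n%:R : C)); rewrite !natrM /= => H.
    have -> : 'C(k.+1, r.+1)%:R = k.+1%:R * 'C(k, r)%:R / r.+1%:R :> C by rewrite H mulrC mulKf.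
    by field; rewrite !nat1r k0 r0.
  apply: (@sum_cut _ (fun r => L r.+1 / r.+1%:R * (binterm x r k)%:C)) => r hr.
    by rewrite /binterm bin_small// mul0r mulr0.
  by rewrite LN ?mul0r// leqW.
apply: (@eq_csum R _ _ _ (fun k => esym (E k))).
apply: csum_big => r _; apply: csumZ; apply: rsum_csum.
exact: negbin_rsum.
Qed.

Implicit Types (g h : {poly C}) (p : nat -> C).

Lemma pfun_sum m p (I : Type) (s : seq I) (P : pred I) (F : I -> {poly C}) :
  pfun m p (\sum_(i <- s | P i) F i) = \sum_(i <- s | P i) pfun m p (F i).
Proof.
rewrite /pfun (eq_bigr (fun k : 'I_m => \sum_(i <- s | P i) p k * (F i)`_k)).
  by rewrite exchange_big.
by move=> k _; rewrite coef_sum mulr_sumr.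
Qed.

Lemma pfunZ m p c g : pfun m p (c *: g) = c * pfun m p g.
Proof. by rewrite /pfun mulr_sumr; apply: eq_bigr => k _; rewrite coefZ; ring. Qed.

(** Degrees below [t] are absent from the polynomial and those above [t] from [p]. *)
Lemma pfun_top m p t h : (t < m)%N -> (forall k, (t < k < m)%N -> p k = 0) ->
  pfun m p ('X^t * h) = p t * h`_0.
Proof.
move=> tm pk; rewrite /pfun (bigD1 (Ordinal tm))//= coefXnM ltnn subnn big1 ?addr0// => k kt.
have [kt'|tk] := ltnP k t; first by rewrite coefXnM kt' mulr0.
rewrite pk ?mul0r//; apply/andP; split; last exact: ltn_ord k.
rewrite ltn_neqAle tk andbT eq_sym.
by apply: contra kt => /eqP h1; apply/eqP/val_inj.
Qed.

Lemma polyX_factor g : g`_0 = 0 -> exists h, g = 'X * h /\ h`_0 = g`_1.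
Proof.
move=> g0; exists (drop_poly 1 g); split; last by rewrite coef_drop_poly.
by apply/polyP => -[|k]; rewrite coefXM /= ?g0// coef_drop_poly addn1.
Qed.

(** The unknowns are the [n + 1] entries of [p] in degrees [1] to [n + 1], against [n] equations;
    [t] is the last degree where [p] is nonzero. *)
Lemma kernel_vector n (F : 'I_n -> {poly C}) : exists p t, [/\ p 0%N = 0,
  (0 < t < n.+2)%N, p t != 0, (forall k, (t < k < n.+2)%N -> p k = 0) &
  forall j, pfun n.+2 p (F j) = 0].
Proof.
pose A : 'M[C]_(n.+1, n) := \matrix_(k, j) (F j)`_k.+1.
have : kermx A != 0.
  rewrite -mxrank_eq0 mxrank_ker -lt0n subn_gt0; exact: leq_ltn_trans (rank_leq_col A) _.
case/rowV0Pn => v /sub_kermxP vA v0.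
pose p k : C := if k is k'.+1 then (if insub k' is Some i then v 0 (i : 'I_n.+1) else 0) else 0.
have pE (i : 'I_n.+1) : p i.+1 = v 0 i.
  by rewrite /p /=; case: insubP => [j _ /val_inj ->//|]; rewrite ltn_ord.
have ex : exists t, (0 < t < n.+2)%N && (p t != 0).
  have [i vi] : exists i, v 0 i != 0.
    by apply/existsP; apply: contraR v0 => /existsPn h; apply/eqP/rowP => i; rewrite mxE; apply/eqP/negPn/h.
  by exists i.+1; rewrite pE vi andbT /=; exact: ltn_ord i.
have ub t : (0 < t < n.+2)%N && (p t != 0) -> (t <= n.+1)%N by case/andP => /andP[_].
have [t /andP[/andP[t0 tn] pt] tmax] := ex_maxnP ex ub.
exists p, t; split=> //; first by rewrite t0.
  move=> k /andP[tk kn]; apply/eqP; apply: contraLR tk => pk; rewrite -leqNgt.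
  by apply: tmax; rewrite kn pk !andbT lt0n; apply: contra pk => /eqP ->.
move=> j; rewrite /pfun big_ord_recl mul0r add0r.
have := congr1 (fun M : 'rV[C]_n => M 0 j) vA; rewrite mxE [RHS]mxE => H; rewrite -[RHS]H.
by apply: eq_bigr => k _; rewrite mxE /= /bump add1n -pE.
Qed.

(** Here [E] stands for the truncation of [e^q] and [x] for the value of [X] at the base point. The
    last hypothesis says that the curve does not degenerate: either the component in the base moves
    and some [xi i * E] is nonzero, or some [xi i * E] moves. *)
Theorem rank_contradiction (n d0 : nat) (F : 'I_n -> {poly C}) (xi : 'I_d0 -> {poly C})
    (f : nat -> {poly C}) (A : bipoly) (E : {poly C}) (c x : R) :
  let N := (2 * n).+3 in
  let X := (\sum_i hol (xi i) * ahol (xi i)) *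
    ((c%:C)%:P%:P * (hol E * ahol E) * jcomp (exp_poly R N) A) in
  0 < c -> 0 <= x < 1 -> (forall j, (f j)`_0 = 0) ->
  (forall k l, csum (fun j => (f j)`_k * ((f j)`_l)^J) (cf A k l)) ->
  cf X 0 0 = x%:C ->
  (forall k l, (0 < k)%N -> (0 < l)%N -> (k + l < N)%N ->
    cf (jcomp (ln_poly R N) (((1 - x)^-1)%:C%:P%:P * (X - (x%:C)%:P%:P))) k l + cf A k l =
    \sum_j (F j)`_k * ((F j)`_l)^J) ->
  (exists i j, (xi i * E)`_0 != 0 /\ (f j)`_1 != 0) \/ (exists i, (xi i * E)`_1 != 0) ->
  False.
Proof.
move=> N X c0 x01 f0 fA X0 H alt.
have [p [t [p0 /andP[t0 tn] pt ptop pF]]] := kernel_vector F.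
pose m := n.+2.
have mN k l : (k < m)%N -> (l < m)%N -> (k + l < N)%N by rewrite /m /N; lia.
have coneE j : cone (hol (f j) * ahol (f j)) by exact: cone_rank1.
have cfE k l : csum (fun j => cf (hol (f j) * ahol (f j)) k l) (cf A k l).
  by apply: eq_csum (fA k l) => j; rewrite cf_rank1.
have coneA : cone A := cone_lim coneE cfE.
have exp0 k : 0 <= (exp_poly R N)`_k.
  by rewrite coef_poly; case: ifP => // _; rewrite invr_ge0 ler0n.
have coneEA : cone (jcomp (exp_poly R N) A) by exact: cone_jcomp.
have coneW i : cone (hol (xi i) * ahol (xi i)) by exact: cone_rank1.
have coneX1 : cone X.
  apply: coneM; first exact: cone_sum.
  by apply: coneM => //; apply: coneZ; [exact: ltW|exact: cone_rank1].
have coneXk k : cone (X ^+ k) := coneX k coneX1.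
set L := jcomp (ln_poly R N) _ in H.
have Lsum : csum (fun k => lam m p (X ^+ k.+1) / k.+1%:R) (lam m p L).
  exact: lam_ln.
have term0 k : 0 <= lam m p (X ^+ k.+1) / k.+1%:R.
  by rewrite divr_ge0 ?ler0n//; apply: cone_psd.
(* On the right is the Gram matrix of the [F j], annihilated by [p]. The coefficients with [k = 0]
   or [l = 0], not covered by [H], are hidden by [p 0 = 0]. Two nonnegative numbers with sum 0
   vanish, and so does each term of the series for [L]. *)
have sum0 : lam m p L + lam m p A = 0.
  rewrite -lamD (_ : lam m p (L + A) = lam m p (\sum_j hol (F j) * ahol (F j))).
    by rewrite lam_sum big1// => j _; rewrite lam_rank1 pF mul0r.
  apply: lam_ext => k l km lm pk pl; rewrite cfD [RHS]cf_sum H ?mN//.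
  - by apply: eq_bigr => j _; rewrite cf_rank1.
  - by rewrite lt0n; apply: contra pk => /eqP ->; rewrite p0.
  - by rewrite lt0n; apply: contra pl => /eqP ->; rewrite p0.
have A0 : 0 <= lam m p A by exact: cone_psd.
have L0 : 0 <= lam m p L by exact: csum_ge0 term0 Lsum.
have Lz : lam m p L = 0.
  by apply/eqP; rewrite eq_le L0 andbT -sum0 lerDl.
have Xk0 k : lam m p (X ^+ k.+1) = 0.
  have := csum_term_le k term0 Lsum; rewrite Lz => h; apply/eqP; rewrite eq_le.
  rewrite (cone_psd (coneXk k.+1)) andbT.
  by move: h; rewrite ler_pdivrMr ?ltr0n// mul0r.
(* A positive multiple of the squared modulus of [pfun m p g] is squeezed between 0 and
   [lam m p (X ^+ k.+1) = 0]. *)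
have zero (g : {poly C}) (a : R) k : 0 < a ->
    cone (X ^+ k.+1 - (a%:C)%:P%:P * (hol g * ahol g)) -> pfun m p g = 0.
  move=> a0 /cone_psd /(_ m p); rewrite lamD lamN lamZ Xk0 add0r lam_rank1 oppr_ge0.
  rewrite -normc_sqE -real_complexM lecR pmulr_rle0// => h.
  by apply: eq0_normc; apply/eqP; rewrite -sqrf_eq0 eq_le h sqr_ge0.
have sexp : (size (exp_poly R N) <= N)%N by exact: size_poly.
have coneXi i : cone (\sum_i hol (xi i) * ahol (xi i) - hol (xi i) * ahol (xi i)).
  by rewrite (bigD1 i)//= addrAC subrr add0r; exact: cone_sum.
(* The exponential polynomial dominates its term of degree [k], and [A ^+ k] dominates the power of
   its [j]-th summand, by a telescoping factorization. *)
have coneEm k j : (k < N)%N -> cone (jcomp (exp_poly R N) A -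
    ((k`!%:R^-1 : R)%:C)%:P%:P * (hol (f j) * ahol (f j)) ^+ k).
  move=> kN; rewrite (jcomp_wide _ sexp) (bigD1 (Ordinal kN))//= coef_poly kN.
  rewrite addrAC; apply: coneD; last first.
    by apply: cone_sum => i _; apply: coneZ => //; exact: coneX.
  rewrite -mulrBr; apply: coneZ; first by rewrite invr_ge0 ler0n.
  have powB : forall r, cone (A ^+ r - (hol (f j) * ahol (f j)) ^+ r).
    elim=> [|r IH]; first by rewrite !expr0 subrr; exact: cone0.
    have -> : A ^+ r.+1 - (hol (f j) * ahol (f j)) ^+ r.+1 =
       (A - hol (f j) * ahol (f j)) * A ^+ r + (hol (f j) * ahol (f j)) * (A ^+ r - (hol (f j) * ahol (f j)) ^+ r).
      by rewrite !exprS; ring.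
    apply: coneD; apply: coneM => //; last exact: coneX.
    exact: (cone_lim_term j coneE cfE).
  exact: powB.
pose eta i := xi i * E.
(* the contribution of one coordinate of [xi] and one monomial in one
   coordinate of [f] *)
have coneT i j k : (k < N)%N -> cone (X - ((c * k`!%:R^-1)%:C)%:P%:P *
    (hol (eta i * f j ^+ k) * ahol (eta i * f j ^+ k))).
  move=> kN; pose W := \sum_i hol (xi i) * ahol (xi i); pose w := hol (xi i) * ahol (xi i).
  pose G := jcomp (exp_poly R N) A; pose e := (hol (f j) * ahol (f j)) ^+ k.
  have -> : X - ((c * k`!%:R^-1)%:C)%:P%:P * (hol (eta i * f j ^+ k) * ahol (eta i * f j ^+ k)) =
     (W - w) * ((c%:C)%:P%:P * (hol E * ahol E) * G) +
     w * ((c%:C)%:P%:P * ((hol E * ahol E) * (G - ((k`!%:R^-1 : R)%:C)%:P%:P * e))).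
    have hX (g : {poly C}) r : hol (g ^+ r) = hol g ^+ r by exact: polyC_exp.
    have aX (g : {poly C}) r : ahol (g ^+ r) = ahol g ^+ r by rewrite aholE rmorphXn.
    rewrite /X -/W -/G /w /e /eta !holM !aholM hX aX exprMn real_complexM !polyCM; ring.
  apply: coneD.
    apply: coneM; first exact: coneXi.
    by apply: coneM => //; apply: coneZ; [exact: ltW|exact: cone_rank1].
  apply: coneM; first exact: coneW.
  apply: coneZ; first exact: ltW.
  by apply: coneM; [exact: cone_rank1|exact: (coneEm k j kN)].
(* [X] dominates the rank-one term [T], which is [coneT] with exponent 0; domination passes to
   powers by telescoping. *)
have coneP i k : cone (X ^+ k - ((c ^+ k)%:C)%:P%:P * (hol (eta i ^+ k) * ahol (eta i ^+ k))).
  pose T := (c%:C)%:P%:P * (hol (eta i) * ahol (eta i)).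
  have coneT' : cone T by apply: coneZ; [exact: ltW|exact: cone_rank1].
  have XT : cone (X - T).
    have := coneT i 0%N 0%N isT; rewrite fact0 invr1 mulr1 expr0 mulr1; exact.
  have -> : ((c ^+ k)%:C)%:P%:P * (hol (eta i ^+ k) * ahol (eta i ^+ k)) = T ^+ k.
    have hX (g : {poly C}) r : hol (g ^+ r) = hol g ^+ r by exact: polyC_exp.
    have aX (g : {poly C}) r : ahol (g ^+ r) = ahol g ^+ r by rewrite aholE rmorphXn.
    by rewrite hX aX real_complexX !polyC_exp /T [RHS]exprMn [in RHS]exprMn.
  elim: k => [|k IH]; first by rewrite !expr0 subrr; exact: cone0.
  have -> : X ^+ k.+1 - T ^+ k.+1 = (X - T) * X ^+ k + T * (X ^+ k - T ^+ k).
    by rewrite !exprS; ring.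
  by apply: coneD; apply: coneM.
have tN : (t < N)%N by rewrite /N; lia.
case: alt => [[i [j [eta0 f1]]]|[i eta1]].
  (* [f j] has a simple zero, so [eta i * f j ^+ t] vanishes to order exactly [t] and its pairing
     with [p] is a nonzero multiple of [p t]. *)
  have [h [fE h0]] := polyX_factor (f0 j).
  have a0 : 0 < c * t`!%:R^-1 by rewrite mulr_gt0// invr_gt0 ltr0n fact_gt0.
  have := zero (eta i * f j ^+ t) _ 0%N a0; rewrite expr1 => /(_ (coneT i j t tN)).
  have -> : eta i * f j ^+ t = 'X^t * (eta i * h ^+ t) by rewrite fE exprMn; ring.
  rewrite (pfun_top _ tn ptop) => /eqP; rewrite mulf_eq0 (negPf pt) /=.
  rewrite -!horner_coef0 hornerM horner_exp !horner_coef0 h0 mulf_eq0 (negPf eta0) /=.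
  by rewrite expf_eq0 (negPf f1) andbF.
(* Now [eta i - e0] has a simple zero. Its [t]-th power is a combination of powers of [eta i]: the
   positive ones are annihilated through [coneP], the zeroth by [p 0 = 0]. *)
pose e0 := (eta i)`_0.
have [h [hE h0]] : exists h, eta i - e0%:P = 'X * h /\ h`_0 = (eta i)`_1.
  have [|h [h1 h2]] := @polyX_factor (eta i - e0%:P); first by rewrite coefB coefC subrr.
  by exists h; split=> //; rewrite h2 coefB coefC subr0.
have pk k : pfun m p (eta i ^+ k) = 0.
  case: k => [|k]; last by apply: zero (coneP i k.+1); rewrite exprn_gt0.
  rewrite expr0 /pfun big1// => k _; rewrite coef1.
  by have [->|_] := eqVneq (k : nat) 0%N; rewrite ?p0 ?mul0r// mulr0.
have : pfun m p ((eta i - e0%:P) ^+ t) = 0.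
  rewrite exprBn pfun_sum big1// => k _.
  have -> : (-1) ^+ k * eta i ^+ (t - k) * e0%:P ^+ k *+ 'C(t, k) =
     ((-1) ^+ k * e0 ^+ k * 'C(t, k)%:R) *: eta i ^+ (t - k).
    rewrite -mul_polyC !polyCM !polyC_exp polyC_natr polyCN polyC1 -mulr_natr; ring.
  by rewrite pfunZ pk mulr0.
rewrite hE exprMn (pfun_top _ tn ptop) => /eqP; rewrite mulf_eq0 (negPf pt) /=.
by rewrite -horner_coef0 horner_exp horner_coef0 h0 expf_eq0 (negPf eta1) andbF.
Qed.

End core.

(** * Kaehler forms along holomorphic curves *)

Section vector_norms.
Variable R : realType.
Local Notation C := R[i].

Lemma normE (z : C) : `|z| = (normc z)%:C.
Proof. by rewrite normc_def; case: z. Qed.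

Lemma mx_entry_le m n (h : 'M[C]_(m, n)) i j : `|h i j| <= `|h|.
Proof.
rewrite [leRHS]/Num.Def.normr /= mx_normE -[leLHS]nngE num_le.
exact: (le_bigmax _ (fun ij : 'I_m * 'I_n => `|h ij.1 ij.2|%:nng) (i, j)).
Qed.

Lemma mx_norm_lt m n (h : 'M[C]_(m, n)) e : 0 < e -> (forall i j, `|h i j| < e) -> `|h| < e.
Proof.
move=> e0 H; have [h0|] := eqVneq (mx_norm h) 0.
  by rewrite [ltLHS]/Num.Def.normr /= h0.
by move=> /mx_norm_neq0 [[i j] /= E]; rewrite [ltLHS]/Num.Def.normr /= E.
Qed.

Lemma near0_entries m (P : 'rV[C]_m -> Prop) : (\forall h \near (0 : 'rV[C]_m), P h) ->
  exists2 r : R, 0 < r & forall h : 'rV[C]_m, (forall j, normc (h 0 j) < r) -> P h.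
Proof.
move=> /nbhs_norm0P [e /= e0 eP]; have eE : e = (complex.Re e)%:C.
  by apply: complex_ext => //=; move: e0; rewrite ltcE => /andP[/eqP -> _].
exists (complex.Re e); first by move: e0; rewrite eE ltcR.
move=> h hP; apply: eP => /=; apply: mx_norm_lt => // i j.
by rewrite (ord1 i) normE eE ltcR.
Qed.

Lemma open_entries m (U : set 'rV[C]_m) x : open U -> U x ->
  exists2 r : R, 0 < r & forall h : 'rV[C]_m, (forall j, normc (h 0 j) < r) -> U (x + h).
Proof.
move=> oU Ux; have /nbhs_normP [e /= e0 eP] : nbhs x U by exact: open_nbhs_nbhs.
apply: near0_entries; apply/nbhs_norm0P; exists e => // h /= he; apply: eP => /=.
by rewrite opprD addrA subrr add0r normrN.
Qed.

End vector_norms.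

Section line_diff.
Variables (R : realType) (V W : normedModType R[i]).
Local Notation C := R[i].

(** [e] is any bounded linear functional, so that coordinates in [C^m] and in [l2] are treated
    alike. The proof divides by [|v| + 1] rather than by [|v|], which may be 0. *)
Lemma cdiff_line (F : V -> W) (x v : V) (t0 : C) (e : W -> C) :
  (forall a b, e (a + b) = e a + e b) -> (forall k a, e (k *: a) = k * e a) ->
  (forall a, (normc (e a))%:C <= `|a|) ->
  differentiable F (x + t0 *: v) ->
  cdiff (fun t => e (F (x + t *: v))) t0 (e ('d F (x + t0 *: v) v)).
Proof.
move=> eD eZ eb dF eps eps0.
have /diff_locally/eqaddoP H := dF.
have v1 : 0 < `|v| + 1 by rewrite ltr_wpDl.
have [w [w0 wE]] : exists w : R, 0 < w /\ `|v| + 1 = w%:C.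
  have : `|v| + 1 \is Num.real by rewrite realD ?normr_real.
  by move=> /complex_realP [k kE]; exists k; split=> //; move: v1; rewrite kE ltcR.
have ew0 : 0 < (eps / w)%:C :> C by rewrite ltcR divr_gt0.
have /nbhs_norm0P [r /= r0 rP] := H _ ew0.
have rE : r = (complex.Re r)%:C.
  by apply: complex_ext => //=; move: r0; rewrite ltcE => /andP[/eqP -> _].
exists (complex.Re r / w); first by apply: divr_gt0 => //; move: r0; rewrite rE ltcR.
move=> h hr.
have hv : `|h *: v| <= (normc h * w)%:C.
  by rewrite normrZ normE real_complexM ler_wpM2l ?lecR ?normc_ge0// -wE lerDl.
have /rP : `|h *: v| < r.
  by apply: le_lt_trans hv _; rewrite rE ltcR -ltr_pdivlMr.
rewrite /= !fctE /= => hP.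
rewrite -lecR.
have eB a b : e (a - b) = e a - e b by rewrite eD -scaleN1r eZ mulN1r.
rewrite (_ : _ - _ - _ = e (F (h *: v + (x + t0 *: v)) - (F (x + t0 *: v) + 'd F (x + t0 *: v) (h *: v)))); last first.
  have -> : 'd F (x + t0 *: v) (h *: v) = h *: 'd F (x + t0 *: v) v by exact: linearZ.
  rewrite eB eD eZ opprD addrA [_ * h]mulrC; congr (e (F _) - _ - _).
  by rewrite scalerDl addrA addrC.
have hP2 : (eps / w)%:C * `|h *: v| <= (eps / w)%:C * (normc h * w)%:C.
  by rewrite ler_wpM2l// ltW.
apply: le_trans (eb _) _; apply: le_trans hP _; apply: le_trans hP2 _.
by rewrite -!real_complexM lecR mulrA (mulrAC eps) mulfVK ?gt_eqF.
Qed.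

End line_diff.

(** * Second derivatives along real lines *)

Section twice_derivable.
Variable R : realType.
Local Notation C := R[i].

Lemma is_derive_epsV (f : R -> R) (x a : R) : is_derive x 1 f a ->
  forall e, 0 < e -> exists2 d, 0 < d & forall h, `|h| < d ->
    `|f (x + h) - f x - a * h| <= e * `|h|.
Proof.
case=> df <- e e0; have := df; rewrite /derivable => /cvg_ex [l lP].
have -> : 'D_1 f x = l by exact/cvg_lim.
move/cvgrPdist_le: lP => /(_ e e0); rewrite near_withinE => /nbhs_norm0P [d /= d0 dP].
exists d => // h hd; have [->|h0] := eqVneq h 0.
  by rewrite addr0 subrr mulr0 subrr !normr0 mulr0.
have := dP h hd h0; rewrite distrC /GRing.scale /= mulr1 [h + x]addrC.
have -> : h^-1 * (f (x + h) - f x) - l = (f (x + h) - f x - l * h) / h by field.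
by rewrite normrM normfV ler_pdivrMr ?normr_gt0.
Qed.

Lemma derive1_near (f g : R -> R) (d a : R) : 0 < d -> (forall t, `|t| < d -> f t = g t) ->
  is_derive (0 : R) 1 g a -> derive1 f 0 = a.
Proof.
move=> d0 fg ga; have [_ <-] : is_derive (0 : R) 1 f a; last by rewrite derive1E.
apply: near_eq_is_derive ga; apply/nbhs_norm0P; exists d => // t /= td.
by rewrite fg.
Qed.

Definition twice (g g1 : R -> R) (a : R) :=
  (exists2 d : R, 0 < d & forall t : R, `|t| < d -> is_derive t 1 g (g1 t)) /\ is_derive (0 : R) 1 g1 a.

(** The derivative of [g t + g (- t) - a t^2] is [g1 t - g1 (- t) - 2 a t], which is [o(t)];
    continuity of the second derivative is not involved. *)
Lemma twice_second (g g1 : R -> R) a : twice g g1 a -> forall e, 0 < e ->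
  exists2 d : R, 0 < d & forall r : R, 0 < r < d -> `|g r + g (- r) - 2 * g 0 - a * r ^+ 2| <= e * r ^+ 2.
Proof.
move=> [[d1 d10 gg1] g1a] e e0; have [|d2 d20 dP] := is_derive_epsV g1a (e := e / 2).
  by rewrite divr_gt0.
exists (Num.min d1 d2); first by rewrite lt_min d10.
move=> r /andP[r0]; rewrite lt_min => /andP[rd1 rd2].
pose G t := g t + g (- t) - a * t ^+ 2.
have -> : g r + g (- r) - 2 * g 0 - a * r ^+ 2 = G r - G 0 by rewrite /G oppr0; ring.
have -> : e * r ^+ 2 = e * r * (r - 0) by ring.
apply: (@mean_value_bound _ G (fun t => g1 t - g1 (- t) - 2 * a * t)); first exact: ltW.
  move=> t /andP[t0 tr].
  have g1t : is_derive t 1 g (g1 t) by apply: gg1; rewrite ger0_norm// (le_lt_trans tr).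
  have g2t : is_derive t 1 (g \o -%R) (- g1 (- t)).
    have : is_derive (- t) 1 g (g1 (- t)) by apply: gg1; rewrite normrN ger0_norm// (le_lt_trans tr).
    have N1 : is_derive t 1 (-%R : R -> R) (-1).
      by rewrite (_ : -%R = - id)//; apply: is_derive_eq.
    by move=> H; rewrite -mulrN1; exact: is_derive1_comp H N1.
  rewrite /G (_ : (fun _ => _) = g + (g \o -%R) - (fun t => t ^+ 2 * a)).
    by apply: is_derive_eq; rewrite /GRing.scale/=; ring.
  by apply/funext => s; rewrite !fctE /= (mulrC a).
move=> t /andP[t0 tr].
have td : t < d2 by exact: le_lt_trans tr _.
have H1 := dP t; have H2 := dP (- t).
rewrite ger0_norm// in H1; rewrite normrN ger0_norm// in H2.
have := H1 td; have := H2 td; rewrite !add0r.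
have : e * t <= e * r by rewrite ler_pM2l.
by rewrite !ler_norml => ? /andP[? ?] /andP[? ?]; apply/andP; split; lra.
Qed.

Lemma twice_lin (b c : R) g g1 a h h1 a' : twice g g1 a -> twice h h1 a' ->
  twice (fun t => b * g t + c * h t) (fun t => b * g1 t + c * h1 t) (b * a + c * a').
Proof.
have lin (f k : R -> R) (x u v : R) : is_derive x 1 f u -> is_derive x 1 k v ->
    is_derive x 1 (fun t => b * f t + c * k t) (b * u + c * v).
  move=> fu kv; rewrite (_ : (fun _ => _) = b *: f + c *: k)//.
  by apply: is_derive_eq; rewrite /GRing.scale.
move=> [[d1 d10 H1] ga] [[d2 d20 H2] ha]; split; last exact: lin.
exists (Num.min d1 d2); first by rewrite lt_min d10.
by move=> t; rewrite lt_min => /andP[t1 t2]; apply: lin; [exact: H1|exact: H2].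
Qed.

Lemma twice_quad (a b c : R) : twice (fun t => a + b * t + c * t ^+ 2) (fun t => b + 2 * c * t) (2 * c).
Proof.
split.
  exists 1 => // t _; rewrite (_ : (fun _ => _) = (fun t => a + t * b + t ^+ 2 * c)).
    by apply: is_derive_eq; rewrite /GRing.scale/=; ring.
  by apply/funext => s; rewrite (mulrC b) (mulrC c).
rewrite (_ : (fun _ => _) = (fun t => b + t * (2 * c))).
  by apply: is_derive_eq; rewrite /GRing.scale/=; ring.
by apply/funext => s; rewrite (mulrC s).
Qed.

Lemma twice_ln g g1 a : twice g g1 a -> 0 < g 0 -> 
  twice (fun t => - ln (g t)) (fun t => - (g1 t / g t)) (- ((a * g 0 - g1 0 ^+ 2) / g 0 ^+ 2)).
Proof.
move=> [[d d0 H] ga] g0.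
have g00 : is_derive (0 : R) 1 g (g1 0) by apply: H; rewrite normr0.
have cg : {for 0, continuous g} by apply: differentiable_continuous; apply/derivable1_diffP; case: g00.
have [r r0 rP] : exists2 r, 0 < r & forall t, `|t| < r -> 0 < g t.
  have : \forall t \near (0 : R), 0 < g t by exact: cvgr_gt cg _ g0.
  by move=> /nbhs_norm0P [r /= r0 rP]; exists r.
split.
  exists (Num.min d r); first by rewrite lt_min d0.
  move=> t; rewrite lt_min => /andP[td tr].
  have H1 := H t td; have H2 := is_derive1_ln (rP t tr).
  have H3 := is_derive1_comp H2 H1.
  rewrite (_ : (fun _ => _) = - (@ln R \o g))//.
  by apply: is_derive_eq; rewrite mulrC.
rewrite (_ : (fun _ => _) = - (g1 * (fun t => (g t)^-1))) => //.
have gn0 : g 0 != 0 by rewrite gt_eqF.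
apply: is_derive_eq; rewrite /GRing.scale/=; field.
by rewrite gt_eqF.
Qed.

End twice_derivable.

(** * The Levi coefficient in one complex variable *)

Section levi.
Variable R : realType.
Local Notation C := R[i].

(** A common ground, by [levi_uniq], for two ways of computing the same number: as the coefficient
    of [t * t^J] in a jet, and through the iterated directional derivatives of a Kaehler form. *)
Definition levi (u : C -> C) (a : C) := genharm (fun t => u t - a * (t * t^J)) 0.

Lemma cross_sq (a : C) (r : R) : cross (fun t => a * (t * t^J)) 0 r = a * (4 * r ^+ 2)%:C.
Proof.
rewrite /cross !add0r; have rJ : (r%:C)^J = r%:C by exact: conjc_real.
have iJ : ('i : C)^J = - 'i by apply: complex_ext => //=; rewrite oppr0.
have nJ (z : C) : (- z)^J = - z^J by exact: rmorphN.
have i2 : 'i * 'i = -1 :> C by rewrite -expr2 sqr_i.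
rewrite !nJ !conjcM iJ rJ real_complexM real_complexX (_ : 4%:C = 4) ?rmorph_nat//.
rewrite !mulrNN !mulNr !mulrN (mulrACA 'i) i2 conjc0 -expr2; ring.
Qed.

Lemma levi_uniq u a b : levi u a -> levi u b -> a = b.
Proof.
move=> ua ub; apply/eqP; rewrite -subr_eq0; apply/eqP/eq0_normc; apply/eqP.
rewrite eq_le normc_ge0 andbT leNgt; apply/negP => ab0.
have [|d d0 dP] := genharmB ub ua (e := normc (a - b)); first by [].
have /dP : 0 < d / 2 < d by rewrite divr_gt0//= ltr_pdivrMr// ltr_pMr// ltr1n.
have -> : cross (fun x => u x - b * (x * x^J) - (u x - a * (x * x^J))) 0 (d / 2) =
   cross (fun t => (a - b) * (t * t^J)) 0 (d / 2) by rewrite /cross; ring.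
have r0 : 0 < (d / 2) ^+ 2 by rewrite exprn_gt0// divr_gt0.
rewrite cross_sq normcM normc_real ler_pM2l// ger0_norm; last by rewrite mulr_ge0// ltW.
by move=> H; lra.
Qed.

Lemma levi_jet u A : jet 3 u A -> levi u (cf A 1 1).
Proof.
move=> uA; pose B := A - (cf A 1 1)%:P%:P * (hol 'X * ahol 'X).
apply: (@jet_genharm _ _ _ B).
  apply: jetB; first by apply: eq_jet uA => t; rewrite add0r.
  apply: jetZ; apply: jetM.
    by apply: jet_hol; apply: eq_bigO (bigO_0 _ 3) => t; rewrite add0r hornerX subrr.
  by apply: (@jet_ahol _ _ (fun t => 0 + t)); apply: eq_bigO (bigO_0 _ 3) => t; rewrite add0r hornerX subrr.
rewrite /B cfD cfN cfC cfM !big_ord_recl !big_ord0 !cf_hol !cf_ahol /= !coefX /=.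
rewrite !(mul0r, mulr0, add0r, addr0, mul1r, mulr1).
rewrite (_ : 1 -i* 0 = 1 :> C) ?mulr1 ?subrr//.
by apply: complex_ext => //=; rewrite oppr0.
Qed.

End levi.

(** * Kaehler forms on complex lines *)

Section kahler_real_part.
Variables (R : realType) (V : normedModType R[i]).
Local Notation C := R[i].

Lemma dirderiv_real (psi : V -> R) v y :
  dirderiv (fun y => (psi y)%:C) v y = (derive1 (fun t : R => psi (y + t%:C *: v)) 0)%:C.
Proof. by rewrite /dirderiv /= derive1_cst. Qed.

(** In the real part only the repeated derivatives along [u] and along ['i *: u] survive, giving a
    quarter of the Laplacian on the complex line; mixed derivatives go to the imaginary part, so
    their symmetry is never at stake. *)
Lemma Re_kahler_form (psi : V -> R) x u g1 a h1 b :
  twice (fun t : R => psi (x + t%:C *: u)) g1 a ->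
  twice (fun t : R => psi (x + t%:C *: ('i *: u))) h1 b ->
  complex.Re (kahler_form psi x u ('i *: u)) = (a + b) / 4.
Proof.
set w := 'i *: u; move=> [[d d0 gP] ga] [[d' d'0 hP] hb].
have iw : 'i *: w = - u by rewrite scalerA -expr2 sqr_i scaleN1r.
pose Dv v y := derive1 (fun t : R => psi (y + t%:C *: v)) 0.
have shift (v : V) (g gd : R -> R) (s t : R) : (forall r, psi (x + r%:C *: v) = g r) ->
    is_derive t 1 g (gd t) -> Dv (s%:C *: v) (x + t%:C *: v) = s * gd t.
  move=> vg gt; rewrite /Dv (_ : (fun _ => _) = g \o (fun r => t + r * s)); last first.
    apply/funext => r; rewrite /= -vg -addrA scalerA -scalerDl.
    by rewrite real_complexD real_complexM.
  have H : is_derive (0 : R) 1 (fun r => t + r * s) s.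
    by apply: is_derive_eq; rewrite /GRing.scale/=; ring.
  have gt' : is_derive ((fun r => t + r * s) 0) 1 g (gd t) by rewrite mul0r addr0.
  have [_ E] := @is_derive1_comp _ g (fun r => t + r * s) 0 _ _ gt' H.
  by rewrite derive1E E mulrC.
have ReG v y : complex.Re (dzbar (fun y => (psi y)%:C) v y) = Dv v y / 2.
  rewrite /dzbar !dirderiv_real -/(Dv _ _) -/(Dv _ _).
  have -> : 2^-1 = (2^-1)%:C :> C by rewrite fmorphV rmorph_nat.
  by rewrite [_ * (2^-1)%:C]mulrC ReMr ReD /=; ring.
have ImG v y : complex.Im (dzbar (fun y => (psi y)%:C) v y) = Dv ('i *: v) y / 2.
  rewrite /dzbar !dirderiv_real -/(Dv _ _) -/(Dv _ _).
  have -> : 2^-1 = (2^-1)%:C :> C by rewrite fmorphV rmorph_nat.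
  by rewrite [_ * (2^-1)%:C]mulrC ImMr ImD /=; ring.
have Imdz (G : V -> C) (v v' y : V) : 'i *: v = v' -> complex.Im (dz G v y) =
   (derive1 (fun t : R => complex.Im (G (y + t%:C *: v))) 0
    - derive1 (fun t : R => complex.Re (G (y + t%:C *: v'))) 0) / 2.
  move=> <-; have -> : dz G v y = (2^-1)%:C * (dirderiv G v y - 'i * dirderiv G ('i *: v) y).
    by rewrite /dz mulrC fmorphV rmorph_nat.
  by rewrite ImMr ImD ImN /dirderiv /=; ring.
have Re_iM (z z' : C) : complex.Re ('i / 2 * (z - z')) = (complex.Im z' - complex.Im z) / 2.
  have -> : 'i / 2 * (z - z') = (2^-1)%:C * ('i * (z - z')).
    by rewrite mulrA fmorphV rmorph_nat [2^-1 * _]mulrC.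
  by rewrite ReMr; case: z => p q; case: z' => p' q' /=; ring.
have kE (G1 G2 : V -> C) : complex.Re ('i / 2 * (dz G1 u x - dz G2 w x)) =
    ((derive1 (fun t : R => complex.Im (G2 (x + t%:C *: w))) 0
      - derive1 (fun t : R => complex.Re (G2 (x + t%:C *: - u))) 0) / 2 -
     (derive1 (fun t : R => complex.Im (G1 (x + t%:C *: u))) 0
      - derive1 (fun t : R => complex.Re (G1 (x + t%:C *: w))) 0) / 2) / 2.
  by rewrite Re_iM (Imdz G1 u w x erefl) (Imdz G2 w (- u) x iw).
rewrite /kahler_form kE.
have D1 : derive1 (fun t : R => complex.Im (dzbar (fun y => (psi y)%:C) w (x + t%:C *: u))) 0 = - a / 2.
  apply: (@derive1_near _ _ (fun t => g1 t * (- 1 / 2)) d) => //.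
    move=> t td; rewrite ImG iw -[- u]scaleN1r -(rmorphN1 (real_complex R)).
    by rewrite (shift u _ _ (-1) t (fun r => erefl) (gP t td)); ring.
  by apply: is_derive_eq; rewrite /GRing.scale/=; ring.
have D2 : derive1 (fun t : R => complex.Re (dzbar (fun y => (psi y)%:C) w (x + t%:C *: w))) 0 = b / 2.
  apply: (@derive1_near _ _ (fun t => h1 t * (1 / 2)) d') => //.
    move=> t td; rewrite ReG -[w in Dv w]scale1r (_ : 1 = (1)%:C)//.
    by rewrite (shift w _ _ 1 t (fun r => erefl) (hP t td)); ring.
  by apply: is_derive_eq; rewrite /GRing.scale/=; ring.
have D3 : derive1 (fun t : R => complex.Im (dzbar (fun y => (psi y)%:C) u (x + t%:C *: w))) 0 = b / 2.
  apply: (@derive1_near _ _ (fun t => h1 t * (1 / 2)) d') => //.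
    move=> t td; rewrite ImG -/w -[w in Dv w]scale1r (_ : 1 = (1)%:C)//.
    by rewrite (shift w _ _ 1 t (fun r => erefl) (hP t td)); ring.
  by apply: is_derive_eq; rewrite /GRing.scale/=; ring.
have D4 : derive1 (fun t : R => complex.Re (dzbar (fun y => (psi y)%:C) u (x + t%:C *: - u))) 0 = - a / 2.
  apply: (@derive1_near _ _ (fun t => (g1 \o -%R) t * (1 / 2)) d) => //.
    move=> t td; rewrite ReG scalerN -scaleNr -[u in Dv u]scale1r (_ : 1 = (1)%:C)//.
    rewrite (_ : - t%:C = (- t)%:C); last by rewrite rmorphN.
    have tN : `|- t| < d by rewrite normrN.
    by rewrite (shift u _ _ 1 (- t) (fun r => erefl) (gP _ tN)) /=; ring.
  have N1 : is_derive (0 : R) 1 (-%R : R -> R) (-1).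
    by rewrite (_ : -%R = - id)//; apply: is_derive_eq.
  have ga' : is_derive (- 0 : R) 1 g1 a by rewrite oppr0.
  have H := @is_derive1_comp _ g1 -%R 0 _ _ ga' N1.
  by apply: is_derive_eq; rewrite /GRing.scale/=; ring.
by rewrite D1 D2 D3 D4; field.
Qed.

Lemma levi_line (psi : V -> R) x u g1 a h1 b :
  twice (fun t : R => psi (x + t%:C *: u)) g1 a ->
  twice (fun t : R => psi (x + t%:C *: ('i *: u))) h1 b ->
  levi (fun t => (psi (x + t *: u))%:C) (complex.Re (kahler_form psi x u ('i *: u)))%:C.
Proof.
move=> ga hb; rewrite (Re_kahler_form ga hb) => e e0.
have e20 : 0 < e / 2 by rewrite divr_gt0.
have [d d0 dP] := twice_second ga e20; have [d' d'0 d'P] := twice_second hb e20.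
exists (Num.min d d'); first by rewrite lt_min d0.
move=> r /andP[r0]; rewrite lt_min => /andP[rd rd'].
have rd1 : 0 < r < d by rewrite r0.
have rd2 : 0 < r < d' by rewrite r0.
have := dP r rd1; have := d'P r rd2; rewrite !scale0r !addr0.
set B := ((_ + _) / 4)%:C.
have -> : cross (fun t => (psi (x + t *: u))%:C - B * (t * t^J)) 0 r =
   cross (fun t => (psi (x + t *: u))%:C) 0 r - cross (fun t => B * (t * t^J)) 0 r.
  by rewrite /cross; ring.
rewrite cross_sq /cross !add0r !scale0r !addr0 /B.
have -> : 'i * r%:C *: u = r%:C *: ('i *: u) by rewrite scalerA mulrC.
have -> : - ('i * r%:C) *: u = - r%:C *: ('i *: u) by rewrite scalerA mulNr mulrC.
have -> : - r%:C = (- r)%:C :> C by rewrite rmorphN.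
set p1 := psi (x + r%:C *: u); set p2 := psi (x + (- r)%:C *: u).
set p3 := psi (x + r%:C *: ('i *: u)); set p4 := psi (x + (- r)%:C *: ('i *: u)).
set p0 := psi x; move=> H1 H2.
have -> : p1%:C + p2%:C + p3%:C + p4%:C - 4 * p0%:C - ((a + b) / 4)%:C * (4 * r ^+ 2)%:C =
   ((p1 + p2 - 2 * p0 - a * r ^+ 2) + (p3 + p4 - 2 * p0 - b * r ^+ 2))%:C :> C.
  have -> : 4 * p0%:C = (4 * p0)%:C :> C by rewrite real_complexM rmorph_nat.
  by rewrite -real_complexM; apply: complex_ext => /=; field.
rewrite normc_real; apply: le_trans (ler_normD _ _) _.
rewrite (_ : e * r ^+ 2 = e / 2 * r ^+ 2 + e / 2 * r ^+ 2); last by field.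
by apply: lerD.
Qed.

End kahler_real_part.

(** * Taylor expansion of real analytic functions *)

Section analytic.
Variables (R : realType) (m : nat).
Local Notation C := R[i].
Local Notation Cm := 'rV[C]_m.
Local Notation I := ('I_m * bool)%type.

Lemma box_widen N k (P : (I -> nat) -> bool) (F : (I -> nat) -> R) : (k < N)%N ->
  (forall a, P a -> forall i, (a i <= k)%N) ->
  \sum_(a : {ffun I -> 'I_N} | P (fun i => a i : nat)) F (fun i => a i : nat) =
  \sum_(a : {ffun I -> 'I_k.+1} | P (fun i => a i : nat)) F (fun i => a i : nat).
Proof.
move=> kN HP; pose w (a : {ffun I -> 'I_k.+1}) : {ffun I -> 'I_N} := [ffun i => widen_ord kN (a i)].
pose v (a : {ffun I -> 'I_N}) : {ffun I -> 'I_k.+1} := [ffun i => inord (a i)].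
have wE a : (fun i => w a i : nat) = (fun i => a i : nat).
  by apply/funext => i; rewrite ffunE.
rewrite (reindex_onto w v) => [|a Pa].
  apply: eq_big => a; last by rewrite wE.
  rewrite wE (_ : v (w a) = a) ?eqxx ?andbT//.
  by apply/ffunP => i; rewrite !ffunE; apply: val_inj; rewrite /= inordK.
apply/ffunP => i; rewrite !ffunE; apply: val_inj; rewrite /= inordK//.
by rewrite ltnS; exact: HP Pa i.
Qed.

(** The homogeneous part of degree [k]; a multi-index of total degree [k] has entries at most [k],
    so the box of side [k + 1] contains them all. *)
Definition homog (c : (I -> nat) -> R) (k : nat) (h : Cm) : R :=
  \sum_(a : {ffun I -> 'I_k.+1} | \sum_i (a i : nat) == k)
    c (fun i => a i : nat) * real_monomial (fun i => a i : nat) h.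

Lemma sum_homog c K N h : (K <= N)%N -> \sum_(k < K) homog c k h =
  \sum_(a : {ffun I -> 'I_N} | (\sum_i (a i : nat) < K)%N)
     c (fun i => a i : nat) * real_monomial (fun i => a i : nat) h.
Proof.
move=> KN; under eq_bigr => k _.
  rewrite /homog -(@box_widen N k (fun a => \sum_i a i == k)
    (fun a => c a * real_monomial a h)); first last.
  - by move=> a /eqP <- i; rewrite (bigD1 i)//= leq_addr.
  - exact: leq_trans (ltn_ord k) KN.
  rewrite big_mkcond; over.
rewrite exchange_big [RHS]big_mkcond; apply: eq_bigr => a _.
case: ltnP => aK.
  rewrite (bigD1 (Ordinal aK))//= eqxx big1 ?addr0// => k.
  by rewrite -val_eqE/= eq_sym => /negPf ->.
rewrite big1// => k _; case: eqP => // ak.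
by have := ltn_ord k; rewrite -ak ltnNge aK.
Qed.

Lemma real_monomial_le (a : I -> nat) (h : Cm) (s r : R) : 0 <= s -> 0 <= r ->
  (forall i, `|real_coord h i| <= s * r) ->
  `|real_monomial a h| <= s ^+ (\sum_i a i) * real_monomial a (const_mx (r +i* r)).
Proof.
move=> s0 r0 H; rewrite /real_monomial normr_prod -prodrXr -big_split /=.
apply: ler_prod => i _; rewrite normr_ge0 normrX -exprMn/=.
rewrite {2}/real_coord mxE /= if_same lerXn2r ?nnegrE ?mulr_ge0//.
Qed.

(** Comparison with the absolutely convergent series at the point [hs], all of whose real
    coordinates equal [r]: scaling by [s <= 1] multiplies a monomial of degree at least [K] by at
    most [s ^+ K]. *)
Lemma analytic_taylor (U : set Cm) f p : real_analytic_on U f -> U p ->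
  exists (c : (I -> nat) -> R) (r M : R), [/\ 0 < r, 0 <= M &
    forall K s h, 0 <= s <= 1 -> (forall i, `|real_coord h i| <= s * r) ->
      `|f (p + h) - \sum_(k < K) homog c k h| <= M * s ^+ K].
Proof.
move=> fU /fU [c /near0_entries [r0 r00 cP]].
pose r := r0 / 4; have rp : 0 < r by rewrite divr_gt0.
have small (h : Cm) : (forall i, `|real_coord h i| <= r) -> forall j, normc (h 0 j) < r0.
  move=> hr j; apply: le_lt_trans (normc_le _) _.
  have := hr (j, false); have := hr (j, true); rewrite /real_coord /= => h1 h2.
  have r4 : r0 = r * 4 by rewrite /r; field.
  by rewrite r4; have := rp; lra.
pose hs : Cm := const_mx (r +i* r).
have hsE i : real_coord hs i = r by rewrite /real_coord mxE /=; case: i.2.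
have [cvs _] : cvgn (box_sum (fun a => `|c a * real_monomial a hs|)) /\
    box_sum (fun a => c a * real_monomial a hs) @ \oo --> f (p + hs).
  by apply: cP; apply: small => i; rewrite hsE gtr0_norm.
have [M MP] : exists M : R, forall N, box_sum (fun a => `|c a * real_monomial a hs|) N <= M.
  have [M [_ HM]] := cvg_seq_bounded cvs.
  by exists (M + 1) => N; apply: le_trans (ler_norm _) _; apply: HM => //; rewrite ltrDl.
have M0 : 0 <= M.
  by apply: le_trans (MP 0%N); apply: sumr_ge0 => a _; exact: normr_ge0.
exists c, r, M; split=> // K s h /andP[s0 s1] hs_le.
have [_ cvh] : cvgn (box_sum (fun a => `|c a * real_monomial a h|)) /\
    box_sum (fun a => c a * real_monomial a h) @ \oo --> f (p + h).
  by apply: cP; apply: small => i; apply: le_trans (hs_le i) _; rewrite ler_piMl// ltW.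
have tail N : (K <= N)%N ->
    `|box_sum (fun a => c a * real_monomial a h) N - \sum_(k < K) homog c k h| <= M * s ^+ K.
  move=> KN; rewrite (sum_homog _ _ KN) /box_sum.
  rewrite (bigID (fun a : {ffun I -> 'I_N} => (\sum_i (a i : nat) < K)%N))/=.
  rewrite addrAC subrr add0r; apply: le_trans (ler_norm_sum _ _ _) _.
  apply: le_trans (_ : _ <= \sum_(a : {ffun I -> 'I_N} | ~~ (\sum_i (a i : nat) < K)%N)
     s ^+ K * `|c (fun i => a i : nat) * real_monomial (fun i => a i : nat) hs|) _.
    apply: ler_sum => a; rewrite -leqNgt => Ka; rewrite !normrM mulrCA.
    apply: ler_wpM2l => //; apply: le_trans (real_monomial_le _ s0 (ltW rp) hs_le) _.
    apply: ler_pM; rewrite ?exprn_ge0//.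
    - by apply: prodr_ge0 => i _; rewrite hsE exprn_ge0// ltW.
    - exact: ler_wiXn2l.
    - exact: ler_norm.
  rewrite -mulr_sumr mulrC; apply: ler_wpM2r; first exact: exprn_ge0.
  apply: le_trans (MP N); rewrite /box_sum [leRHS](bigID (fun a : {ffun I -> 'I_N} => ~~ (\sum_i (a i : nat) < K)%N))/=.
  by rewrite lerDl; apply: sumr_ge0 => a _; exact: normr_ge0.
apply/ler_addgt0Pl => e e0.
have /cvgrPdist_le /(_ e e0) [N _ NP] := cvh.
have := NP (maxn N K) (leq_maxl _ _); have := tail (maxn N K) (leq_maxr _ _).
set S := box_sum _ _; set T := \sum_(k < K) _ => h1 h2.
rewrite (_ : f (p + h) - T = (f (p + h) - S) + (S - T)); last by ring.
by apply: le_trans (ler_normD _ _) _; rewrite lerD.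
Qed.

End analytic.

(** * Term-by-term differentiation of power series *)

Section power_series.
Variable R : realType.

Lemma bounded_pseries_cvg (b : nat -> R) (rho M x : R) : 0 < rho ->
  (forall k, `|b k| * rho ^+ k <= M) -> `|x| <= rho / 2 -> cvgn (pseries b x).
Proof.
move=> rho0 bM x2; apply: normed_cvg.
apply: (@series_le_cvg _ _ (geometric M 2^-1)) => [k|k|k|].
- exact: normr_ge0.
- by rewrite /geometric /= mulr_ge0 ?exprn_ge0// (le_trans _ (bM 0%N))// mulr_ge0.
- rewrite /geometric /= normrM normrX.
  apply: le_trans (_ : `|b k| * (rho / 2) ^+ k <= _).
    apply: ler_wpM2l => //; apply: lerXn2r => //; rewrite nnegrE//.
    by apply: ltW; rewrite divr_gt0.
  by rewrite exprMn mulrA ler_wpM2r// exprn_ge0.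
- by apply: is_cvg_geometric_series; rewrite ger0_norm ?invf_lt1 ?ltr1n.
Qed.

(** Halving the radius absorbs the factor [k + 1 <= 2 ^ k] created by differentiation. *)
Lemma bounded_pseries_diffs (b : nat -> R) (rho M : R) : 0 < rho ->
  (forall k, `|b k| * rho ^+ k <= M) ->
  forall k, `|pseries_diffs b k| * (rho / 2) ^+ k <= M / rho.
Proof.
move=> rho0 bM k; rewrite ler_pdivlMr// /pseries_diffs normrM ger0_norm//.
apply: le_trans (bM k.+1).
have -> : k.+1%:R * `|b k.+1| * (rho / 2) ^+ k * rho = (k.+1%:R / 2 ^+ k) * (`|b k.+1| * rho ^+ k.+1).
  by rewrite exprMn exprVn exprS; ring.
apply: ler_piMl; first by apply: mulr_ge0 => //; apply: exprn_ge0; exact: ltW.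
by rewrite ler_pdivrMr ?exprn_gt0// mul1r -natrX ler_nat ltn_expl.
Qed.

Lemma pseries_twice (g : R -> R) (b : nat -> R) (tau M : R) : 0 < tau -> 0 <= M ->
  (forall K s t, 0 <= s <= 1 -> `|t| <= s * tau ->
     `|g t - \sum_(k < K) b k * t ^+ k| <= M * s ^+ K) ->
  exists g1 a, twice g g1 a.
Proof.
move=> tau0 M0 H.
(* The difference of two consecutive partial sums at [t = tau], both within [M] of [g tau]. *)
have bM k : `|b k| * tau ^+ k <= M + M.
  have t1 : `|tau| <= 1 * tau by rewrite mul1r gtr0_norm.
  have H1 := H k 1 tau; have H2 := H k.+1 1 tau.
  rewrite !expr1n !mulr1 ler01 lexx in H1 H2.
  have := H1 isT t1; have := H2 isT t1; rewrite big_ord_recr/=.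
  have -> : `|b k| * tau ^+ k = `|b k * tau ^+ k| by rewrite normrM normrX (gtr0_norm tau0).
  rewrite !ler_norml => /andP[? ?] /andP[? ?].
  by apply/andP; split; lra.
have gE t : `|t| < tau -> limn (pseries b t) = g t.
  move=> tt; apply/cvg_lim => //; apply/cvgrPdist_le => e e0.
  pose s := `|t| / tau; have s1 : s < 1 by rewrite ltr_pdivrMr// mul1r.
  have s0 : 0 <= s by rewrite divr_ge0// ltW.
  have /cvgrPdist_le /(_ e e0) : (fun K => M * s ^+ K) @ \oo --> (0 : R).
    rewrite -[X in _ --> X](mulr0 M); apply: cvgMr; apply: cvg_expr.
    by rewrite ger0_norm.
  apply: filterS => K; rewrite sub0r normrN => /(le_trans _) -> //.
  apply: le_trans (ler_norm _).
  have := H K s t; rewrite /pseries /series /= big_mkord; apply; first by rewrite s0 ltW.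
  by rewrite mulfVK// gt_eqF.
have b1M := bounded_pseries_diffs tau0 bM.
have b2M := bounded_pseries_diffs (divr_gt0 tau0 (ltr0Sn R 1)) b1M.
have b3M := bounded_pseries_diffs (divr_gt0 (divr_gt0 tau0 (ltr0Sn R 1)) (ltr0Sn R 1)) b2M.
(* Each use of the differentiation theorem needs the series and two formal derivatives to converge,
   so two uses need three derivatives. Each of these halves the radius, and convergence halves it
   once more. *)
pose x0 := tau / 2 / 2 / 2 / 2.
have x00 : 0 < x0 by rewrite !divr_gt0.
have cv0 : cvgn (pseries b x0).
  by apply: bounded_pseries_cvg bM _ => //; rewrite gtr0_norm// /x0; lra.
have cv1 : cvgn (pseries (pseries_diffs b) x0).
  by apply: bounded_pseries_cvg b1M _; rewrite ?divr_gt0// gtr0_norm// /x0; lra.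
have cv2 : cvgn (pseries (pseries_diffs (pseries_diffs b)) x0).
  by apply: bounded_pseries_cvg b2M _; rewrite ?divr_gt0// gtr0_norm// /x0; lra.
have cv3 : cvgn (pseries (pseries_diffs (pseries_diffs (pseries_diffs b))) x0).
  by apply: bounded_pseries_cvg b3M _; rewrite ?divr_gt0// gtr0_norm// /x0; lra.
exists (fun t => limn (pseries (pseries_diffs b) t)).
exists (limn (pseries (pseries_diffs (pseries_diffs b)) 0)); split.
  exists x0 => // t tx.
  have D := @pseries_snd_diffs _ b x0 t cv0 cv1 cv2; rewrite (gtr0_norm x00) in D.
  apply: near_eq_is_derive (D tx).
  have tt : 0 < x0 - `|t| by rewrite subr_gt0.
  apply/nbhs_normP; exists (x0 - `|t|) => // y /= yt; apply: gE.
  have := ler_normB t (t - y); rewrite opprB addrC subrK => h.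
  by apply: le_lt_trans h _; apply: lt_trans (_ : x0 < tau); [lra|rewrite /x0; lra].
have D := @pseries_snd_diffs _ (pseries_diffs b) x0 0 cv1 cv2 cv3.
by apply: D; rewrite normr0 gtr0_norm.
Qed.

End power_series.

(** * Functions obeying the chain rule for the Levi form *)

Section smooth2.
Variable R : realType.
Local Notation C := R[i].

Definition curve_jet m (Y : C -> 'rV[C]_m) (p : 'I_m -> {poly C}) :=
  (forall j, (p j)`_0 = 0) /\ forall j, bigO 3 (fun t => Y t 0 j - (p j).[t]).

Lemma curve_jet0 m (Y : C -> 'rV[C]_m) p : curve_jet Y p -> Y 0 = 0.
Proof.
move=> [p0 H]; apply/rowP => j; have /eqP := bigO_at0 (H j).
by rewrite subr_eq0 horner_coef0 p0 => /eqP ->; rewrite mxE.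
Qed.

Lemma curve_jet_O1 m (Y : C -> 'rV[C]_m) p j : curve_jet Y p -> bigO 1 (fun t => Y t 0 j).
Proof.
move=> Yp; apply: (@bigO1_jet _ 2 _ (hol (p j))); first exact: jet_hol (Yp.2 j).
by rewrite (curve_jet0 Yp) mxE.
Qed.

Lemma curve_jet_line m (u : 'rV[C]_m) : curve_jet (fun t => t *: u) (fun j => u 0 j *: 'X).
Proof.
split=> j; first by rewrite coefZ coefX mulr0.
by apply: eq_bigO (bigO_0 _ 3) => t; rewrite hornerZ hornerX mxE mulrC subrr.
Qed.

(** The first clause gives a meaning to the form of [g] at [x]. The second says that [g] has a jet
    along every holomorphic curve through [x], whose coefficients of degree at most one in each
    variable depend only on the first-order part of the curve. *)
Definition smooth2 m (g : 'rV[C]_m -> R) (x : 'rV[C]_m) :=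
  (forall u, exists g1 a, twice (fun t : R => g (x + t%:C *: u)) g1 a) /\
  exists J : ('I_m -> {poly C}) -> {poly {poly C}},
    (forall p q : 'I_m -> {poly C}, (forall j k, (k <= 1)%N -> (p j)`_k = (q j)`_k) -> eq2 (J p) (J q)) /\
    forall Y p, curve_jet Y p -> jet 3 (fun t => (g (x + Y t))%:C) (J p).

(** The curve is replaced by its tangent line, which has the same coefficient of [t * t^J]; on a
    line, [levi_line] identifies this coefficient. *)
Lemma smooth2_levi m (g : 'rV[C]_m -> R) x (Y : C -> 'rV[C]_m) (p : 'I_m -> {poly C}) (u := \row_j (p j)`_1) : smooth2 g x ->
  curve_jet Y p ->
  levi (fun t => (g (x + Y t))%:C) (complex.Re (kahler_form g x u ('i *: u)))%:C.
Proof.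
move=> [gl [J [J2 JP]]] Yp; have lY := levi_jet (JP _ _ Yp).
have lZ := levi_jet (JP _ _ (curve_jet_line u)).
have [g1 [a ga]] := gl u; have [h1 [b hb]] := gl ('i *: u).
rewrite (levi_uniq (levi_line ga hb) lZ) -(J2 p _ _ 1 1)// => j [|[|//]] _.
  by rewrite Yp.1 coefZ coefX mulr0.
by rewrite coefZ coefX mulr1 mxE.
Qed.

Lemma smooth2B m (g h : 'rV[C]_m -> R) x : smooth2 g x -> smooth2 h x ->
  smooth2 (fun y => g y - h y) x.
Proof.
move=> [gl [J [J2 JP]]] [hl [J' [J'2 J'P]]]; split=> [u|].
  have [g1 [a ga]] := gl u; have [h1 [b hb]] := hl u.
  exists (fun t => 1 * g1 t + (-1) * h1 t), (1 * a + (-1) * b).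
  have := twice_lin 1 (-1) ga hb; congr twice.
  by apply/funext => t; rewrite mul1r mulN1r.
exists (fun p => J p - J' p); split=> [p q pq|Y p Yp].
  by apply: eq2D; [exact: J2|apply: eq2N; exact: J'2].
by apply: eq_jet (jetB (JP _ _ Yp) (J'P _ _ Yp)) => t; rewrite rmorphB.
Qed.

Lemma smooth2_reindex m m' (s : 'I_m' -> 'I_m) (g : 'rV[C]_m' -> R) (x : 'rV[C]_m) :
  smooth2 g (colsub s x) -> smooth2 (fun y => g (colsub s y)) x.
Proof.
move=> [gl [J [J2 JP]]].
have sD (y z : 'rV[C]_m) : colsub s (y + z) = colsub s y + colsub s z.
  by apply/rowP => j; rewrite !mxE.
split=> [u|].
  have [g1 [a ga]] := gl (colsub s u); exists g1, a.
  move: ga; congr twice; apply/funext => t; rewrite sD; congr (g (_ + _)).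
  by apply/rowP => j; rewrite !mxE.
exists (fun p => J (p \o s)); split=> [p q pq|Y p Yp].
  by apply: J2 => j k; exact: pq.
apply: eq_jet (JP (fun t => colsub s (Y t)) _ _) => [t|]; first by rewrite sD.
by split=> j; [exact: Yp.1|apply: eq_bigO (Yp.2 (s j)) => t; rewrite mxE].
Qed.

Lemma normc_sq_line (x u : C) (t : R) : normc (x + t%:C * u) ^+ 2 =
  normc x ^+ 2 + (normc (x + u) ^+ 2 - normc x ^+ 2 - normc u ^+ 2) * t + normc u ^+ 2 * t ^+ 2.
Proof. by rewrite !normc_sq !ReD !ImD !ReMr !ImMr; ring. Qed.

Lemma sqnorm_twice m (x u : 'rV[C]_m) : exists g1, twice (fun t : R => sqnorm (x + t%:C *: u)) g1 (2 * sqnorm u).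
Proof.
exists (fun t => sqnorm (x + u) - sqnorm x - sqnorm u + 2 * sqnorm u * t).
have := @twice_quad _ (sqnorm x) (sqnorm (x + u) - sqnorm x - sqnorm u) (sqnorm u).
congr twice; apply/funext => t; rewrite /sqnorm -!sumrB !mulr_suml -!big_split /=.
by apply: eq_bigr => j _; rewrite !mxE normc_sq_line.
Qed.

Lemma smooth2_sqnorm m (x : 'rV[C]_m) : smooth2 (@sqnorm R m) x.
Proof.
split=> [u|]; first by have [g1 H] := sqnorm_twice x u; exists g1, (2 * sqnorm u).
exists (fun p => \sum_j hol ((x 0 j)%:P + p j) * ahol ((x 0 j)%:P + p j)).
split=> [p q pq|Y p Yp].
  apply: eq2_sum => j _; apply: eq2M => k l k1 l1.
    by rewrite !cf_hol !coefD pq.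
  by rewrite !cf_ahol !coefD pq.
have H j : bigO 3 (fun t => (x + Y t) 0 j - ((x 0 j)%:P + p j).[t]).
  by apply: eq_bigO (Yp.2 j) => t; rewrite mxE hornerD hornerC; ring.
apply: eq_jet (jet_sum _ (fun j _ => jetM (jet_hol (H j)) (jet_ahol (H j)))) => t.
by rewrite /sqnorm real_complex_sum; apply: eq_bigr => j _; rewrite normc_sqE.
Qed.

Lemma smooth2_ln m (g : 'rV[C]_m -> R) x : smooth2 g x -> 0 < g x ->
  smooth2 (fun y => - ln (g y)) x.
Proof.
move=> [gl [J [J2 JP]]] c0; set c := g x in c0; split=> [u|].
  have [g1 [a ga]] := gl u.
  have g0 : 0 < g (x + (0 : R)%:C *: u) by rewrite scale0r addr0.
  by have := twice_ln ga g0; exists (fun t => - (g1 t / g (x + t%:C *: u))); eexists; eassumption.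
exists (fun p => (- ln c)%:C%:P%:P + jcomp (ln_poly R 3) (1 - (c^-1)%:C%:P%:P * J p)).
split=> [p q pq|Y p Yp].
  apply: eq2D; first exact: eq2_refl.
  apply: eq2_jcomp; apply: eq2D; first exact: eq2_refl.
  by apply: eq2N; apply: eq2M; [exact: eq2_refl|exact: J2].
pose v t := 1 - c^-1 * g (x + Y t).
have v0 : v 0 = 0 by rewrite /v (curve_jet0 Yp) addr0 mulVf ?subrr// gt_eqF.
have jv : jet 3 (fun t => (v t)%:C) (1 - (c^-1)%:C%:P%:P * J p).
  apply: eq_jet (jetB (jet_cst 3 1) (jetZ (c^-1)%:C (JP _ _ Yp))) => t.
  by rewrite -real_complexM -rmorphB.
have [K [r [K0 r0 _ H]]] := bigO_pos (bigO1_jet jv (congr1 (real_complex R) v0)).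
(* On this disc [|v t| < 1], so [g] stays positive along the curve and the logarithm of [c] times
   [c^-1 g] splits. *)
have r'0 : 0 < Num.min r (K^-1 / 2) by rewrite lt_min r0 divr_gt0// invr_gt0.
apply: jet_near r'0 _ (jetD (jet_cst 3 _) (jet_ln v0 jv)) => t.
rewrite lt_min => /andP[tr tK]; rewrite -real_complexD; congr (_%:C).
have := H t tr; rewrite normc_real expr1 => h.
have v1 : `|v t| < 1.
  apply: le_lt_trans h _; move: tK; rewrite -(ltr_pM2l K0) mulrA divff ?gt_eqF// mul1r.
  by move=> hK; lra.
have gc : 0 < c^-1 * g (x + Y t).
  by move: v1; rewrite ltr_norml /v => /andP[_]; lra.
rewrite /v subKr -opprD -lnM ?posrE//.
by rewrite mulrA mulfV ?mul1r// gt_eqF.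
Qed.

Section analytic.
Variable m : nat.
Local Notation I := ('I_m * bool)%type.

Definition coord_jet (p : 'I_m -> {poly C}) (i : I) : {poly {poly C}} :=
  if i.2 then (- 'i / 2)%:P%:P * (hol (p i.1) - ahol (p i.1))
  else (2^-1)%:P%:P * (hol (p i.1) + ahol (p i.1)).

Lemma jet_coord Y p i : curve_jet Y p -> jet 3 (fun t => (real_coord (Y t) i)%:C) (coord_jet p i).
Proof.
move=> Yp; have h := jet_hol (Yp.2 i.1); have a := jet_ahol (Yp.2 i.1).
rewrite /coord_jet /real_coord; case: i.2.
  apply: eq_jet (jetZ _ (jetB h a)) => t; case: (Y t 0 i.1) => y1 y2.
  have -> : - 'i / 2 = (2^-1)%:C * - 'i :> C by rewrite fmorphV rmorph_nat mulrC.
  by apply: complex_ext => /=; field.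
apply: eq_jet (jetZ _ (jetD h a)) => t; case: (Y t 0 i.1) => y1 y2.
have -> : 2^-1 = (2^-1)%:C :> C by rewrite fmorphV rmorph_nat.
by apply: complex_ext => /=; field.
Qed.

Lemma eq2_coord (p q : 'I_m -> {poly C}) i : (forall j k, (k <= 1)%N -> (p j)`_k = (q j)`_k) ->
  eq2 (coord_jet p i) (coord_jet q i).
Proof.
move=> pq; rewrite /coord_jet; case: i.2 => k l k1 l1.
  by rewrite !cfC !cfD !cfN !cf_hol !cf_ahol !pq.
by rewrite !cfC !cfD !cf_hol !cf_ahol !pq.
Qed.

Lemma homogZ c k (u : 'rV[C]_m) (t : R) : homog c k (t%:C *: u) = t ^+ k * homog c k u.
Proof.
rewrite /homog mulr_sumr; apply: eq_bigr => a /eqP ak; rewrite mulrCA -[in t ^+ _]ak; congr (_ * _).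
rewrite /real_monomial -prodrXr -big_split; apply: eq_bigr => i _ /=.
by rewrite -exprMn; congr (_ ^+ _); rewrite /real_coord; case: i.2; rewrite mxE ?ReMr ?ImMr.
Qed.

Lemma smooth2_analytic (U : set 'rV[C]_m) f x : real_analytic_on U f -> U x -> smooth2 f x.
Proof.
move=> fU Ux; have [c [r [M [r0 M0 H]]]] := analytic_taylor fU Ux; split=> [u|].
  (* It dominates every real coordinate of [u], so that [|t| <= s * (r / A)] keeps [t u] in the
     range of the Taylor estimate. *)
  pose A := 1 + \sum_i `|real_coord u i|.
  have A0 : 0 < A by rewrite ltr_pwDl// sumr_ge0.
  apply: (@pseries_twice _ _ (fun k => homog c k u) (r / A) M) => //.
    by rewrite divr_gt0.
  move=> K s t s01 ts; rewrite (eq_bigr (fun k : 'I_K => homog c k (t%:C *: u))); last first.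
    by move=> k _; rewrite homogZ mulrC.
  apply: H => // i; have -> : real_coord (t%:C *: u) i = t * real_coord u i.
    by rewrite /real_coord; case: i.2; rewrite mxE ?ReMr ?ImMr.
  rewrite normrM; apply: le_trans (_ : s * (r / A) * A <= _).
    apply: ler_pM => //; rewrite /A (bigD1 i)//= addrCA lerDl addr_ge0//.
    by rewrite sumr_ge0.
  by rewrite -mulrA mulfVK// gt_eqF.
(* The quadratic Taylor polynomial of [f], with the jets of the real coordinates of the curve
   substituted. *)
exists (fun p => \sum_(k < 3) \sum_(a : {ffun I -> 'I_k.+1} | \sum_i (a i : nat) == k)
   (c (fun i => a i : nat))%:C%:P%:P * \prod_i coord_jet p i ^+ a i).
split=> [p q pq|Y p Yp].
  apply: eq2_sum => k _; apply: eq2_sum => a _; apply: eq2M; first exact: eq2_refl.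
  by apply: eq2_prod => i _; apply: eq2X; exact: eq2_coord.
have T : jet 3 (fun t => (\sum_(k < 3) homog c k (Y t))%:C)
  (\sum_(k < 3) \sum_(a : {ffun I -> 'I_k.+1} | \sum_i (a i : nat) == k)
   (c (fun i => a i : nat))%:C%:P%:P * \prod_i coord_jet p i ^+ a i).
  apply: eq_jet (jet_sum _ (fun k _ => jet_sum _ (fun a _ => jetZ _ (jet_prod _ (fun i _ => jetX _ (jet_coord i Yp)))))) => t.
  rewrite real_complex_sum; apply: eq_bigr => k _; rewrite /homog real_complex_sum.
  apply: eq_bigr => a _; rewrite real_complexM; congr (_ * _).
  by rewrite /real_monomial rmorph_prod; apply: eq_bigr => i _; exact: esym (real_complexX _ _).
have O1 : bigO 1 (fun t => (\sum_j normc (Y t 0 j))%:C).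
  apply: eq_bigO (bigO_sum _ (fun j _ => _ : bigO 1 (fun t => (normc (Y t 0 j))%:C))) => [t|j _].
    by rewrite real_complex_sum.
  have [K [r1 [r10 h]]] := curve_jet_O1 j Yp; exists K, r1; split=> // t /h.
  by rewrite normc_real ger0_norm ?normc_ge0.
have [K [r1 [K0 r10 r11 KP]]] := bigO_pos O1.
have O3 : bigO 3 (fun t => (f (x + Y t))%:C - (\sum_(k < 3) homog c k (Y t))%:C).
  exists (M * (K / r) ^+ 3), (Num.min r1 (r / K)); split; first by rewrite lt_min r10 divr_gt0.
  move=> t; rewrite lt_min => /andP[t1 t2]; rewrite -rmorphB normc_real -mulrA -exprMn.
  apply: H => [|i].
    apply/andP; split; first by apply: mulr_ge0; [rewrite divr_ge0 ?ltW|exact: normc_ge0].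
    rewrite mulrAC ler_pdivrMr// mul1r mulrC -ler_pdivlMr//; exact: ltW.
  have -> : K / r * normc t * r = K * normc t ^+ 1 by rewrite expr1; field; rewrite gt_eqF.
  apply: le_trans (KP t t1); rewrite normc_real.
  apply: le_trans (ler_norm _).
  rewrite (bigD1 i.1)//=; apply: le_trans (_ : normc (Y t 0 i.1) <= _).
    by rewrite /real_coord; case: i.2; [exact: normc_Im|exact: normc_Re].
  by rewrite lerDl; apply: sumr_ge0 => j _; exact: normc_ge0.
by apply: eq_bigO (bigOD O3 T) => t; ring.
Qed.

End analytic.

End smooth2.

(** * Jets of holomorphic and harmonic functions of one variable *)

Section curves.
Variable R : realType.
Local Notation C := R[i].

Lemma cdiff_bigO (e : C -> C) : bigO 2 e -> cdiff e 0 0.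
Proof.
move=> eO; have e0 := bigO_at0 eO; have [K [r [K0 r0 _ H]]] := bigO_pos eO.
move=> eps eps0; exists (Num.min r (eps / K)); first by rewrite lt_min r0 divr_gt0.
move=> h; rewrite lt_min => /andP[hr hK]; rewrite add0r e0 mul0r !subr0.
apply: le_trans (H h hr) _; rewrite expr2 mulrA ler_wpM2r ?normc_ge0// mulrC.
by rewrite -ler_pdivlMr// ltW.
Qed.

Lemma cdiff_uniq (f : C -> C) z a b : cdiff f z a -> cdiff f z b -> a = b.
Proof.
move=> fa fb; apply/eqP; rewrite -subr_eq0; apply/eqP/eq0_normc; apply/eqP.
rewrite eq_le normc_ge0 andbT leNgt; apply/negP => ab0.
have e0 : 0 < normc (a - b) / 4 by rewrite divr_gt0.
have [d d0 dP] := fa _ e0; have [d' d'0 d'P] := fb _ e0.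
pose r := Num.min d d' / 2; have m0 : 0 < Num.min d d' by rewrite lt_min d0.
have r0 : 0 < r by rewrite divr_gt0.
have nr : normc r%:C = r by rewrite normc_real gtr0_norm.
have rm : r < Num.min d d' by rewrite /r ltr_pdivrMr// ltr_pMr// ltr1n.
move: (rm); rewrite lt_min => /andP[rd rd'].
have := dP r%:C; have := d'P r%:C; rewrite nr => /(_ rd') h1 /(_ rd) h2.
have : normc ((a - b) * r%:C) <= normc (a - b) / 4 * r + normc (a - b) / 4 * r.
  rewrite (_ : (a - b) * r%:C = (f (z + r%:C) - f z - b * r%:C) + - (f (z + r%:C) - f z - a * r%:C)); last by ring.
  by apply: le_trans (le_normcD _ _) _; rewrite normcN lerD.
rewrite normcM nr -mulrDl ler_pM2r// => h; lra.
Qed.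

Lemma coef1_cdiff (f : C -> C) p a : cdiff f 0 a -> bigO 2 (fun t => f t - p.[t]) -> p`_1 = a.
Proof.
move=> fa fO; apply: cdiff_uniq fa; have := cdiffD (cdiff_bigO fO) (cdiff_poly p 0).
rewrite add0r horner_coef0 coef_deriv (_ : (fun _ => _) = f)//.
by apply/funext => t; rewrite subrK.
Qed.

Lemma holo_jet (f : C -> C) N : (forall z, normc z < 8 -> exists a, cdiff f z a) ->
  exists p : {poly C}, bigO N (fun t => f t - p.[t]).
Proof.
move=> fd; have [z z1|M MP] := @disc_bounded _ f.
  by have [|a /cdiff_ccont//] := fd z; apply: le_lt_trans z1 _; rewrite ltr1n.
have [p [_ H]] := holo_taylor N fd MP; exists p.
apply: (@bigO_le _ N.+1) => //; exists (4 * M), 2^-1; split=> [|t t2]; first by rewrite invr_gt0.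
by apply: H; exact: ltW.
Qed.

Lemma genharm_jet (u : C -> C) N : (forall z, normc z <= 1 -> ccont u z) ->
  (forall z, normc z < 1 -> genharm u z) -> exists p q : {poly C}, jet N u (hol p + ahol q).
Proof.
move=> cu hu; have [M MP] := disc_bounded cu.
have [p [q [_ _ H]]] := genharm_taylor N cu hu MP; exists p, (map_poly conjc q).
apply: (@jet_le _ N.+1) => //; exists (4 * M), 2^-1; split=> [|t t2]; first by rewrite invr_gt0.
rewrite ahol_hpol (_ : map_poly _ (map_poly _ q) = q); first by apply: H; exact: ltW.
by apply/polyP => k; rewrite !coef_map /= conjcK.
Qed.

Lemma jet_ccont N (u : C -> C) z A : (0 < N)%N -> jet N (fun t => u (z + t)) A -> ccont u z.
Proof.
move=> N0 /(jet_le N0) uA.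
have uA1 : jet 1 (fun t => u (z + t)) ((cf A 0 0)%:P%:P).
  apply: jet_trunc uA => k l; rewrite -[_%:P%:P]mulr1 cfC.
  case: k => [|k]; last by lia.
  case: l => [|l]; last by lia.
  by move=> _; rewrite /cf !coef1 /= ?mulr1 ?coef1 ?mulr1.
have [K [r [K0 r0 r1 H]]] := bigO_pos uA1.
have u0 : u z = cf A 0 0 by have := bigO_at0 uA1; rewrite addr0 evC => /eqP; rewrite subr_eq0 => /eqP.
move=> e e0; exists (Num.min r (e / K)); first by rewrite lt_min r0 divr_gt0.
move=> s; rewrite lt_min => /andP[sr sK]; have := H _ sr; rewrite evC -u0 expr1 [z + _]addrC subrK => h.
by apply: le_trans h _; rewrite mulrC -ler_pdivlMr// ltW.
Qed.

Definition cexp_poly N (q : {poly C}) : {poly C} := \sum_(m < N) (m`!%:R^-1)%:P * q ^+ m.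

Lemma exp_trunc_sum (x y : C) N : \sum_(m < N) (x + y) ^+ m / m`!%:R =
  \sum_(i < N) \sum_(j < N | (i + j < N)%N) (x ^+ j / j`!%:R) * (y ^+ i / i`!%:R).
Proof.
pose G (j i : nat) := (x ^+ j / j`!%:R) * (y ^+ i / i`!%:R).
transitivity (\sum_(m < N) \sum_(i < N | (i < m.+1)%N) G (m - i)%N i).
  apply: eq_bigr => m _; rewrite -(big_ord_widen N (fun i => G (m - i)%N i)) ?ltn_ord//.
  rewrite exprDn mulr_suml; apply: eq_bigr => i _; rewrite /G -mulr_natr.
  have im : (i <= m)%N by rewrite -ltnS ltn_ord.
  have f0 k : k`!%:R != 0 :> C by rewrite pnatr_eq0 -lt0n fact_gt0.
  by rewrite -(bin_fact im) !natrM; field; rewrite !f0 pnatr_eq0 -lt0n bin_gt0.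
rewrite (exchange_big_dep xpredT)//=; apply: eq_bigr => i _.
under eq_bigl => m do rewrite ltnS.
rewrite -(big_geq_mkord i N xpredT (fun m => G (m - i)%N i)) -{1}[i : nat]add0n big_addn big_mkord.
under [RHS]eq_bigl => j do rewrite -ltn_subRL.
rewrite -(big_ord_widen N (fun j => G j i)) ?leq_subr//.
by apply: eq_bigr => j _; rewrite addnK.
Qed.

(** The two sides differ by the products of terms of degrees [i] and [j] with [i + j >= N], each of
    which is [O(t^N)] as [a] and [b] are [O(t)]. *)
Lemma exp_trunc_add (a b : C -> C) N : bigO 1 a -> bigO 1 b ->
  bigO N (fun t => \sum_(m < N) (a t + b t) ^+ m / m`!%:R -
    (\sum_(i < N) a t ^+ i / i`!%:R) * (\sum_(j < N) b t ^+ j / j`!%:R)).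
Proof.
move=> aO bO.
have O (i j : nat) : (N <= i + j)%N -> bigO N (fun t => (a t ^+ i / i`!%:R) * (b t ^+ j / j`!%:R)).
  have pw (g : C -> C) k : bigO 1 g -> bigO k (fun t => g t ^+ k).
    move=> gO; elim: k => [|k IH]; first exact: eq_bigO (bigO_cst 1).
    by rewrite -addn1 addnC; apply: eq_bigO (bigOM gO IH) => t; rewrite exprS.
  move=> ij; apply: bigO_le ij _.
  apply: eq_bigO (bigOZ (i`!%:R^-1 * j`!%:R^-1) (bigOM (pw _ i aO) (pw _ j bO))) => t; ring.
apply: eq_bigO (bigON (bigO_sum _ (fun (i : 'I_N) _ => bigO_sum (index_enum 'I_N) (fun (j : 'I_N) (ij : (N <= j + i)%N) => O j i ij)))) => t.
rewrite exp_trunc_sum [X in _ - X]mulrC mulr_suml -sumrB -sumrN; apply: eq_bigr => i _.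
have -> : b t ^+ i / i`!%:R * (\sum_(j < N) a t ^+ j / j`!%:R) =
    \sum_(j < N | (i + j < N)%N) a t ^+ j / j`!%:R * (b t ^+ i / i`!%:R) +
    \sum_(j < N | (N <= j + i)%N) a t ^+ j / j`!%:R * (b t ^+ i / i`!%:R).
  rewrite mulr_sumr (bigID (fun j : 'I_N => (i + j < N)%N))/=; congr (_ + _).
    by apply: eq_bigr => j _; rewrite mulrC.
  by apply: eq_big => j; [rewrite -leqNgt addnC|rewrite mulrC].
by rewrite opprD addrA subrr add0r.
Qed.

End curves.

(** * From curves to the rank argument *)

Section curve_contradiction.
Variable R : realType.
Local Notation C := R[i].

Lemma ev_jcomp_exp N (A : {poly {poly C}}) t :
  ev (jcomp (exp_poly R N) A) t = \sum_(m < N) ev A t ^+ m / m`!%:R.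
Proof.
have sz : (size (exp_poly R N) <= N)%N by exact: size_poly.
rewrite /jcomp ev_sum (big_ord_widen N (fun m => ev (((exp_poly R N)`_m)%:C%:P%:P * A ^+ m) t) sz) big_mkcond.
apply: eq_bigr => m _; have -> : ev A t ^+ m / m`!%:R = ev (((exp_poly R N)`_m)%:C%:P%:P * A ^+ m) t.
  rewrite evM evC evX coef_poly ltn_ord mulrC; congr (_ * _).
  by rewrite fmorphV rmorph_nat.
case: ltnP => // ms; rewrite evM evC nth_default// mul0r//.
Qed.

Lemma cexp_horner N (q : {poly C}) t : (cexp_poly N q).[t] = \sum_(m < N) q.[t] ^+ m / m`!%:R.
Proof.
rewrite horner_sum; apply: eq_bigr => m _.
by rewrite hornerM hornerC horner_exp mulrC.
Qed.

(** The exponential of twice the real part of [q] is the squared modulus of [e^q], at the level of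
    truncations: this is what makes the factor of [X] a rank-one element. *)
Lemma jet_exp_harmonic N (w : C -> R) (q : {poly C}) : w 0 = 0 -> q`_0 = 0 ->
  jet N.+1 (fun t => (w t)%:C) (hol q + ahol q) ->
  jet N.+1 (fun t => (expR (w t))%:C) (hol (cexp_poly N.+1 q) * ahol (cexp_poly N.+1 q)).
Proof.
move=> w0 q0 wq; have qO : bigO 1 (fun t => q.[t]).
  apply: (@bigO1_jet _ 0 _ (hol q)); last by rewrite horner_coef0.
  by apply: jet_hol; apply: eq_bigO (bigO_0 _ 1) => t; rewrite subrr.
have := bigOD (jet_exp w0 wq) (exp_trunc_add N.+1 qO (bigO_conj qO)).
apply: eq_bigO => t; rewrite ev_jcomp_exp evD ev_hol ev_ahol evM ev_hol ev_ahol.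
rewrite cexp_horner conjc_sum addrA subrK; congr (_ - _ * _).
apply: eq_bigr => m _; rewrite conjcM conjcX; congr (_ * _).
by rewrite -[in RHS](rmorph_nat (real_complex R)) -fmorphV conjc_real fmorphV rmorph_nat.
Qed.

Lemma coef_cexp N (q : {poly C}) : q`_0 = 0 ->
  (cexp_poly N.+2 q)`_0 = 1 /\ (cexp_poly N.+2 q)`_1 = q`_1.
Proof.
move=> q0; have q2 m k : (k < 2)%N -> (q ^+ m.+2)`_k = 0.
  have -> : q = q %/ 'X * 'X.
    by rewrite divpK// -['X]subr0 -polyC0 dvdp_XsubCl /root horner_coef0 q0.
  by move=> k2; rewrite exprMn coefMXn; case: ltnP => //; lia.
have one : 1%:R^-1 = 1 :> C by rewrite mulr1n invr1.
have E k : (k < 2)%N -> (cexp_poly N.+2 q)`_k = (k == 0)%:R + q`_k.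
  move=> k2; rewrite /cexp_poly !big_ord_recl !coefD coef_sum big1 => [|m _].
    by rewrite /= !coefCM expr0 expr1 !one !mul1r coef1 addr0.
  by rewrite coefCM /= q2 ?mulr0.
by rewrite !E// q0 addr0 add0r.
Qed.

Variables (n d0 : nat) (F : 'I_n -> C -> C) (xi : 'I_d0 -> C -> C) (f : nat -> C -> C).
Variables (S P : C -> R) (M : R).
Let u1 z := - ln (P z - \sum_i normc (xi i z) ^+ 2) - \sum_i normc (F i z) ^+ 2.
Let u2 z := - ln (P z) - S z.

Lemma curve_contradiction : 0 <= M ->
  (forall i z, normc z < 8 -> exists a, cdiff (F i) z a) ->
  (forall i z, normc z < 8 -> exists a, cdiff (xi i) z a) ->
  (forall j z, normc z < 8 -> exists a, cdiff (f j) z a) ->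
  (forall j, f j 0 = 0) ->
  (forall z, normc z <= 1 -> rsum (fun j => normc (f j z) ^+ 2) (S z)) ->
  (forall z, normc z <= 1 -> S z <= M ^+ 2) ->
  (forall z, normc z <= 1 -> \sum_i normc (xi i z) ^+ 2 < P z) ->
  (forall z, normc z <= 1 -> ccont (fun z => (u1 z)%:C) z) ->
  (forall z, normc z <= 1 -> ccont (fun z => (u2 z)%:C) z) ->
  (forall z, normc z < 1 -> genharm (fun z => (u1 z)%:C) z) ->
  (forall z, normc z < 1 -> genharm (fun z => (u2 z)%:C) z) ->
  (exists i j a, [/\ xi i 0 != 0, cdiff (f j) 0 a & a != 0]) \/
  (exists i a A, [/\ cdiff (xi i) 0 a, a != 0, jet 2 (fun z => (u2 z)%:C) A & cf A 1 0 = 0]) ->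
  False.
Proof.
move=> M0 dF dxi df f0 fS SM xiP c1 c2 h1 h2 alt.
pose N := (2 * n).+3.
have [pF pFP] := choice (fun i => holo_jet N (dF i)).
have [px pxP] := choice (fun i => holo_jet N (dxi i)).
have [pf [B [pfP BP fB]]] := l2_taylor (2 * n).+2 M0 df fS SM.
rewrite -/N in pfP BP.
have pf0 j : (pf j)`_0 = 0.
  by have /eqP := bigO_at0 (pfP j); rewrite f0 sub0r oppr_eq0 horner_coef0 => /eqP.
have [p1 [q1 U1]] := genharm_jet N c1 h1.
have [p2 [q2 U2]] := genharm_jet N c2 h2.
(* As [u2] is real, its jet may be averaged with the conjugate jet, which makes the two parts
   conjugate to each other. *)
pose q := (2^-1)%:P * (p2 + q2).
pose q' := q - (q`_0)%:P.
have q'0 : q'`_0 = 0 by rewrite coefB coefC subrr.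
have half (z : C) : 2^-1 * (z + z) = z by field.
have U2' : jet N (fun t => (u2 t)%:C) (hol q + ahol q).
  have U2J : jet N (fun t => (u2 t)%:C) (hol q2 + ahol p2).
    apply: eq_bigO (bigO_conj U2) => t.
    by rewrite conjcB !evD !ev_hol !ev_ahol conjcD conjcK conjc_real [_^J + _]addrC.
  have := jetZ (2^-1) (jetD U2 U2J) => /(eq_jet (fun t => half _)).
  apply: eq_bigO => t; congr (_ - _).
  rewrite evM evC !evD !ev_hol !ev_ahol !hornerM !hornerD !hornerC conjcM conjcD.
  have -> : (2^-1 : C)^J = 2^-1.
    by rewrite -(rmorph_nat (real_complex R)) -fmorphV conjc_real.
  ring.
have u20 : (u2 0)%:C = q`_0 + (q`_0)^J.
  by rewrite (jet_at0 U2') cfD cf_hol cf_ahol.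
pose w t := u2 t - u2 0.
have w0 : w 0 = 0 by exact: subrr.
have wq : jet N (fun t => (w t)%:C) (hol q' + ahol q').
  apply: eq_bigO (jetB U2' (jet_cst N (u2 0)%:C)) => t.
  have -> : (w t)%:C = (u2 t)%:C - (u2 0)%:C by rewrite rmorphB.
  rewrite u20 !evD evN evC !ev_hol !ev_ahol !hornerD !hornerN !hornerC conjcB.
  ring.
pose E := cexp_poly N q'.
have EP := jet_exp_harmonic w0 q'0 wq.
rewrite -/N -/E in EP.
have [E0 E1] := coef_cexp (2 * n).+1 q'0; rewrite -/N -/E in E0 E1.
have P0 z : normc z <= 1 -> 0 < P z.
  by move=> /xiP; apply: le_lt_trans; apply: sumr_ge0 => i _; exact: sqr_ge0.
pose Xf z := (\sum_i normc (xi i z) ^+ 2) / P z.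
pose c := expR (u2 0); have c0 : 0 < c := expR_gt0 _.
have S0 : S 0 = 0.
  have [|H1 H2] := fS 0; first by rewrite normc0.
  have z0 k : \sum_(j < k) normc (f j 0) ^+ 2 = 0.
    by rewrite big1// => j _; rewrite f0 normc0 expr0n.
  apply/eqP; rewrite eq_le; apply/andP; split; last by have := H1 0%N; rewrite z0.
  apply/ler_addgt0Pl => e /H2 [k /(_ k (leqnn _))]; rewrite z0; lra.
pose X := (\sum_i hol (px i) * ahol (px i)) *
    ((c%:C)%:P%:P * (hol E * ahol E) * jcomp (exp_poly R N) B).
have near1 t : normc t < 1 -> normc t <= 1 by exact: ltW.
(* From [- ln P = u2 + S] and [u2 = u2 0 + w]. *)
have XE t : normc t < 1 -> Xf t = (\sum_i normc (xi i t) ^+ 2) * (c * expR (w t) * expR (S t)).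
  move=> /near1 t1; congr (_ * _); rewrite -!expRD /w.
  have -> : u2 0 + (u2 t - u2 0) + S t = - ln (P t) by rewrite /u2; ring.
  by rewrite expRN lnK// posrE P0.
have XJ : jet N (fun t => (Xf t)%:C) X.
  apply: (@jet_near _ _ (fun t => ((\sum_i normc (xi i t) ^+ 2) * (c * expR (w t) * expR (S t)))%:C) _ _ 1) => //.
    by move=> t /XE ->.
  have J1 := jet_sum (index_enum 'I_d0) (fun i (_ : true) => jetM (jet_hol (pxP i)) (jet_ahol (pxP i))).
  apply: eq_jet (jetM J1 (jetM (jetZ c%:C EP) (jet_exp S0 BP))) => t.
  rewrite !real_complexM real_complex_sum; congr (_ * _).
  by apply: eq_bigr => i _; rewrite normc_sqE.
pose x := Xf 0.
have x01 : 0 <= x < 1.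
  have z1 : normc (0 : C) <= 1 by rewrite normc0.
  apply/andP; split; last by rewrite ltr_pdivrMr ?P0// mul1r xiP.
  apply: divr_ge0; last exact: ltW (P0 _ z1).
  by apply: sumr_ge0 => i _; exact: sqr_ge0.
have x1 : 1 - x != 0 by rewrite subr_eq0 eq_sym; case/andP: x01 => _ /lt_eqF ->.
have X0 : cf X 0 0 = x%:C by rewrite -(jet_at0 XJ).
pose v t := (1 - x)^-1 * (Xf t - x).
have v0 : v 0 = 0 by rewrite /v subrr mulr0.
have vJ : jet N (fun t => (v t)%:C) (((1 - x)^-1)%:C%:P%:P * (X - (x%:C)%:P%:P)).
  apply: eq_jet (jetZ _ (jetB XJ (jet_cst N x%:C))) => t.
  by rewrite -rmorphB -real_complexM.
have lnJ := jet_ln v0 vJ.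
(* [1 - v] is the quotient of [1 - Xf] by its value [1 - x] at 0, so the logarithm of [P (1 - Xf)]
   occurring in [u1] is recovered up to a constant. *)
have lnE t : normc t < 1 -> (- ln (1 - v t))%:C =
    (u1 t)%:C + \sum_i F i t * (F i t)^J - (u2 t)%:C - (S t)%:C + (ln (1 - x))%:C.
  move=> /near1 t1.
  have Pt := P0 t t1; have xt := xiP t t1.
  have -> : \sum_i F i t * (F i t)^J = (\sum_i normc (F i t) ^+ 2)%:C.
    by rewrite real_complex_sum; apply: eq_bigr => i _; rewrite normc_sqE.
  have CE (r1 r2 r3 r4 r5 : R) : r1%:C + r2%:C - r3%:C - r4%:C + r5%:C = (r1 + r2 - r3 - r4 + r5)%:C :> C.
    by apply: complex_ext => /=; ring.
  rewrite CE; congr (_%:C).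
  have xlt : x < 1 by case/andP: x01.
  have xp : 0 < 1 - x by rewrite subr_gt0.
  have -> : 1 - v t = (1 - x)^-1 * ((P t)^-1 * (P t - \sum_i normc (xi i t) ^+ 2)).
    by rewrite /v /Xf; field; rewrite x1 gt_eqF.
  rewrite !lnM ?posrE ?invr_gt0 ?mulr_gt0 ?invr_gt0 ?subr_gt0//.
  by rewrite !lnV ?posrE// /u1 /u2; ring.
have RC := @rank_contradiction R n d0 pF px pf B E c x c0 x01 pf0 fB X0.
apply: RC.
(* For [k] and [l] both positive, the harmonic jets of [u1] and [u2] and the constant disappear,
   leaving the Gram matrix of the [pF i] minus that of the [pf j]. *)
- move=> k l k0 l0 klN.
  have FJ := jet_sum (index_enum 'I_n) (fun i (_ : true) => jetM (jet_hol (pFP i)) (jet_ahol (pFP i))).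
  have T := jetD (jetB (jetB (jetD U1 FJ) U2') BP) (jet_cst N (ln (1 - x))%:C).
  have lnE' t : normc t < 1 -> (u1 t)%:C + \sum_i F i t * (F i t)^J - (u2 t)%:C - (S t)%:C + (ln (1 - x))%:C = (- ln (1 - v t))%:C by move=> /lnE ->.
  rewrite (jet_uniq lnJ (jet_near ltr01 lnE' T) klN).
  have cst0 (z : C) : cf z%:P%:P k l = 0 by rewrite /cf coefC (gtn_eqF l0) coef0.
  rewrite cfD cst0 addr0 !(cfD, cfN) !cf_hol !cf_ahol cf_sum (gtn_eqF k0) (gtn_eqF l0).
  rewrite !addr0 subr0 add0r subrK.
  by apply: eq_bigr => i _; rewrite cf_rank1.
- case: alt => [[i [j [a [xi0 fa a0]]]]|[i [a [A [xa a0 u2A A10]]]]].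
    left; exists i, j; split.
      rewrite coefM big_ord1 E0 mulr1.
      by have /eqP := bigO_at0 (pxP i); rewrite subr_eq0 horner_coef0 => /eqP <-.
    by rewrite (coef1_cdiff fa (@bigO_le _ N 2 _ isT (pfP j))).
  right; exists i.
  (* The linear part of [u2] vanishes, so [E] is stationary and the derivative of [xi i * E] is that
     of [xi i]. *)
  have q1' : q'`_1 = 0.
    have := jet_uniq (@jet_le _ N 2 _ _ isT U2') u2A (isT : (1 + 0 < 2)%N).
    by rewrite A10 cfD cf_hol cf_ahol /= addr0 coefB coefC subr0.
  rewrite coefM !big_ord_recl big_ord0 E0 E1 q1' /= mulr0 add0r mulr1 addr0.
  by rewrite (coef1_cdiff xa (@bigO_le _ N 2 _ isT (pxP i))).
Qed.

End curve_contradiction.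

(** * Immersions and relatives *)

Section kahler_linear.
Variables (R : realType) (V W : normedModType R[i]) (L : V -> W).
Hypothesis LD : forall a b, L (a + b) = L a + L b.
Hypothesis LZ : forall k a, L (k *: a) = k *: L a.

(** A complex linear map commutes with directional derivatives and with multiplication by ['i],
    whence with the Wirtinger derivatives. It is applied to the inclusion of the zero section. *)
Lemma kahler_form_linear (psi : W -> R) x u v :
  kahler_form psi (L x) (L u) (L v) = kahler_form (psi \o L) x u v.
Proof.
have dE (G : W -> R[i]) w y : dirderiv G (L w) (L y) = dirderiv (G \o L) w y.
  rewrite /dirderiv; congr (_ +i* _); congr (derive1 _ 0); apply/funext => t;
    by rewrite -LZ -LD.
have zE (G : W -> R[i]) w y : dz G (L w) (L y) = dz (G \o L) w y.
  by rewrite /dz -LZ !dE.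
have bE (w : V) : dzbar (fun y => (psi y)%:C) (L w) \o L = dzbar (fun y => ((psi \o L) y)%:C) w.
  by apply/funext => y; rewrite /dzbar /= -LZ !dE.
by rewrite /kahler_form !zE !bE.
Qed.

End kahler_linear.

(** * Flat targets of finite and infinite dimension *)

Section embedding.
Variable R : realType.
Local Notation C := R[i].

(** What is kept of an immersion into [C^n] or [l2]: coordinates [e j], the squared length [s], and
    a comparison of [s] with the norm of [V]. The constant [K] is there because the norm of [C^n] is
    the maximum norm, for which [K = n]; for [l2] it is 1. *)
Definition embedding m (U : set 'rV[C]_m) (om : 'rV[C]_m -> 'rV[C]_m -> 'rV[C]_m -> C) :=
  exists (V : normedModType C) (e : nat -> V -> C) (s : V -> R) (K : R) (f : 'rV[C]_m -> V),
  [/\ (forall j a b, e j (a + b) = e j a + e j b) /\ (forall j k a, e j (k *: a) = k * e j a),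
      (forall j a, (normc (e j a))%:C <= `|a|) /\ (forall a, (forall j, e j a = 0) -> a = 0),
      forall a, rsum (fun j => normc (e j a) ^+ 2) (s a) /\ (s a)%:C <= K%:C * `|a| ^+ 2,
      holomorphic_on U f /\ (forall x, U x -> injective ('d f x)) &
      forall x u, U x -> complex.Re (om x u ('i *: u)) = s ('d f x u)].

Lemma linear_i (V W : normedModType C) (f : V -> W) x u : 'd f x ('i *: u) = 'i *: 'd f x u.
Proof. exact: linearZ. Qed.

Lemma Re_flat_form n (y u : 'rV[C]_n) : complex.Re (flat_form R n y u ('i *: u)) = sqnorm u.
Proof.
have [g1 H1] := sqnorm_twice y u; have [g2 H2] := sqnorm_twice y ('i *: u).
rewrite /flat_form (Re_kahler_form H1 H2) (_ : sqnorm ('i *: u) = sqnorm u); first by field.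
by apply: eq_bigr => j _; rewrite mxE normcM normc_i mul1r.
Qed.

Lemma embedding_flat m n (U : set 'rV[C]_m) om (f : 'rV[C]_m -> 'rV[C]_n) :
  kahler_immersion U om (flat_form R n) f -> embedding U om.
Proof.
move=> [hf injf omf].
(* Coordinates are indexed by all integers, those from [n] on being 0. *)
pose e (j : nat) (a : 'rV[C]_n) := if insub j is Some i then a 0 i else 0.
have eE (i : 'I_n) a : e i a = a 0 i by rewrite /e valK.
have eD j a b : e j (a + b) = e j a + e j b.
  by rewrite /e; case: insubP => [i _ _|_]; rewrite ?mxE ?addr0.
have eZ j k a : e j (k *: a) = k * e j a.
  by rewrite /e; case: insubP => [i _ _|_]; rewrite ?mxE ?mulr0.
have eb j a : (normc (e j a))%:C <= `|a|.
  rewrite /e; case: insubP => [i _ _|_]; first by rewrite -normE; exact: mx_entry_le.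
  by rewrite normc0 normr_ge0.
exists 'rV[C]_n, e, (@sqnorm R n), n%:R, f; split=> //.
- split=> // a a0; apply/rowP => i; have := a0 i; rewrite mxE; congr (_ = _); exact: eE.
- move=> a; have S k : (n <= k)%N -> \sum_(j < k) normc (e j a) ^+ 2 = sqnorm a.
    move=> nk; rewrite /sqnorm (eq_bigr (fun i : 'I_n => normc (e i a) ^+ 2)); last by move=> i _; rewrite eE.
    rewrite (big_ord_widen k (fun j => normc (e j a) ^+ 2) nk) [RHS]big_mkcond.
    apply: eq_bigr => j _; case: ltnP => // nj.
    by rewrite /e insubF ?normc0 ?expr0n// ltnNge nj.
  split; [split=> [k|eps eps0]|].
  + rewrite -(S (maxn n k) (leq_maxl _ _)); apply: (sum_mono (a := fun j => normc (e j a) ^+ 2)); last exact: leq_maxr.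
    by move=> j; exact: sqr_ge0.
  + by exists n => k nk; rewrite S// lerBlDr lerDl ltW.
  + have na : `|a| \is Num.real by exact: normr_real.
    rewrite /sqnorm real_complex_sum.
    apply: le_trans (_ : \sum_(i < n) `|a| ^+ 2 <= _).
      apply: ler_sum => i _; rewrite real_complexX -normE lerXn2r ?nnegrE//.
      exact: mx_entry_le.
    have -> : n%:R%:C = n%:R :> C by exact: rmorph_nat.
    by rewrite sumr_const card_ord -[leLHS]mulr_natl.
- by move=> x u Ux; rewrite -(omf _ _ _ Ux) linear_i Re_flat_form.
Qed.

Lemma l2_csum (a : l2 R) : csum (fun j => (normc (a j) ^+ 2)%:C) (l2sq a)%:C.
Proof.
move=> e e0; have /cvgrPdist_le /(_ e e0) [N _ NP] := @l2_cvg R a.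
exists N => k /NP; rewrite /series /= big_mkord -real_complex_sum -rmorphB normc_real.
by rewrite distrC.
Qed.

Lemma l2_rsum (a : l2 R) : rsum (fun j => normc (a j) ^+ 2) (l2sq a).
Proof.
split=> [k|e e0].
  rewrite -(big_mkord xpredT (fun j => normc (a j) ^+ 2)).
  apply: (@nondecreasing_cvgn_le _ (series (fun j => normc (a j) ^+ 2))); last exact: l2_cvg.
  by apply: nondecreasing_series => i _ _; exact: sqr_ge0.
have /cvgrPdist_le /(_ e e0) [N _ NP] := @l2_cvg R a.
exists N => k /NP; rewrite /series /= big_mkord ler_norml => /andP[_]; rewrite /l2sq; lra.
Qed.

Lemma csum_uniq (a : nat -> C) s t : csum a s -> csum a t -> s = t.
Proof.
move=> ha hb; have D s' t' : csum a s' -> csum a t' -> 0 <= s' - t'.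
  move=> h1 h2; apply: (@csum_ge0 _ (fun=> 0)) => // e e0.
  have [N NP] := csumD h1 (csumZ (-1) h2) e0; exists N => k /NP.
  by rewrite mulN1r big1 ?big1// => j _; rewrite mulN1r subrr.
by apply/eqP; rewrite eq_le -subr_ge0 D// -subr_ge0 D.
Qed.

(** The identity holds termwise by [normc_sq_line]; uniqueness of sums transfers it to the
    series. *)
Lemma l2sq_line (x u : l2 R) (t : R) : l2sq (x + t%:C *: u) =
  l2sq x + (l2sq (x + u) - l2sq x - l2sq u) * t + l2sq u * t ^+ 2.
Proof.
have H := csumD (l2_csum x) (csumD (csumZ t%:C (csumD (l2_csum (x + u))
  (csumD (csumZ (-1) (l2_csum x)) (csumZ (-1) (l2_csum u))))) (csumZ (t ^+ 2)%:C (l2_csum u))).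
have CE (a b c : R) : a%:C + (t%:C * (b%:C + (-1 * a%:C + -1 * c%:C)) + (t ^+ 2)%:C * c%:C) =
   (a + (b - a - c) * t + c * t ^+ 2)%:C :> C.
  by rewrite !mulN1r; apply: complex_ext => /=; ring.
have H2 : csum (fun j => (normc ((x + t%:C *: u) j) ^+ 2)%:C)
    (l2sq x + (l2sq (x + u) - l2sq x - l2sq u) * t + l2sq u * t ^+ 2)%:C.
  rewrite -CE; apply: eq_csum H => j; rewrite CE; congr (_%:C).
  by rewrite -normc_sq_line.
have [] // := csum_uniq (l2_csum (x + t%:C *: u)) H2.
Qed.

Lemma l2sq_twice (x u : l2 R) : exists g1, twice (fun t : R => l2sq (x + t%:C *: u)) g1 (2 * l2sq u).
Proof.
exists (fun t => l2sq (x + u) - l2sq x - l2sq u + 2 * l2sq u * t).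
have := @twice_quad _ (l2sq x) (l2sq (x + u) - l2sq x - l2sq u) (l2sq u).
by congr twice; apply/funext => t; rewrite l2sq_line.
Qed.

Lemma Re_flat_form_l2 (y u : l2 R) : complex.Re (flat_form_l2 R y u ('i *: u)) = l2sq u.
Proof.
have [g1 H1] := l2sq_twice y u; have [g2 H2] := l2sq_twice y ('i *: u).
rewrite /flat_form_l2 (Re_kahler_form H1 H2) (_ : l2sq ('i *: u) = l2sq u); first by field.
rewrite /l2sq; congr (limn (series _)); apply/funext => j.
by rewrite [LHS](_ : _ = normc ('i * u j) ^+ 2)// normcM normc_i mul1r.
Qed.

Lemma embedding_l2 m (U : set 'rV[C]_m) om (f : 'rV[C]_m -> l2 R) :
  kahler_immersion U om (flat_form_l2 R) f -> embedding U om.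
Proof.
move=> [hf injf omf].
have nE (a : l2 R) : `|a| = (Num.sqrt (l2sq a))%:C by [].
exists (l2 R), (fun j a => l2val a j), (@l2sq R), 1, f; split=> //.
- split=> [j a|a a0]; last by apply/val_inj/funext => j; exact: a0.
  rewrite nE lecR -[leLHS]ger0_norm ?normc_ge0// -sqrtr_sqr ler_wsqrtr//.
  exact: l2sq_ge.
- move=> a; split; first exact: l2_rsum.
  by rewrite mul1r nE -real_complexX sqr_sqrtr ?l2sq_ge0.
- by move=> x u Ux; rewrite -(omf _ _ _ Ux) linear_i Re_flat_form_l2.
Qed.

End embedding.

(** * Jets along curves in several variables *)

Section lines.
Variable R : realType.
Local Notation C := R[i].

(** For the last clause, a curve with zero velocity has the same low coefficients as a constant
    curve. *)
Lemma smooth2_jets m (g : 'rV[C]_m -> R) x (Y : C -> 'rV[C]_m) (p : 'I_m -> {poly C})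
    (u := \row_j (p j)`_1) : smooth2 g x -> curve_jet Y p ->
  exists A, [/\ jet 3 (fun t => (g (x + Y t))%:C) A,
    cf A 1 1 = (complex.Re (kahler_form g x u ('i *: u)))%:C & u = 0 -> cf A 1 0 = 0].
Proof.
move=> gx Yp; have lY := smooth2_levi gx Yp.
have [gl [J [J2 JP]]] := gx; exists (J p); split; first exact: JP.
  exact: levi_uniq (levi_jet (JP _ _ Yp)) lY.
move=> u0; have Y0 : curve_jet (fun=> 0 : 'rV[C]_m) (fun=> 0).
  split=> j; first by rewrite coef0.
  by apply: eq_bigO (bigO_0 _ 3) => t; rewrite mxE horner0 subrr.
rewrite (J2 p (fun=> 0) _ 1 0)//; last first.
  move=> j [|[|//]] _; rewrite coef0; first exact: Yp.1.
  by have /rowP/(_ j) := u0; rewrite !mxE.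
have c0 := jet_cst 3 (g x)%:C.
have H : jet 3 (fun=> (g x)%:C) (J (fun=> 0)) by apply: eq_jet (JP _ _ Y0) => t; rewrite addr0.
by rewrite (jet_uniq H c0 (isT : (1 + 0 < 3)%N)) /cf !coefC.
Qed.

Lemma cdiff_shift (f : C -> C) z t a : cdiff f (t + z) a -> cdiff (fun s => f (t + s)) z a.
Proof.
move=> H e e0; have [d d0 dP] := H e e0; exists d => // h /dP.
by rewrite addrA.
Qed.

Lemma cdiff_subc (f : C -> C) z a b : cdiff f z a -> cdiff (fun s => f s - b) z a.
Proof. by move=> fa; have := cdiffD fa (cdiff_cst (- b) z); rewrite addr0. Qed.

(** The radius 16 leaves more than the radius 8 needed for Taylor expansion after recentring at a
    point of the unit disc. *)
Lemma curve_jet_exists m (Z Z' : C -> 'rV[C]_m) t0 :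
  (forall j t, normc t < 16 -> cdiff (fun t => Z t 0 j) t (Z' t 0 j)) -> normc t0 <= 1 ->
  exists2 p, curve_jet (fun t => Z (t0 + t) - Z t0) p & \row_j (p j)`_1 = Z' t0.
Proof.
move=> dZ t01; have dS j t : normc t < 8 ->
    cdiff (fun t => Z (t0 + t) 0 j - Z t0 0 j) t (Z' (t0 + t) 0 j).
  move=> t8; apply: cdiff_subc; apply: (@cdiff_shift (fun t => Z t 0 j)); apply: dZ.
  by apply: le_lt_trans (le_normcD _ _) _; lra.
have dE j t : normc t < 8 -> exists a, cdiff (fun t => Z (t0 + t) 0 j - Z t0 0 j) t a.
  by move=> /(dS j); exists (Z' (t0 + t) 0 j).
have [p pP] := choice (fun j => holo_jet 3 (dE j)).
exists p; first split=> j.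
- have /eqP := bigO_at0 (pP j); rewrite addr0 subrr sub0r oppr_eq0 horner_coef0.
  by move=> /eqP.
- by apply: eq_bigO (pP j) => t; rewrite !mxE.
apply/rowP => j; rewrite mxE.
have z8 : normc (0 : C) < 8 by rewrite normc0.
have := dS j 0 z8; rewrite addr0 => H.
by apply: coef1_cdiff H _; apply: bigO_le (pP j).
Qed.

Lemma line_norm_ccont k (W : normedModType C) (G : 'rV[C]_k -> W) (x v : 'rV[C]_k) (t : C) b :
  {for x + t *: v, continuous G} -> ccont (fun t => `|G (x + t *: v) - b|) t.
Proof.
move=> cG e e0; set y := x + t *: v in cG *.
have e0' : 0 < e%:C by rewrite ltcR.
move/cvgrPdist_le : cG => /(_ _ e0') /nbhs_normP [d /= d0 dP].
have : \forall h \near (0 : 'rV[C]_k), `|G y - G (y + h)| <= e%:C.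
  apply/nbhs_norm0P; exists d => // h /= hd; apply: dP => /=.
  by rewrite opprD addrA subrr add0r normrN.
move=> /near0_entries [r r0 rP].
pose B := 1 + \sum_j normc (v 0 j).
have B0 : 0 < B by rewrite ltr_pwDl// sumr_ge0// => j _; exact: normc_ge0.
exists (r / B); first by rewrite divr_gt0.
move=> s sr; have := rP ((s - t) *: v) _.
have -> : y + (s - t) *: v = x + s *: v by rewrite /y -addrA -scalerDl [t + _]addrC subrK.
move=> H; have {}H : `|G y - G (x + s *: v)| <= e%:C.
  apply: H => j; rewrite mxE normcM; move: sr; rewrite ltr_pdivlMr// => sr.
  apply: le_lt_trans sr; apply: ler_wpM2l; first exact: normc_ge0.
  rewrite /B (bigD1 j)//= addrCA lerDl addr_ge0//.
  by apply: sumr_ge0 => l _; exact: normc_ge0.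
rewrite -lecR -normE; apply: le_trans (ler_dist_dist _ _) _.
by rewrite opprB addrA subrK distrC.
Qed.

End lines.

(** * The zero section, and the case where [xi] vanishes identically *)

Section submatrices.
Variable R : realType.
Local Notation C := R[i].

Lemma diff_lsubmx k d0 d (g : 'rV[C]_k -> 'rV[C]_(d0 + d)) x u : differentiable g x ->
  'd (lsubmx \o g) x u = lsubmx ('d g x u).
Proof.
move=> dg; rewrite diff_comp//; last exact: differentiable_lsubmx.
by rewrite /= diff_lin//; exact: continuous_lsubmx.
Qed.

Lemma diff_rsubmx k d0 d (g : 'rV[C]_k -> 'rV[C]_(d0 + d)) x u : differentiable g x ->
  'd (rsubmx \o g) x u = rsubmx ('d g x u).
Proof.
move=> dg; rewrite diff_comp//; last exact: differentiable_rsubmx.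
by rewrite /= diff_lin//; exact: continuous_rsubmx.
Qed.

Lemma hartogs_form_base d0 d (phi : 'rV[C]_d -> R) (z u v : 'rV[C]_d) :
  hartogs_form d0 phi (row_mx 0 z) (row_mx 0 u) (row_mx 0 v) = base_form phi z u v.
Proof.
pose psi (x : 'rV[C]_(d0 + d)) := - ln (phi (rsubmx x) - sqnorm (lsubmx x)).
pose L (z : 'rV[C]_d) := row_mx (0 : 'rV[C]_d0) z.
have LD a b : L (a + b) = L a + L b by rewrite /L add_row_mx addr0.
have LZ c a : L (c *: a) = c *: L a by rewrite /L scale_row_mx scaler0.
have E : psi \o L = (fun z => - ln (phi z)).
  apply/funext => y; rewrite /psi /L /= row_mxKl row_mxKr.
  rewrite [sqnorm _]big1 ?subr0// => j _.
  by rewrite mxE normc0 expr0n.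
by have := kahler_form_linear LD LZ psi z u v; rewrite E.
Qed.

(** The component [lsubmx \o f1] is constant and has zero differential, so [rsubmx \o f1] is still
    an immersion; on the zero section the form of the Hartogs domain is that of the base. *)
Lemma relatives_base d d0 n (D : set 'rV[C]_d) (phi : 'rV[C]_d -> R) k
    (S : complex_manifold R k) (f1 : S -> 'rV[C]_(d0 + d)) (f2 : S -> 'rV[C]_n) :
  (0 < k)%N -> (forall s, hartogs d0 D phi (f1 s)) -> (forall s, lsubmx (f1 s) = 0) ->
  holomorphic_immersion f1 -> holomorphic_immersion f2 ->
  (forall (i : cm_index S) x u v, cm_img i x ->
    pullback (hartogs_form d0 phi) f1 i x u v = pullback (flat_form R n) f2 i x u v) ->
  relatives D (base_form phi) [set: 'rV[C]_n] (flat_form R n).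
Proof.
move=> k0 f1H l0 if1 if2 pb; exists k, S, (rsubmx \o f1), f2.
have cA i : (rsubmx \o f1) \o cm_inv i = rsubmx \o (f1 \o cm_inv i) by [].
split.
- exact: k0.
- by split=> s; [have [] := f1H s|].
- move=> i; have [hf inj] := if1 i; rewrite cA; split=> x xi.
    apply: differentiable_comp; first exact: hf.
    exact: differentiable_rsubmx.
  move=> u v; rewrite !diff_rsubmx; try exact: hf.
  move=> uv; apply: (inj x xi); rewrite -[LHS]hsubmxK -[RHS]hsubmxK uv.
  rewrite -!diff_lsubmx; try exact: hf.
  have -> : lsubmx \o (f1 \o cm_inv i) = cst 0 by apply/funext => y; exact: l0.
  by rewrite diff_cst.
- exact: if2.
- move=> i x u v xi; rewrite -(pb i x u v xi) /pullback cA.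
  have [hf _] := if1 i.
  rewrite !diff_rsubmx; try exact: hf.
  rewrite -(hartogs_form_base d0).
  have lz w : lsubmx ('d (f1 \o cm_inv i) x w) = 0.
    rewrite -diff_lsubmx; last exact: hf.
    have -> : lsubmx \o (f1 \o cm_inv i) = cst 0 by apply/funext => y; exact: l0.
    by rewrite diff_cst.
  have E (y : 'rV[C]_(d0 + d)) : lsubmx y = 0 -> row_mx 0 (rsubmx y) = y.
    by move=> y0; rewrite -[RHS]hsubmxK y0.
  by rewrite (E _ (l0 _)) (E _ (lz u)) (E _ (lz v)).
Qed.

End submatrices.

(** * The case where [xi] is nonzero at the base point *)

Section line_contradiction.
Variable R : realType.
Local Notation C := R[i].
Variables (d d0 n k : nat) (D : set 'rV[C]_d) (phi : 'rV[C]_d -> R).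
Variables (g : 'rV[C]_k -> 'rV[C]_(d0 + d)) (F : 'rV[C]_k -> 'rV[C]_n) (x v : 'rV[C]_k).
Variables (V : normedModType C) (e : nat -> V -> C) (s : V -> R) (K : R) (f : 'rV[C]_d -> V).
Hypothesis phi0 : forall z, D z -> 0 < phi z.
Hypothesis phiA : real_analytic_on D phi.
Hypothesis eD : forall j a b, e j (a + b) = e j a + e j b.
Hypothesis eZ : forall j c a, e j (c *: a) = c * e j a.
Hypothesis eb : forall j a, (normc (e j a))%:C <= `|a|.
Hypothesis e_inj : forall a, (forall j, e j a = 0) -> a = 0.
Hypothesis es : forall a, rsum (fun j => normc (e j a) ^+ 2) (s a).
Hypothesis sK : forall a, (s a)%:C <= K%:C * `|a| ^+ 2.
Hypothesis hf : holomorphic_on D f.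
Hypothesis inj_f : forall z, D z -> injective ('d f z).
Hypothesis om_f : forall z u, D z ->
  complex.Re (base_form phi z u ('i *: u)) = s ('d f z u).
Let L (t : C) := x + t *: v.
Hypothesis gH : forall t, hartogs d0 D phi (g (L t)).
Hypothesis dg : forall t, normc t < 16 -> differentiable g (L t).
Hypothesis dF : forall t, normc t < 16 -> differentiable F (L t).
Hypothesis om_g : forall t, normc t < 16 ->
  hartogs_form d0 phi (g (L t)) ('d g (L t) v) ('i *: 'd g (L t) v) =
  flat_form R n (F (L t)) ('d F (L t) v) ('i *: 'd F (L t) v).
Hypothesis dg0 : 'd g (L 0) v != 0.
Hypothesis xi0 : lsubmx (g (L 0)) != 0.

Let z t := rsubmx (g (L t)).
Let Dz t : D (z t). Proof. by have [] := gH t. Qed.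
Let Z' t := rsubmx ('d g (L t) v).
Let Fc (i : 'I_n) t := F (L t) 0 i.
Let xic (i : 'I_d0) t := lsubmx (g (L t)) 0 i.
(** Translated so as to vanish at the base point; this changes neither the differential nor the
    induced form. *)
Let fc j t := e j (f (z t) - f (z 0)).
Let Sc t := s (f (z t) - f (z 0)).
Let Pc t := phi (z t).

Let cdiff_coord m (G : 'rV[C]_k -> 'rV[C]_m) (i : 'I_m) t : differentiable G (L t) ->
  cdiff (fun t => G (L t) 0 i) t ('d G (L t) v 0 i).
Proof.
move=> dG; apply: (cdiff_line (e := fun a : 'rV[C]_m => a 0 i)) => //.
- by move=> a b; rewrite mxE.
- by move=> c a; rewrite mxE.
- by move=> a; rewrite -normE; exact: mx_entry_le.
Qed.

Let dxic i t : normc t < 16 -> cdiff (xic i) t (lsubmx ('d g (L t) v) 0 i).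
Proof.
move=> t16; rewrite -diff_lsubmx; last exact: dg.
apply: (@cdiff_coord _ (lsubmx \o g)).
by apply: differentiable_comp; [exact: dg|exact: differentiable_lsubmx].
Qed.

Let dgz t : normc t < 16 -> differentiable (rsubmx \o g) (L t).
Proof.
by move=> t16; apply: differentiable_comp; [exact: dg|exact: differentiable_rsubmx].
Qed.

Let dzc j t : normc t < 16 -> cdiff (fun t => z t 0 j) t (Z' t 0 j).
Proof.
move=> t16; rewrite /Z' -diff_rsubmx; last exact: dg.
by apply: (@cdiff_coord _ (rsubmx \o g)); exact: dgz.
Qed.

Let dfz t : normc t < 16 -> differentiable (f \o (rsubmx \o g)) (L t).
Proof. by move=> t16; apply: differentiable_comp; [exact: dgz|exact: hf (Dz t)]. Qed.

Let dfc j t : normc t < 16 -> cdiff (fc j) t (e j ('d f (z t) (Z' t))).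
Proof.
move=> t16.
have eB a b : e j (a - b) = e j a - e j b by rewrite eD -scaleN1r eZ mulN1r.
have H := @cdiff_line _ _ _ (f \o (rsubmx \o g)) x v t (e j) (eD j) (eZ j) (eb j) (dfz t16).
have E : 'd (f \o (rsubmx \o g)) (L t) v = 'd f (z t) (Z' t).
  by rewrite diff_comp; [rewrite /= diff_rsubmx//; exact: dg|exact: dgz|exact: hf (Dz t)].
rewrite E in H; rewrite (_ : fc j = fun t => e j (f (z t)) - e j (f (z 0))).
  exact: cdiff_subc H.
by apply/funext => r; exact: eB.
Qed.

(** Radius 2 allows recentring at points of the unit disc; it is reached from [disc_bounded] through
    the substitution of [2 t] for [t]. *)
Let Sc_bounded : exists2 M : R, 0 <= M & forall t, normc t <= 2 -> Sc t <= M ^+ 2.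
Proof.
have [|M0 M0P] := @disc_bounded _ (fun t => `|f (z (2 * t)) - f (z 0)|).
  move=> t t1; have t2 : normc (2 * t) < 16.
    by rewrite normcM (_ : 2 = (2 : R)%:C) ?normc_real ?ger0_norm//; [lra|rewrite rmorph_nat].
  have := @line_norm_ccont _ _ _ (f \o (rsubmx \o g)) x (2 *: v) t (f (z 0)) _.
  have E r : x + r *: (2 *: v) = L (2 * r) by rewrite /L scalerA mulrC.
  rewrite E => H; have {H} := H (differentiable_continuous (dfz t2)).
  rewrite (_ : (fun _ => _) = (fun t => `|f (z (2 * t)) - f (z 0)|))//.
  by apply/funext => r; rewrite E.
have M00 : 0 <= M0 by apply: le_trans (normc_ge0 _) (M0P 0 _); rewrite normc0.
(* With [K' >= 1], the bound [K' * M0 ^+ 2] is at most the square of [K' * M0], as the form of the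
   statement requires. *)
pose K' := 1 + `|K|; have K1 : 1 <= K' by rewrite lerDl.
have K'0 : 0 <= K' by rewrite (le_trans ler01).
exists (K' * M0); first exact: mulr_ge0.
move=> t t2; have ht : normc (2^-1 * t) <= 1.
  rewrite normcM (_ : 2^-1 = (2^-1 : R)%:C) ?normc_real ?ger0_norm ?invr_ge0//.
    by rewrite mulrC ler_pdivrMr// mul1r.
  by rewrite fmorphV rmorph_nat.
have := M0P _ ht; rewrite mulrA mulfV ?pnatr_eq0// mul1r => H.
have {}H : `|f (z t) - f (z 0)| <= M0%:C.
  rewrite -[leLHS]normr_id normE lecR; exact: H.
rewrite -lecR; apply: le_trans (sK _) _.
apply: (@le_trans _ _ (K'%:C * M0%:C ^+ 2)).
  apply: (@le_trans _ _ (K'%:C * `|f (z t) - f (z 0)| ^+ 2)).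
    apply: ler_wpM2r; first by rewrite exprn_ge0.
    by rewrite lecR /K'; have := ler_norm K; lra.
  by apply: ler_wpM2l; rewrite ?lecR// lerXn2r ?nnegrE ?lecR.
rewrite -real_complexX -real_complexM lecR exprMn ler_wpM2r ?exprn_ge0//.
by rewrite expr2 ler_peMl.
Qed.

Let LD t0 t : g (L t0) + (g (L (t0 + t)) - g (L t0)) = g (L (t0 + t)).
Proof. by rewrite addrC subrK. Qed.

Let u1 t := - ln (Pc t - \sum_i normc (xic i t) ^+ 2) - \sum_i normc (Fc i t) ^+ 2.
Let u2 t := - ln (Pc t) - Sc t.

Let norm16 (t : C) : normc t <= 1 -> normc t < 16.
Proof. by move=> t1; lra. Qed.

(** [u1] is the difference of the two potentials along the curves, so its Levi coefficient is the
    difference of the two forms on the velocities, 0 by [om_g]. *)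
Let jet_u1 t0 : normc t0 <= 1 -> exists2 A, jet 3 (fun t => (u1 (t0 + t))%:C) A & cf A 1 1 = 0.
Proof.
move=> t01; have t016 := norm16 t01.
have [p pY pE] := curve_jet_exists (fun j t t16 => cdiff_coord j (dg t16)) t01.
have [q qY qE] := curve_jet_exists (fun j t t16 => cdiff_coord j (dF t16)) t01.
pose rho (y : 'rV[C]_(d0 + d)) := phi (rsubmx y) - sqnorm (lsubmx y).
have rS : smooth2 rho (g (L t0)).
  have rE : (rsubmx : 'rV[C]_(d0 + d) -> 'rV[C]_d) = colsub (@rshift d0 d).
    by apply/funext => y; apply/rowP => j; rewrite !mxE.
  have lE : (lsubmx : 'rV[C]_(d0 + d) -> 'rV[C]_d0) = colsub (@lshift d0 d).
    by apply/funext => y; apply/rowP => j; rewrite !mxE.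
  apply: smooth2B.
    by rewrite rE; apply: smooth2_reindex; rewrite -rE; exact: smooth2_analytic phiA (Dz t0).
  by rewrite lE; apply: smooth2_reindex; exact: smooth2_sqnorm.
have r0 : 0 < rho (g (L t0)) by rewrite subr_gt0; have [] := gH t0.
have [A [AJ A11 _]] := smooth2_jets (smooth2_ln rS r0) pY.
have [B [BJ B11 _]] := smooth2_jets (smooth2_sqnorm (F (L t0))) qY.
exists (A - B).
  apply: eq_jet (jetB AJ BJ) => t; rewrite LD [F _ + _]addrC subrK -rmorphB.
  by congr (_%:C).
rewrite pE in A11; rewrite qE in B11.
have E1 : cf A 1 1 = (complex.Re (hartogs_form d0 phi (g (L t0)) ('d g (L t0) v) ('i *: 'd g (L t0) v)))%:C := A11.
have E2 : cf B 1 1 = (complex.Re (flat_form R n (F (L t0)) ('d F (L t0) v) ('i *: 'd F (L t0) v)))%:C := B11.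
by rewrite cfD cfN E1 E2 om_g// subrr.
Qed.

Let jet_u2 t0 : normc t0 <= 1 -> exists A, [/\ jet 3 (fun t => (u2 (t0 + t))%:C) A, cf A 1 1 = 0 &
  t0 = 0 -> Z' t0 = 0 -> cf A 1 0 = 0].
Proof.
move=> t01; have t016 := norm16 t01.
have [p pY pE] := curve_jet_exists dzc t01.
have [A [AJ A11 A10]] := smooth2_jets (smooth2_ln (smooth2_analytic phiA (Dz t0)) (phi0 (Dz t0))) pY.
have [M M0 MP] := Sc_bounded.
have t2 t : normc t <= 1 -> normc (t0 + t) <= 2.
  by move=> t1; apply: le_trans (le_normcD _ _) _; lra.
have dfs j t : normc t < 8 -> cdiff (fun t => fc j (t0 + t)) t (e j ('d f (z (t0 + t)) (Z' (t0 + t)))).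
  move=> t8; apply: cdiff_shift; apply: dfc.
  by apply: le_lt_trans (le_normcD _ _) _; lra.
have [q [B [qO BJ BC]]] := @l2_taylor R (fun j t => fc j (t0 + t)) (fun t => Sc (t0 + t)) M 2 M0
  (fun j t t8 => ex_intro _ _ (dfs j t t8)) (fun t _ => es _) (fun t t1 => MP _ (t2 t t1)).
have q1 j : (q j)`_1 = e j ('d f (z t0) (Z' t0)).
  have z8 : normc (0 : C) < 8 by rewrite normc0.
  have := dfs j 0 z8; rewrite addr0 => H.
  by apply: coef1_cdiff H _; apply: bigO_le (qO j).
(* The Gram coefficient of first derivatives is the squared length of the velocity of [f \o z],
   which by isometry is the Levi coefficient of the potential of the base. *)
have B11 : cf B 1 1 = (s ('d f (z t0) (Z' t0)))%:C.
  apply: csum_uniq (BC 1%N 1%N) _.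
  by apply: eq_csum (rsum_csum (es _)) => j; rewrite q1 normc_sqE.
exists (A - B); split.
- apply: eq_jet (jetB AJ BJ) => t; rewrite [z t0 + _]addrC subrK -rmorphB.
  by congr (_%:C).
- rewrite pE in A11.
  have E1 : cf A 1 1 = (complex.Re (base_form phi (z t0) (Z' t0) ('i *: Z' t0)))%:C := A11.
  by rewrite cfD cfN E1 B11 om_f ?subrr.
- move=> t00 Z0; rewrite cfD cfN A10 ?pE// add0r.
  rewrite (csum_uniq (BC 1%N 0%N) (eq_csum _ (@csum0 R))) ?oppr0// => j.
  have /eqP := bigO_at0 (qO j); rewrite addr0 t00 /fc subrr horner_coef0.
  have -> : e j 0 = 0 by rewrite -(scale0r (0 : V)) eZ mul0r.
  by rewrite sub0r oppr_eq0 => /eqP ->; rewrite conjc0 mulr0.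
Qed.

Lemma line_contradiction : False.
Proof.
have [M M0 MP] := Sc_bounded.
have n8 (t : C) : normc t < 8 -> normc t < 16 by move=> ?; lra.
have z16 : normc (0 : C) < 16 by rewrite normc0.
have z1 : normc (0 : C) <= 1 by rewrite normc0.
apply: (@curve_contradiction R n d0 Fc xic fc Sc Pc M M0).
- by move=> i t /n8 t16; eexists; exact: cdiff_coord (dF t16).
- by move=> i t /n8 t16; eexists; exact: dxic.
- by move=> j t /n8 t16; eexists; exact: dfc.
- by move=> j; rewrite /fc subrr -(scale0r (0 : V)) eZ mul0r.
- by move=> t _; exact: es.
- by move=> t t1; apply: MP; lra.
- by move=> t _; have [] := gH t.
- by move=> t /jet_u1 [A AJ _]; apply: (jet_ccont _ AJ).
- by move=> t /jet_u2 [A [AJ _ _]]; apply: (jet_ccont _ AJ).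
- by move=> t /ltW /jet_u1 [A AJ A11]; apply: (jet_genharm AJ).
- by move=> t /ltW /jet_u2 [A [AJ A11 _]]; apply: (jet_genharm AJ).
have row_neq0 m (y : 'rV[C]_m) : y != 0 -> exists i, y 0 i != 0.
  by move=> /rV0Pn.
(* The velocity in the total space is nonzero. If its base part vanishes, [xi] moves and [u2] has no
   linear term; otherwise injectivity of the differential of [f] makes some coordinate of [f \o z]
   move. *)
have [Z0|Z0] := eqVneq (Z' 0) 0.
  right; have [|i li] := row_neq0 _ (lsubmx ('d g (L 0) v)).
    apply: contra dg0 => /eqP l0; rewrite -['d g _ v]hsubmxK l0 -/(Z' 0) Z0.
    by rewrite row_mx0.
  have [A [AJ _ A10]] := jet_u2 z1.
  exists i, (lsubmx ('d g (L 0) v) 0 i), A; split=> //; first exact: dxic.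
    apply: (@jet_le _ 3) => //; apply: eq_jet AJ => t; by rewrite add0r.
  exact: A10.
left; have [i xi_i] := row_neq0 _ _ xi0.
have [j ej] : exists j, e j ('d f (z 0) (Z' 0)) != 0.
  apply/not_existsP => H; move/eqP: Z0; apply.
  apply: (inj_f (Dz 0)); rewrite [RHS]linear0; apply: e_inj => j.
  by apply/eqP/negPn/negP; exact: H.
by exists i, j, (e j ('d f (z 0) (Z' 0))); split=> //; exact: dfc.
Qed.

End line_contradiction.

Theorem theorem3p9 (R : realType) (d d0 n : nat)
    (D : set 'rV[R[i]]_d) (phi : 'rV[R[i]]_d -> R) :
  (0 < d0)%N -> (0 < n)%N ->
  is_domain D ->
  (forall z, D z -> 0 < phi z) ->
  real_analytic_on D phi ->
  positive_form D (base_form phi) ->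
  positive_form (hartogs d0 D phi) (hartogs_form d0 phi) ->
  is_domain (hartogs d0 D phi) ->
  simply_connected (hartogs d0 D phi) ->
  circular (hartogs d0 D phi) ->
  is_diastasis D (base_form phi) 0 (fun z => - ln (phi z)) ->
  (exists f : 'rV[R[i]]_d -> 'rV[R[i]]_n,
     kahler_immersion D (base_form phi) (flat_form R n) f) \/
  (exists f : 'rV[R[i]]_d -> l2 R,
     kahler_immersion D (base_form phi) (flat_form_l2 R) f) ->
  ~ relatives D (base_form phi) [set: 'rV[R[i]]_n] (flat_form R n) ->
  ~ relatives (hartogs d0 D phi) (hartogs_form d0 phi)
              [set: 'rV[R[i]]_n] (flat_form R n).
Proof.
move=> _ _ _ phi0 phiA _ _ _ _ _ _ imm nrel [k [S [f1 [f2 [k0 [f1H _] if1 if2 pb]]]]].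
have {imm} [V [e [s [K [f [[eD eZ] [eb e_inj] es [hf inj_f] om_f]]]]]] :
    embedding D (base_form phi).
  by case: imm => -[f]; [exact: embedding_flat|exact: embedding_l2].
(* Vanishing is tested on the whole of [S]: if it fails, a point [s0] where it fails is taken as the
   base point of the line. *)
have [l0|] := pselect (forall s, lsubmx (f1 s) = 0).
  exact: nrel (relatives_base k0 f1H l0 if1 if2 pb).
move=> /existsNP [s0 /eqP s0P].
have [i s0i] := cm_cover s0.
pose x := cm_chart i s0; have xi : cm_img i x by exists s0.
have xs0 : cm_inv i x = s0 by exact: cm_chartK.
have [r r0 rP] := open_entries (@cm_img_open _ _ S i) xi.
(* Scaled so that [x + t v] stays in the image of the chart for [|t| < 16]. *)
pose v : 'rV[R[i]]_k := const_mx (r / 16)%:C.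
have img t : normc t < 16 -> cm_img i (x + t *: v).
  move=> t16; apply: rP => j; rewrite !mxE normcM normc_real gtr0_norm ?divr_gt0//.
  by rewrite mulrA ltr_pdivrMr// mulrC ltr_pM2l.
have v0 : v != 0.
  apply/rV0Pn; exists (Ordinal k0); rewrite mxE; apply/eqP => /(congr1 (@complex.Re R))/=.
  by apply/eqP; rewrite gt_eqF// divr_gt0.
have Lx : x + 0 *: v = x by rewrite scale0r addr0.
have [hf1 inj1] := if1 i; have [hf2 _] := if2 i.
pose g := f1 \o cm_inv i; pose F := f2 \o cm_inv i.
have gH t : hartogs d0 D phi (g (x + t *: v)) by exact: f1H.
have dg t : normc t < 16 -> differentiable g (x + t *: v) by move=> /img; exact: hf1.
have dF t : normc t < 16 -> differentiable F (x + t *: v) by move=> /img; exact: hf2.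
have om t : normc t < 16 ->
    hartogs_form d0 phi (g (x + t *: v)) ('d g (x + t *: v) v) ('i *: 'd g (x + t *: v) v) =
    flat_form R n (F (x + t *: v)) ('d F (x + t *: v) v) ('i *: 'd F (x + t *: v) v).
  by move=> /img it; rewrite -!linear_i; exact: pb.
have dg0 : 'd g (x + 0 *: v) v != 0.
  rewrite Lx; apply: contra v0 => /eqP dv0; apply/eqP; apply: (inj1 x xi).
  by rewrite [LHS]dv0 linear0.
have g0 : lsubmx (g (x + 0 *: v)) != 0 by rewrite Lx /g /= xs0.
exact: line_contradiction phi0 phiA eD eZ eb e_inj (fun a => (es a).1)
  (fun a => (es a).2) hf inj_f om_f gH dg dF om dg0 g0.
Qed.
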